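(* Let $s,d,e\ge 1$ be integers, and let $f(t_1,\dots,t_s)$ and $g(t_1,\dots,t_s)$ be general inhomogeneous polynomials of degrees $d$ and $e$, respectively. Then the rational function $h(t)=f(t)/g(t)$ has exactly $$\frac{d(d-1)^s-e(e-1)^s}{d-e}$$ complex critical points if $d\ne e$, and it has exactly $(s+1)(d-1)^s$ complex critical points if $d=e$.
   Context: ''General'' means that the pair $(f,g)$ lies outside a proper Zariski-closed subset of the space of pairs of polynomials of degrees at most $d$ and at most $e$ in $s$ variables. A complex critical point is a point $t\in\mathbb C^s$ in the domain of $h$ at which all partial derivatives of $h$ vanish. *)

(* Defs.v *)
From HB Require Import structures.
From mathcomp Require Import all_boot all_order all_algebra.
From mathcomp Require Import complex.
From mathcomp Require Import boolp classical_sets functions cardinality reals.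
From mathcomp Require Import topology normedtype derive.
(* The notations of mpoly clash with those of the analysis library. *)
From mathcomp Require Import -(notations) mpoly.

Set Implicit Arguments.
Unset Strict Implicit.
Unset Printing Implicit Defensive.

Import Order.TTheory GRing.Theory Num.Theory numFieldNormedType.Exports.

Local Open Scope classical_set_scope.
Local Open Scope ring_scope.

Section PairSpace.
Variables (F : comNzRingType) (s d e : nat).

(* [msize p] is the total degree of [p] plus one (and 0 if [p = 0]). *)
Definition poly_pairs : set (mpoly s F * mpoly s F) :=
  [set fg | (msize fg.1 <= d.+1)%N /\ (msize fg.2 <= e.+1)%N].

Definition pair_monomials : finType :=
  (bmultinom s d.+1 + bmultinom s e.+1)%type.

(* The coordinates on the affine space [poly_pairs]: all the coefficients of
   the two polynomials, including those of the lower-degree monomials. *)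
Definition pair_coords (fg : mpoly s F * mpoly s F) :
    'I_#|pair_monomials| -> F :=
  fun k => match (enum_val k : pair_monomials) with
           | inl m => mcoeff (bmnm m) fg.1
           | inr m => mcoeff (bmnm m) fg.2
           end.

Definition zariski_closed (Z : set (mpoly s F * mpoly s F)) : Prop :=
  exists S : set (mpoly #|pair_monomials| F),
    Z = [set fg | poly_pairs fg /\
                  forall P, S P -> meval (pair_coords fg) P = 0].

Definition holds_for_general_pair (P : set (mpoly s F * mpoly s F)) : Prop :=
  exists Z, [/\ zariski_closed Z, Z `<` poly_pairs & poly_pairs `\` Z `<=` P].

End PairSpace.

Section CriticalPoints.
Variables (R : realType) (s : nat).

Definition eval_at (p : mpoly s R[i]) (t : 'rV[R[i]]_s) : R[i] :=
  meval (fun i => t 0 i) p.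

(* [R[i]^o] is [R[i]] seen as a normed space over itself, so that derivatives
   of [ratfun f g] are complex derivatives. *)
Definition ratfun (f g : mpoly s R[i]) : 'rV[R[i]]_s -> R[i]^o :=
  fun t => eval_at f t / eval_at g t.

(* The domain of f/g is taken to be the locus where g does not vanish; this is
   the domain of the rational function as soon as f and g are coprime, which
   is the case for a general pair. *)
Definition critical_points (f g : mpoly s R[i]) : set 'rV[R[i]]_s :=
  [set t | eval_at g t != 0 /\
           forall i : 'I_s, is_derive t (delta_mx 0 i) (ratfun f g) 0].

End CriticalPoints.

(* Main.v *)
Require Import Defs.
From mathcomp Require Import all_boot all_order all_algebra.
From mathcomp Require Import complex.
From mathcomp Require Import boolp classical_sets functions cardinality reals.
From mathcomp Require Import topology normedtype derive.
From mathcomp Require Import interval_inference.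
From mathcomp Require Import -(notations) mpoly.
From mathcomp Require Import closed_field.
From mathcomp Require Import ring lra zify.

Set Implicit Arguments.
Unset Strict Implicit.
Unset Printing Implicit Defensive.

Import Order.TTheory GRing.Theory Num.Theory numFieldNormedType.Exports.

Local Open Scope classical_set_scope.
Local Open Scope ring_scope.

(** The proof reduces the theorem to one well-chosen pair for each pair of degrees.

    Having exactly [N] critical points is a first-order property of the coefficients of [(f, g)].
    Quantifier elimination over an algebraically closed field makes it a Boolean combination of
    polynomial equations, so that its truth value is the same for all pairs outside some
    hypersurface ([card_generic]). It is therefore enough to exhibit one pair all of whose
    sufficiently small perturbations have exactly [N] critical points ([general_pair_card]): a line
    through this pair contains small perturbations outside the hypersurface.

    A critical point of [f / g] with critical value [l] is a common zero of [f - l g] and of its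
    partial derivatives, a system of [s + 1] equations in [s + 1] unknowns. A nondegenerate zero of
    a square system persists, as exactly one zero, under a small perturbation
    ([nondegenerate_zero_persists], by compactness and a Newton step). If all zeros are
    nondegenerate and the zeros of the perturbed systems stay in a bounded region, then the number
    of zeros is constant ([conservation_of_number]). The region is bounded when the leading forms of
    the equations have no common zero at infinity, where the multiplier [l] is eliminated by taking
    cross products ([no_zeros_at_infinity], [singular_members_bounded]), and when [g] has no
    singular zero, which bounds [l]. The outcome is [general_count_of_example], symmetric in the
    degrees because neither polynomial has a singular zero.

    The examples are sums of univariate polynomials, [f = \sum_i P_i(t_i) + c] and
    [g = \sum_i Q_i(t_i) + c']. Their critical points solve [P_i'(t_i) = l Q_i'(t_i)] for each [i],
    together with one more equation [f = l g]. The former define a union of rational curves;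
    restricted to each of them, the last equation has simple roots for a general constant [c], and
    their number is the degree of a univariate polynomial ([separated_count]).
    - If [d > e], write [gamma = d - e], let [w] have [e - 1] simple roots and choose
      [P_i' = 3 ^ i X ^ gamma w] and [Q_i' = 3 ^ i w]. With [l = mu ^ gamma], each [t_i] is a root
      of [w], or [mu] times a root of unity. This gives degree [d] in [mu] on
      [(d - 1) ^ s - (e - 1) ^ s] curves and degree [gamma] on the other [(e - 1) ^ s]; the sum of
      the degrees is [d (d - 1) ^ s - e (e - 1) ^ s]; each critical point is found [gamma] times.
      The case [d < e] follows by exchanging [f] and [g].
    - If [d = e >= 2], let [w] have [d - 2] simple roots and choose [P_i' = (i X + 1) w] and
      [Q_i' = X w]. Then each [t_i] is a root of [w] or [1 / (l - i)]. A curve with [n] coordinates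
      of the second kind contributes [1 + n (d - 1)], and the sum is [(s + 1) (d - 1) ^ s].
    - If [d = e = 1], the count is [0]. *)

(** * Polynomials in several variables *)

Local Notation widen := (widen_ord (leqnSn _)).

Lemma mpoly_ring_ind (K : nzRingType) n (T : mpoly n K -> Prop) :
  (forall c, T (mpolyC n c)) -> (forall i, T (mpolyX K (mnm1 i))) ->
  (forall P Q, T P -> T Q -> T (P + Q)) -> (forall P Q, T P -> T Q -> T (P * Q)) ->
  forall P, T P.
Proof.
move=> TC TX TD TM P; elim/mpolyind: P => [|c m p _ _ Tp].
  by rewrite -(mpolyC0 n K).
apply: TD Tp; rewrite -mul_mpolyC; apply: (TM) => //; rewrite mpolyXE_id.
have T1 : T 1 by rewrite -(mpolyC1 n K).
elim/big_ind: _ => // i _; elim: (m i) => [|k IH]; first by rewrite expr0.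
by rewrite exprS; exact: TM.
Qed.

Lemma mderivXU (K : nzRingType) n (i j : 'I_n) :
  mderiv i (mpolyX K (mnm1 j)) = mpolyC n (i == j)%:R.
Proof.
rewrite mderivX mnm1E eq_sym; case: eqP => [->|_]; last by rewrite scale0r mpolyC0.
have -> : mnm_sub (mnm1 j) (mnm1 j) = @mnm0 n by apply/mnmP => k; rewrite mnmBE mnm0E subnn.
by rewrite scale1r mpolyX0 mpolyC1.
Qed.

Lemma widen_lift n (i : 'I_n) : widen i = lift ord_max i.
Proof. by apply: val_inj; rewrite /= /bump leqNgt ltn_ord. Qed.

Lemma meval_muni (F : comNzRingType) n (p : mpoly n.+1 F) (v : 'I_n.+1 -> F) :
  meval v p = (map_poly (meval (v \o widen)) (muni p)).[v ord_max].
Proof.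
rewrite muniE rmorph_sum horner_sum mevalE; apply: eq_bigr => m _ /=.
rewrite map_polyZ /= map_polyXn hornerZ hornerXn mevalZ mevalX -mulrA; congr (_ * _).
rewrite big_ord_recr /=; congr (_ * _); apply: eq_bigr => i _; by rewrite mnmE.
Qed.

Lemma muni_eq0 (F : nzRingType) n (p : mpoly n.+1 F) : (muni p == 0) = (p == 0).
Proof.
apply/eqP/eqP => [p0|->]; last by rewrite muni0.
apply/mpolyP => m; rewrite mcoeff0.
pose r (m : multinom n.+1) := Multinom [tuple m (widen i) | i < n].
have := congr1 (fun q : {poly mpoly n F} => mcoeff (r m) q`_(m ord_max)) p0.
rewrite muniE coef0 mcoeff0 coef_sum raddf_sum /=.
have rP m' : (r m' == r m) && (m ord_max == m' ord_max) = (m' == m).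
  apply/andP/eqP => [[/eqP/mnmP e /eqP e']|-> //]; apply/mnmP => i.
  by case: (unliftP ord_max i) => [j ->|-> //]; have := e j; rewrite !mnmE;
    rewrite widen_lift.
rewrite (eq_bigr (fun m' => mcoeff m' p * (m' == m)%:R)); last first.
  move=> m' _; rewrite coefZ coefXn mulr_natr -rP.
  case: eqP => _; rewrite ?andbT ?andbF ?mulr0 ?mulr1n ?mulr0n ?mcoeff0 //.
  by rewrite mcoeffZ mcoeffX.
case: (boolP (m \in msupp p)) => [mp|/memN_msupp_eq0-> //].
rewrite (bigD1_seq m) //= eqxx mulr1 big1 ?addr0 // => m' /negPf->.
by rewrite mulr0.
Qed.

Lemma poly_nonroot (F : numDomainType) (p : {poly F}) :
  p != 0 -> exists k : nat, p.[k%:R] != 0.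
Proof.
move=> p0; apply: contrapT => H; suff : (size p < size p)%N by rewrite ltnn.
rewrite -[X in (X < _)%N](size_iota 0) -(size_map (fun k => k%:R : F)).
apply: max_poly_roots => //.
  apply/allP => _ /mapP[k _ ->]; apply/rootP; apply/eqP/negPn/negP => e.
  by apply: H; exists k.
by rewrite map_inj_uniq ?iota_uniq // => x y /eqP; rewrite eqr_nat => /eqP.
Qed.

Lemma mpoly_nonvanishing (F : numFieldType) n (p : mpoly n F) :
  p != 0 -> exists v, meval v p != 0.
Proof.
elim: n p => [|n IH] p p0.
  exists (fun=> 0); have pC : p = mpolyC 0 (mcoeff (@mnm0 0) p).
    apply/mpolyP => m; have -> : m = (@mnm0 0) by apply/mnmP => -[].
    by rewrite mpolyCK.
  by move: p0; rewrite pC mevalC; apply: contra => /eqP->; rewrite mpolyC0.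
have [v vP] : exists v, meval v (lead_coef (muni p)) != 0.
  by apply: IH; rewrite lead_coef_eq0 muni_eq0.
have /poly_nonroot[k kP] : map_poly (meval v) (muni p) != 0.
  by apply: contra vP => /eqP/(congr1 (fun q : {poly F} => q`_(size (muni p)).-1));
    rewrite coef_map coef0 /= => ->.
exists (fun i => if unlift ord_max i is Some j then v j else k%:R).
rewrite meval_muni /= unlift_none; congr (_.[_] != 0): kP.
by apply: eq_map_poly => q; apply: meval_eq => i /=; rewrite widen_lift liftK.
Qed.

(** * Generic truth of first-order formulas *)

Section Definable.
Variables (F : numClosedFieldType) (n : nat).

Definition generic_value (f : ('I_n -> F) -> bool) (b : bool) : Prop :=
  exists2 Q : mpoly n F, Q != 0 & forall v, meval v Q != 0 -> f v = b.

Lemma generic_value2 (o : bool -> bool -> bool) f g :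
  (exists b, generic_value f b) -> (exists b, generic_value g b) ->
  exists b, generic_value (fun v => o (f v) (g v)) b.
Proof.
move=> [b1 [Q1 Q10 H1]] [b2 [Q2 Q20 H2]]; exists (o b1 b2), (Q1 * Q2); first by rewrite mulf_neq0.
by move=> v; rewrite mevalM mulf_eq0 negb_or => /andP[/H1-> /H2->].
Qed.

Definition env_of (v : 'I_n -> F) : seq F := [seq v i | i <- enum 'I_n].

Lemma nth_env_of v (i : 'I_n) : (env_of v)`_i = v i.
Proof. by rewrite (nth_map i) ?size_enum_ord // nth_ord_enum. Qed.

Lemma size_env_of v : size (env_of v) = n.
Proof. by rewrite size_map size_enum_ord. Qed.

Lemma rterm_mpoly (t : GRing.term F) : GRing.rterm t ->
  exists p : mpoly n F, forall v, GRing.eval (env_of v) t = meval v p.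
Proof.
elim: t => //=.
- move=> k _; have [kn|nk] := ltnP k n.
    exists (mpolyX F (mnm1 (Ordinal kn))) => v.
    by rewrite mevalXU -nth_env_of.
  by exists 0 => v; rewrite meval0 nth_default // size_env_of.
- by move=> c _; exists (mpolyC n c) => v; rewrite mevalC.
- by move=> k _; exists k%:R => v; rewrite rmorph_nat.
- move=> t1 IH1 t2 IH2 /andP[/IH1[p pP] /IH2[q qP]]; exists (p + q) => v.
  by rewrite mevalD pP qP.
- by move=> t IH /IH[p pP]; exists (- p) => v; rewrite mevalN pP.
- by move=> t IH k /IH[p pP]; exists (p *+ k) => v; rewrite mevalMn pP.
- move=> t1 IH1 t2 IH2 /andP[/IH1[p pP] /IH2[q qP]]; exists (p * q) => v.
  by rewrite mevalM pP qP.
- by move=> t IH k /IH[p pP]; exists (p ^+ k) => v; rewrite rmorphXn /= pP.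
Qed.

Lemma qf_generic (f : GRing.formula F) : GRing.qf_form f && GRing.rformula f ->
  exists b, generic_value (fun v => GRing.qf_eval (env_of v) f) b.
Proof.
elim: f => //=.
- by move=> b _; exists b, 1; rewrite ?oner_eq0.
- move=> t1 t2 /andP[/rterm_mpoly[p pP] /rterm_mpoly[q qP]].
  have [e|ne] := eqVneq (p - q) 0.
    exists true, 1; rewrite ?oner_eq0 // => v _; rewrite pP qP.
    by move/eqP: e; rewrite subr_eq0 => /eqP ->; rewrite eqxx.
  exists false, (p - q) => // v; rewrite mevalB subr_eq0 pP qP.
  by move/negPf.
- move=> f1 IH1 f2 IH2 /andP[/andP[a1 b1] /andP[a2 b2]].
  by apply: (generic_value2 andb); [apply: IH1; rewrite a1|apply: IH2; rewrite b1].
- move=> f1 IH1 f2 IH2 /andP[/andP[a1 b1] /andP[a2 b2]].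
  by apply: (generic_value2 orb); [apply: IH1; rewrite a1|apply: IH2; rewrite b1].
- move=> f1 IH1 f2 IH2 /andP[/andP[a1 b1] /andP[a2 b2]].
  by apply: (generic_value2 implb); [apply: IH1; rewrite a1|apply: IH2; rewrite b1].
- by move=> f IH /IH[b [Q Q0 H]]; exists (~~ b), Q => // v /H ->.
Qed.

(** By quantifier elimination, a formula is a Boolean combination of polynomial equations in its
    parameters; each of these is constantly true, or false off a hypersurface. *)
Lemma formula_generic (f : GRing.formula F) :
  exists (Q : mpoly n F) (b : bool), Q != 0 /\
    forall v, meval v Q != 0 -> (GRing.holds (env_of v) f <-> b).
Proof.
have rf := GRing.to_rform_rformula f.
have qeP := GRing.quantifier_elim_rformP (@ClosedFieldQE.wf_ex_elim F)
  (ClosedFieldQE.holds_ex_elim (@solve_monicpoly F)).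
have [b [Q Q0 H]] := qf_generic
  (GRing.quantifier_elim_wf (@ClosedFieldQE.wf_ex_elim F) rf).
exists Q, b; split=> // v /H <-.
by split=> [/GRing.to_rformP h|h]; [apply/qeP | apply/GRing.to_rformP/qeP].
Qed.

End Definable.

(** * Counting solutions by first-order formulas *)

Lemma holds_ands (F : unitRingType) (I : eqType) (e : seq F) (r : seq I) f :
  GRing.holds e (foldr GRing.And (GRing.Bool true) [seq f i | i <- r]) <->
  (forall i, i \in r -> GRing.holds e (f i)).
Proof.
elim: r => [|j r IH] //=; split=> [[hj /IH hr] i|h].
  by rewrite inE => /predU1P[->|/hr].
by split; [apply: h; rewrite mem_head|apply/IH => i ir; apply: h; rewrite inE ir orbT].
Qed.

(** The existence of families of distinct elements is what a first-order formula can express. *)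
Lemma card_eq_families (T : pointedType) (A : set T) N :
  (A #= `I_N)%card <->
  (exists x : nat -> T, (forall k, (k < N)%N -> A (x k)) /\
     {in gtn N &, injective x}) /\
  ~ (exists x : nat -> T, (forall k, (k < N.+1)%N -> A (x k)) /\
     {in gtn N.+1 &, injective x}).
Proof.
have leP n : (exists x : nat -> T, (forall k, (k < n)%N -> A (x k)) /\
     {in gtn n &, injective x}) <-> (`I_n #<= A)%card.
  split=> [[x [xA xi]]|/pcard_leP[f]].
    have /card_esym/card_eqPle[h _] : (x @` `I_n #= `I_n)%card.
      by apply: inj_card_eq => k l; rewrite !inE => kn ln; apply: xi.
    apply: card_le_trans h _; apply: subset_card_le => _ [k kn <-].
    exact: xA.
  exists f; split=> [k kn|k l kn ln e]; first exact: funS.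
  by apply: (@inj _ _ _ f) e; rewrite inE.
rewrite !leP; split=> [e|[h1 h2]].
  split; first by have /card_eqPle[] := e.
  move=> h; have /card_eqPle[/(card_le_trans h)+ _] := e.
  by rewrite card_le_II ltnn.
have [n e] : exists n, (A #= `I_n)%card.
  apply/finite_setP/finite_setPn => h; apply: h2.
  exact/(card_le_trans _ h)/subset_card_le.
have /card_eqPle[en ne] := e.
have -> // : N = n; apply/eqP; rewrite eqn_leq; apply/andP; split.
  by rewrite -card_le_II (card_le_trans h1).
by rewrite leqNgt -card_le_II; apply/negP => h; apply/h2/(card_le_trans h).
Qed.

Section CountingFormula.
Variables (F : numClosedFieldType) (n s : nat).
Variable (A : ('I_n -> F) -> set 'rV[F]_s) (phi : nat -> GRing.formula F).
Hypothesis s_gt0 : (0 < s)%N.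

(** The points of a family are stored one after the other, from position [n] on, behind the [n]
    parameters: [phi k] speaks of the [k]-th of these points. *)
Definition nth_point (e : seq F) (k : nat) : 'rV[F]_s :=
  \row_(i < s) e`_(n + k * s + i).

Hypothesis phiP : forall e k,
  GRing.holds e (phi k) <-> A (fun i : 'I_n => e`_i) (nth_point e k).

Definition same_point (k l : nat) : GRing.formula F :=
  foldr GRing.And (GRing.Bool true)
    [seq GRing.Equal (GRing.Var F (n + k * s + i)) (GRing.Var F (n + l * s + i))
    | i <- iota 0 s].

Lemma holds_same_point e k l :
  GRing.holds e (same_point k l) <-> nth_point e k = nth_point e l.
Proof.
rewrite holds_ands; split=> [h|/rowP h i].
  by apply/rowP => i; rewrite !mxE; apply: (h i); rewrite mem_iota /=.
by rewrite mem_iota => /= i_lt; have := h (Ordinal i_lt); rewrite !mxE.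
Qed.

Definition at_least (N : nat) : GRing.formula F :=
  foldr GRing.Exists
    (GRing.And
       (foldr GRing.And (GRing.Bool true) [seq phi k | k <- iota 0 N])
       (foldr GRing.And (GRing.Bool true)
          [seq GRing.Implies (same_point p.1 p.2) (GRing.Bool (p.1 == p.2))
          | p <- [seq (k, l) | k <- iota 0 N, l <- iota 0 N]]))
    (iota n (N * s)).

Lemma at_leastP v N : GRing.holds (env_of v) (at_least N) <->
  exists x : nat -> 'rV[F]_s, (forall k, (k < N)%N -> A v (x k)) /\
     {in gtn N &, injective x}.
Proof.
rewrite -GRing.foldExistsP; split=> [[e' ee' /= []]|[x [xA xi]]].
  rewrite !holds_ands => hA hi.
  have -> : v = (fun i : 'I_n => e'`_i).
    apply/funext => i; rewrite -nth_env_of ee' //.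
    by rewrite inE mem_iota negb_and -ltnNge ltn_ord.
  exists (nth_point e'); split=> [k kN|k l kN lN].
    by rewrite -phiP; apply: hA; rewrite mem_iota.
  rewrite -holds_same_point => h; apply/eqP.
  have /hi /= : (k, l) \in [seq (k, l) | k <- iota 0 N, l <- iota 0 N].
    by rewrite allpairs_f // mem_iota.
  exact.
(* The parameters are followed by the coordinates of [x 0], ..., [x (N - 1)]. *)
pose e' := mkseq (fun j => if insub j is Some i then v i else
  let q := (j - n)%N in if insub (q %% s)%N is Some i then x (q %/ s)%N 0 i else 0)
  (n + N * s).
have e'n k : (k < N)%N -> nth_point e' k = x k.
  move=> kN; apply/rowP => i; rewrite mxE nth_mkseq; last first.
    rewrite -addnA ltn_add2l (leq_trans (n := (k.+1 * s)%N)) ?leq_mul2r ?kN ?orbT //.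
    by rewrite mulSn addnC ltn_add2r.
  rewrite insubF; last by apply/negbTE; rewrite -leqNgt -addnA leq_addr.
  rewrite /= -addnA addKn modnMDl modn_small // divnMDl // divn_small // addn0.
  by rewrite valK.
have e'v : v = (fun i : 'I_n => e'`_i).
  apply/funext => i; rewrite nth_mkseq; first by rewrite valK.
  exact: leq_trans (leq_addr _ _).
exists e'.
  move=> j; rewrite !inE mem_iota negb_and -ltnNge -leqNgt => /orP[jn|jn].
    by rewrite (nth_env_of v (Ordinal jn)) e'v.
  rewrite !nth_default // ?size_mkseq // size_env_of.
  exact: leq_trans (leq_addr _ _) jn.
split; rewrite holds_ands.
  by move=> k; rewrite mem_iota => kN; rewrite phiP -e'v e'n //; exact: xA.
move=> _ /allpairsP[[k l] [/= + + ->]]; rewrite !mem_iota /= => kN lN.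
by rewrite holds_same_point !e'n // => /xi ->.
Qed.

Lemma card_generic (N : nat) : exists (Q : mpoly n F) (b : bool), Q != 0 /\
  forall v, meval v Q != 0 -> (A v #= `I_N)%card <-> b.
Proof.
have [Q1 [b1 [Q10 H1]]] := formula_generic n (at_least N).
have [Q2 [b2 [Q20 H2]]] := formula_generic n (at_least N.+1).
exists (Q1 * Q2), (b1 && ~~ b2); split; first by rewrite mulf_neq0.
move=> v; rewrite mevalM mulf_eq0 negb_or => /andP[/H1 + /H2].
rewrite !at_leastP => h1 h2; rewrite card_eq_families h1 h2.
by split=> [[-> /negP]|/andP[-> /negP]].
Qed.

End CountingFormula.

(** * Absolute values with compact discs *)

(** What the perturbation arguments use of the complex numbers. The norm of a [numFieldType] takes
    its values in the field itself; minimising and comparing sizes require a real-valued one. *)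
Record proper_absval (K : numFieldType) (R : realType) := ProperAbsval {
  av :> K -> R;
  av_ge0 : forall z, 0 <= av z;
  av_eq0 : forall z, (av z == 0) = (z == 0);
  av_nat : forall k, av k%:R = k%:R;
  avM : forall x y, av (x * y) = av x * av y;
  avD : forall x y, av (x + y) <= av x + av y;
  nbhs_avP : forall (z : K) (A : set K),
    nbhs z A <-> exists2 r : R, 0 < r & forall y, av (y - z) < r -> A y;
  compact_disc : forall r : R, compact [set z : K | av z <= r]
}.

Section ComplexTopology.
Import Normc.
Variable R : realType.
Local Notation C := (complex R : numFieldType).
Implicit Types (z : C).

Lemma norm_normc z : `|z| = (normc z)%:C%C. Proof. by []. Qed.

Lemma normcB_le (x y : C) : normc x - normc y <= normc (x - y).
Proof. by rewrite lerBlDr -{1}(subrK y x); exact: le_normcD. Qed.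

Lemma normc_distC (x y : C) : normc (x - y) = normc (y - x).
Proof. by rewrite -normcN opprB. Qed.

Lemma nbhs_normcP (z : C) (A : set C) :
  nbhs z A <-> exists2 r : R, 0 < r & forall y, normc (y - z) < r -> A y.
Proof.
split=> [/nbhs_ballP[e /= e0 eA]|[r r0 rA]].
  have [a ea] : exists a, e = a%:C%C.
    by exists (complex.Re e); rewrite RRe_real // gtr0_real.
  move: e0; rewrite ea ltcR => a0; exists a => // y ya; apply: eA.
  by rewrite ea -ball_normE /= norm_normc ltcR normc_distC.
apply/nbhs_ballP; exists r%:C%C => /=; first by rewrite ltcR.
move=> y; rewrite -ball_normE /= norm_normc ltcR => yr; apply: rA.
by rewrite normc_distC.
Qed.

Lemma normc_continuous : continuous ((@normc R : C -> R)).
Proof.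
move=> z A /nbhs_ballP[e /= e0 eA]; apply/nbhs_normcP; exists e => // y ye.
apply: eA; rewrite -ball_normE /= ltr_norml.
have := normcB_le y z; have := normcB_le z y; rewrite (normc_distC z).
by move: ye => /=; lra.
Qed.

Lemma normc_ge0 z : 0 <= normc z. Proof. by case: z => a b; exact: sqrtr_ge0. Qed.

Lemma normc_eq0 z : (normc z == 0) = (z == 0).
Proof. by apply/eqP/eqP => [/eq0_normc//|->]; rewrite normc0. Qed.

(** A closed disc is a closed subset of the image of a square. *)
Lemma compact_normc (r : R) : compact [set z : C | normc z <= r].
Proof.
pose f (p : R * R) : C := (p.1 +i* p.2)%C.
have cf : continuous f.
  move=> p A /nbhs_normcP[e e0 eA].
  have e20 : 0 < e / 2 by rewrite divr_gt0.
  have h1 : \forall q \near p, `|p.1 - q.1| < e / 2.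
    have c1 : (q : R * R).1 @[q --> p] --> p.1 by case: (p) => ? ?; exact: cvg_fst.
    by have /cvgr_dist_lt/(_ _ e20) := c1.
  have h2 : \forall q \near p, `|p.2 - q.2| < e / 2.
    have c2 : (q : R * R).2 @[q --> p] --> p.2 by case: (p) => ? ?; exact: cvg_snd.
    by have /cvgr_dist_lt/(_ _ e20) := c2.
  change (\forall q \near p, A (f q)); near=> q; apply: eA.
  have -> : f q - f p = (q.1 - p.1)%:C%C + 'i%C * (q.2 - p.2)%:C%C.
    by rewrite /f; simpc.
  rewrite (le_lt_trans (le_normcD _ _)) // normcM (splitr e) ltrD //.
    rewrite /= expr0n addr0 sqrtr_sqr distrC; near: q; exact: h1.
  rewrite [normc 'i%C]/= [normc _%:C%C]/= !expr0n /= expr1n add0r addr0 sqrtr1 mul1r.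
  by rewrite sqrtr_sqr distrC; near: q; exact: h2.
have cc : compact (f @` (`[- r, r]%classic `*` `[- r, r]%classic)).
  apply: continuous_compact; first exact: continuous_subspaceT.
  by apply: compact_setX; exact: segment_compact.
apply: subclosed_compact cc _.
  have -> : [set z : C | normc z <= r] = (@normc R : C -> R) @^-1` [set x | x <= r] by [].
  apply: closed_comp; last exact: closed_le.
  by move=> z _; exact: normc_continuous.
move=> [a b] /= ab; exists (a, b) => //; have r0 := le_trans (sqrtr_ge0 _) ab.
by split; rewrite /= in_itv /= -ler_norml -sqrtr_sqr (le_trans _ ab) // ler_sqrt
  ?addr_ge0 ?sqr_ge0 // ?lerDl ?lerDr sqr_ge0.
Unshelve. all: by end_near.
Qed.

Lemma normc_nat k : normc (k%:R : R[i]) = k%:R.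
Proof. by rewrite normcMn normc1. Qed.

Definition normc_absval : proper_absval C R :=
  ProperAbsval normc_ge0 normc_eq0 normc_nat (@normcM R) (@le_normcD R) nbhs_normcP compact_normc.

End ComplexTopology.

Section ProperField.
Variables (K : numFieldType) (R : realType) (nu : proper_absval K R).

Lemma av0 : nu 0 = 0. Proof. exact: (av_nat nu 0). Qed.

Lemma av1 : nu 1 = 1. Proof. exact: (av_nat nu 1). Qed.

Lemma avN x : nu (- x) = nu x.
Proof.
suff nuN1 : nu (-1) = 1 by rewrite -mulN1r avM nuN1 mul1r.
apply/eqP; rewrite -(eqrXn2 (n := 2)) ?av_ge0 ?ler01 //.
by rewrite expr1n expr2 -avM mulrNN mulr1 av1.
Qed.

Lemma avB x y : nu (x - y) = nu (y - x). Proof. by rewrite -avN opprB. Qed.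

Lemma av_gt0 x : (0 < nu x) = (x != 0).
Proof. by rewrite lt_def av_ge0 andbT av_eq0. Qed.

Lemma avV x : nu x^-1 = (nu x)^-1.
Proof.
have [->|x0] := eqVneq x 0; first by rewrite invr0 av0 invr0.
have nx0 : nu x != 0 by rewrite av_eq0.
by apply: (mulfI nx0); rewrite -avM !divff // av1.
Qed.

Lemma av_continuous : continuous nu.
Proof.
move=> z A /nbhs_ballP[e /= e0 eA]; apply/(nbhs_avP nu); exists e => // y ye.
apply: eA; rewrite -ball_normE /= ltr_norml.
have := avD nu (y - z) z; have := avD nu (z - y) y; rewrite !subrK (avB z).
by move: ye => /=; lra.
Qed.

Lemma nbhs0_harmonic (A : set K) : nbhs (0 : K) A ->
  \forall k \near \oo, A (k.+1%:R^-1 : K).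
Proof.
move=> /(nbhs_avP nu)[_/posnumP[r] rA]; have := near_infty_natSinv_lt r.
by apply: filterS => k; rewrite -(av_nat nu) -avV => h; apply: rA; rewrite subr0.
Qed.

Section Polydiscs.
Variable n : nat.
Implicit Types x y : 'rV[K]_n.

Definition polydisc x (r : R) : set 'rV[K]_n := [set y | forall i, nu (y 0 i - x 0 i) <= r].

Lemma nbhs_polydisc x r : 0 < r -> nbhs x (polydisc x r).
Proof.
move=> r0; exists (fun i j => [set z | nu (z - x i j) <= r]).
  by move=> i j; apply/(nbhs_avP nu); exists r => // z /ltW.
by move=> y h i; have := h 0 i.
Qed.

Lemma nbhs_polydiscP x (A : set 'rV[K]_n) :
  nbhs x A -> exists2 r, 0 < r & polydisc x r `<=` A.
Proof.
move=> /nbhs_ballP[e /= e0 eA].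
have /(nbhs_avP nu)[r r0 rP] : nbhs (0 : K) (ball (0 : K) e) by apply: nbhsx_ballx.
exists (r / 2); first by rewrite divr_gt0.
move=> y yx; apply: eA; split=> // i j; rewrite (ord1 i).
have := rP (y 0 j - x 0 j); rewrite subr0 -!ball_normE /= sub0r opprB; apply.
by rewrite (le_lt_trans (yx j)) // ltr_pdivrMr // ltr_pMr // ltrDl.
Qed.

Lemma polydisc_center x r : 0 <= r -> polydisc x r x.
Proof. by move=> r0 i; rewrite subrr av0. Qed.

Lemma polydisc_le x r r' : r <= r' -> polydisc x r `<=` polydisc x r'.
Proof. by move=> rr y yx i; exact: le_trans (yx i) rr. Qed.

Lemma compact_polydisc x r : compact (polydisc x r).
Proof.
suff cA i : compact [set z : K | nu (z - x 0 i) <= r].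
  exact: (@rV_compact K n (fun i => [set z | nu (z - x 0 i) <= r]) cA).
have -> : [set z | nu (z - x 0 i) <= r] = (fun z : K => z + x 0 i) @` [set z | nu z <= r].
  apply/seteqP; split=> [z /= zr|_ [z /= zr <-]] /=; last by rewrite addrK.
  by exists (z - x 0 i); rewrite ?subrK.
apply: continuous_compact; last exact: compact_disc.
apply: continuous_subspaceT => z.
by apply: (@cvgD _ _ _ (nbhs z) _ id (fun=> x 0 i)); [apply: cvg_id|apply: cvg_cst].
Qed.

End Polydiscs.
End ProperField.

(** This is an instance of the tube lemma. *)
Lemma no_common_zero_near (X Y : topologicalType) (K : numFieldType) (I : Type)
    (G : I -> X * Y -> K) (A : set X) (y0 : Y) :
  compact A -> (forall i, continuous (G i)) ->
  (forall x, A x -> exists i, G i (x, y0) != 0) ->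
  \forall y \near y0, forall x, A x -> exists i, G i (x, y) != 0.
Proof.
move=> /compact_near_coveringP cA cG G0.
apply: (cA _ (nbhs y0) (fun y x => exists i, G i (x, y) != 0)) => x Ax.
have [i Gi] := G0 x Ax.
have : \forall p \near (x, y0), G i p != 0.
  exact: (cvgr_neq0 _ (cG i (x, y0)) Gi).
by apply: filterS => -[x' y] /= h; exists i.
Qed.

Lemma comp_fst_continuous (X Y Z : topologicalType) (f : X -> Z) :
  continuous f -> continuous (fun p : X * Y => f p.1).
Proof.
move=> cf [x y] A /cf fA; exists (f @^-1` A, setT); last by case=> u v [].
by split=> //; exact: filterT.
Qed.

Lemma comp_snd_continuous (X Y Z : topologicalType) (f : Y -> Z) :
  continuous f -> continuous (fun p : X * Y => f p.2).
Proof.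
move=> cf [x y] A /cf fA; exists (setT, f @^-1` A); last by case=> u v [].
by split=> //; exact: filterT.
Qed.

Lemma pair_continuous_r (X Y : topologicalType) (x : X) : continuous (fun y : Y => (x, y)).
Proof.
move=> y A [[P Q] [/= Px Qy] PQ]; apply: filterS Qy => z Qz; apply: (PQ (x, z)).
by split=> //=; exact: nbhs_singleton.
Qed.

Lemma pair_continuous_l (X Y : topologicalType) (y : Y) : continuous (fun x : X => (x, y)).
Proof.
move=> x A [[P Q] [/= Px Qy] PQ]; apply: filterS Px => z Pz; apply: (PQ (z, y)).
by split=> //=; exact: nbhs_singleton.
Qed.

Section PolynomialContinuity.
Variables (K : numFieldType) (n : nat).
Implicit Types P Q : mpoly n K.

Lemma meval_continuous P : continuous (fun x : 'rV[K]_n => meval (x 0) P).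
Proof.
elim/mpoly_ring_ind: P => [c|i|P Q cP cQ|P Q cP cQ] x.
- rewrite (_ : (fun _ => _) = (fun=> c)); first exact: cst_continuous.
  by apply/funext => y; rewrite mevalC.
- rewrite (_ : (fun _ => _) = (fun y : 'rV[K]_n => y 0 i)); first exact: coord_continuous.
  by apply/funext => y; rewrite mevalXU.
- rewrite (_ : (fun _ => _) = (fun y : 'rV[K]_n => meval (y 0) P + meval (y 0) Q)).
    exact: (cvgD (cP x) (cQ x)).
  by apply/funext => y; rewrite mevalD.
- rewrite (_ : (fun _ => _) = (fun y : 'rV[K]_n => meval (y 0) P * meval (y 0) Q)).
    exact: (cvgM (cP x) (cQ x)).
  by apply/funext => y; rewrite mevalM.
Qed.

(** An expansion of the first order that is exact at finite distance; its coefficients, the divided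
    differences, are built along sums and products. *)
Lemma mpoly_divided_differences P : exists D : 'I_n -> 'rV[K]_n * 'rV[K]_n -> K,
  [/\ forall j, continuous (D j),
      forall x y : 'rV[K]_n, meval (x 0) P - meval (y 0) P = \sum_j D j (x, y) * (x 0 j - y 0 j)
    & forall j (x : 'rV[K]_n), D j (x, x) = meval (x 0) (mderiv j P)].
Proof.
have cfst Q := comp_fst_continuous (Y := 'rV[K]_n) (@meval_continuous Q).
have csnd Q := comp_snd_continuous (X := 'rV[K]_n) (@meval_continuous Q).
elim/mpoly_ring_ind: P => [c|i|P Q [D [cD DP Dd]] [E [cE EP Ed]]|
    P Q [D [cD DP Dd]] [E [cE EP Ed]]].
- exists (fun _ _ => 0); split=> [j p|x y|j x]; first exact: cst_continuous.
    by rewrite !mevalC subrr big1 // => j _; rewrite mul0r.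
  by rewrite mderivC meval0.
- exists (fun j _ => (i == j)%:R); split=> [j p|x y|j x]; first exact: cst_continuous.
    rewrite !mevalXU (bigD1 i) //= eqxx mul1r big1 ?addr0 // => j.
    by rewrite eq_sym => /negPf ->; rewrite mul0r.
  by rewrite mderivXU mevalC eq_sym.
- exists (fun j p => D j p + E j p); split=> [j p|x y|j x].
  + exact: (cvgD (cD j p) (cE j p)).
  + rewrite !mevalD opprD addrACA DP EP -big_split; apply: eq_bigr => j _.
    by rewrite mulrDl.
  + by rewrite mderivD mevalD Dd Ed.
- exists (fun j p => D j p * meval (p.1 0) Q + meval (p.2 0) P * E j p).
  split=> [j p|x y|j x].
  + exact: (cvgD (cvgM (cD j p) (cfst Q p)) (cvgM (csnd P p) (cE j p))).
  + have -> : meval (x 0) (P * Q) - meval (y 0) (P * Q) =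
      (meval (x 0) P - meval (y 0) P) * meval (x 0) Q +
      meval (y 0) P * (meval (x 0) Q - meval (y 0) Q) by rewrite !mevalM; ring.
    rewrite DP EP mulr_suml mulr_sumr -big_split; apply: eq_bigr => j _ /=; ring.
  + by rewrite mderivM mevalD !mevalM Dd Ed.
Qed.

End PolynomialContinuity.

(** * Persistence of nondegenerate zeros *)

Lemma det_continuous (T : topologicalType) (K : numFieldType) n (M : T -> 'M[K]_n) :
  (forall i j, continuous (fun t => M t i j)) -> continuous (fun t => \det (M t)).
Proof.
move=> cM; apply: continuous_big => [|/= s _]; first exact: add_continuous.
move=> t; apply: cvgM; first exact: cvg_cst.
pose f (i : 'I_n) t := M t i (perm.fun_of_perm s i).
have := @continuous_big K 'I_n _ 1 xpredT (@mul_continuous K) T (index_enum _) f.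
by apply=> i _; exact: cM.
Qed.

Section Persistence.
Variables (K : numFieldType) (R : realType) (nu : proper_absval K R) (n : nat).
Implicit Types (F : 'I_n -> mpoly n K) (x y : 'rV[K]_n).

Definition common_zero F : set 'rV[K]_n := [set x | forall i, meval (x 0) (F i) = 0].

Definition jacobian F x : 'M[K]_n := \matrix_(i, j) meval (x 0) (mderiv j (F i)).

Definition perturb F F1 (eps : K) : 'I_n -> mpoly n K := fun i => F i + eps *: F1 i.

Lemma meval_perturb F F1 eps i x :
  meval (x 0) (perturb F F1 eps i) = meval (x 0) (F i) + eps * meval (x 0) (F1 i).
Proof. by rewrite mevalD mevalZ. Qed.

Lemma perturb_continuous F F1 i :
  continuous (fun p : 'rV[K]_n * K => meval (p.1 0) (perturb F F1 p.2 i)).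
Proof.
rewrite (_ : (fun _ => _) = (fun p : 'rV[K]_n * K =>
  meval (p.1 0) (F i) + p.2 * meval (p.1 0) (F1 i))); last first.
  by apply/funext => p; rewrite meval_perturb.
have c1 := comp_fst_continuous (Y := K) (@meval_continuous _ _ (F i)).
have c2 := comp_fst_continuous (Y := K) (@meval_continuous _ _ (F1 i)).
have c3 := comp_snd_continuous (X := 'rV[K]_n) (fun z : K => @cvg_id _ (nbhs z)).
by move=> p; exact: (cvgD (c1 p) (cvgM (c3 p) (c2 p))).
Qed.

Definition open_polydisc x (r : R) : set 'rV[K]_n := [set y | forall i, nu (y 0 i - x 0 i) < r].

Lemma open_open_polydisc x r : open (open_polydisc x r).
Proof.
rewrite openE => y yx; exists (fun i j => [set z | nu (z - x i j) < r]).
  move=> i j; rewrite (ord1 i); apply/(nbhs_avP nu).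
  exists (r - nu (y 0 j - x 0 j)); first by rewrite subr_gt0.
  move=> z zy /=; have := avD nu (z - y 0 j) (y 0 j - x 0 j).
  by rewrite addrA subrK; move: zy; lra.
by move=> z h i; exact: h.
Qed.

Lemma open_polydisc_sub x r : open_polydisc x r `<=` polydisc nu x r.
Proof. by move=> y h i; exact: ltW. Qed.

(** The difference of two zeros lies in the kernel of this matrix, which is invertible close to a
    nondegenerate zero. *)
Lemma divided_difference_matrix F F1 : exists M : ('rV[K]_n * 'rV[K]_n) * K -> 'M[K]_n,
  [/\ forall i j, continuous (fun p => M p i j),
      forall x y eps i, meval (x 0) (perturb F F1 eps i) - meval (y 0) (perturb F F1 eps i) =
        \sum_j M ((x, y), eps) i j * (x 0 j - y 0 j)
    & forall x, M ((x, x), 0) = jacobian F x].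
Proof.
have [D DP] := choice (fun i => mpoly_divided_differences (F i)).
have [E EP] := choice (fun i => mpoly_divided_differences (F1 i)).
exists (fun p => \matrix_(i, j) (D i j p.1 + p.2 * E i j p.1)); split.
- move=> i j; rewrite (_ : (fun _ => _) =
    (fun p : ('rV[K]_n * 'rV[K]_n) * K => D i j p.1 + p.2 * E i j p.1)); last first.
    by apply/funext => p; rewrite mxE.
  have [/(_ j) cD _ _] := DP i; have [/(_ j) cE _ _] := EP i.
  have c1 := comp_fst_continuous (Y := K) cD; have c2 := comp_fst_continuous (Y := K) cE.
  have c3 := comp_snd_continuous (X := ('rV[K]_n * 'rV[K]_n)%type)
    (fun z : K => @cvg_id _ (nbhs z)).
  by move=> p; exact: (cvgD (c1 p) (cvgM (c3 p) (c2 p))).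
- move=> x y eps i; have [_ dD _] := DP i; have [_ dE _] := EP i.
  rewrite !meval_perturb opprD addrACA -mulrBr dD dE mulr_sumr -big_split.
  by apply: eq_bigr => j _; rewrite mxE /= mulrDl mulrA.
- move=> x; apply/matrixP => i j; rewrite !mxE mul0r addr0.
  by have [_ _ ->] := DP i.
Qed.

Lemma unit_ker (M : 'M[K]_n) (v : 'rV[K]_n) :
  \det M != 0 -> (forall i, \sum_j M i j * v 0 j = 0) -> v = 0.
Proof.
move=> M0 h; have Mv : M *m v^T = 0.
  by apply/colP => i; rewrite !mxE -[RHS](h i); apply: eq_bigr => j _; rewrite mxE.
have uM : M \in unitmx by rewrite unitmxE unitfE.
have : v^T = 0 by rewrite -[LHS](mulKmx uM) Mv mulmx0.
by move/(congr1 trmx); rewrite trmxK trmx0.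
Qed.

(** Minimising [sum_i |F_i|] over a polydisc produces the zero: the minimum is not attained on the
    boundary, and at an interior point where it is positive a Newton step decreases it, because
    the matrix of divided differences is invertible. *)
Lemma nondegenerate_zero_persists F F1 x0 (U : set 'rV[K]_n) :
  common_zero F x0 -> \det (jacobian F x0) != 0 -> nbhs x0 U ->
  exists2 r : R, 0 < r & polydisc nu x0 r `<=` U /\
    \forall eps \near (0 : K), exists x,
      [/\ polydisc nu x0 r x, common_zero (perturb F F1 eps) x &
        forall y, polydisc nu x0 r y -> common_zero (perturb F F1 eps) y -> y = x].
Proof.
move=> Fx0 J0 Ux0; have [M [cM MP MJ]] := divided_difference_matrix F F1.
have cdet := det_continuous cM.
have [[A B] [/= [[A1 A2] [/= A1n A2n] A12] Bn] AB] :
    \forall p \near ((x0, x0), 0 : K), \det (M p) != 0.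
  by apply: (cvgr_neq0 _ (cdet _)); rewrite MJ.
have [r r0 rS] : exists2 r, 0 < r & polydisc nu x0 r `<=` U `&` (A1 `&` A2).
  by apply: nbhs_polydiscP; do ?apply: filterI.
have detM x y eps : polydisc nu x0 r x -> polydisc nu x0 r y -> B eps ->
    \det (M ((x, y), eps)) != 0.
  move=> /rS[_ [A1x _]] /rS[_ [_ A2y]] Beps; apply: (AB ((x, y), eps)); split=> //=.
  exact: (A12 (x, y)).
have inj x y eps : polydisc nu x0 r x -> polydisc nu x0 r y -> B eps ->
    common_zero (perturb F F1 eps) x -> common_zero (perturb F F1 eps) y -> x = y.
  move=> xr yr Be zx zy; apply/eqP; rewrite -subr_eq0; apply/eqP.
  apply: unit_ker (detM _ _ _ xr yr Be) _ => i.
  have e := MP x y eps i; rewrite zx zy subrr in e.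
  by rewrite [RHS]e; apply: eq_bigr => j _; rewrite !mxE.
exists r => //; split; first by move=> y /rS[].
pose N (p : 'rV[K]_n * K) := \sum_i nu (meval (p.1 0) (perturb F F1 p.2 i)).
have cN : continuous N.
  apply: continuous_big => [|/= i _]; first exact: add_continuous.
  move=> p; apply: (@continuous_comp _ _ _ _ nu); first exact: perturb_continuous.
  exact: av_continuous.
have N_ge0 p : 0 <= N p by apply: sumr_ge0 => i _; exact: av_ge0.
have N0P x eps : N (x, eps) = 0 -> common_zero (perturb F F1 eps) x.
  move=> /eqP; rewrite psumr_eq0 => [/allP h i|i _]; last exact: av_ge0.
  by apply/eqP; rewrite -(av_eq0 nu); apply: h; rewrite mem_index_enum.
have pert0 x : common_zero (perturb F F1 0) x <-> common_zero F x.
  by split=> h i; have := h i; rewrite meval_perturb mul0r addr0.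
pose S := polydisc nu x0 r `&` ~` open_polydisc x0 r.
have cS : compact S.
  by apply: compact_closedI; [exact: compact_polydisc|apply/open_closedC/open_open_polydisc].
(* The minimum is not attained on the boundary [S]. *)
have bdry : \forall eps \near (0 : K), S `<=` [set x | N (x0, eps) < N (x, eps)].
  move/compact_near_coveringP: cS => cS.
  apply: (cS _ (nbhs (0 : K)) (fun eps x => N (x0, eps) < N (x, eps))) => x [xr xS].
  have N00 : N (x0, 0) = 0.
    rewrite /N big1 // => i _; apply/eqP; rewrite av_eq0; apply/eqP.
    by have /pert0 -> := Fx0.
  have Nx : 0 < N (x, 0) - N (x0, 0).
    rewrite N00 subr0 lt_def N_ge0 andbT; apply/eqP => /N0P Fx; apply: xS.
    rewrite (inj x x0 0) //; first by move=> i; rewrite subrr av0.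
    - by apply: polydisc_center; exact: ltW.
    - exact: nbhs_singleton.
    - exact/pert0.
  pose g (e : K) : R := N (x0, e).
  have cg : continuous g.
    move=> e; apply: (@continuous_comp _ _ _ (fun e => (x0, e)) N); last exact: cN.
    exact: pair_continuous_r.
  have cg2 : continuous (fun p : 'rV[K]_n * K => g p.2) := comp_snd_continuous cg.
  have c2 : {for (x, 0), continuous (fun p : 'rV[K]_n * K => N p - g p.2)}.
    exact: (cvgB (cN (x, 0)) (cg2 (x, 0))).
  have h : \forall p \near ((x : 'rV[K]_n), 0 : K), 0 < N p - g p.2 by exact: (cvgr_gt _ c2).
  apply: filterS h => -[x' e] /=.
  by rewrite subr_gt0.
apply: filterS2 Bn bdry => eps Beps bd.
have [c cr cmin] : exists2 c, c \in polydisc nu x0 r &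
    forall t, t \in polydisc nu x0 r -> N (c, eps) <= N (t, eps).
  apply: compact_EVT_min; first by exists x0; apply: polydisc_center; exact: ltW.
    exact: compact_polydisc.
  apply: continuous_subspaceT => x.
  apply: (@continuous_comp _ _ _ (fun x => (x, eps)) N); last exact: cN.
  exact: pair_continuous_l.
move: cr; rewrite inE => cr.
suff /N0P Nc : N (c, eps) = 0 by exists c; split=> // y yr Fy; apply: inj Fy Nc.
apply/eqP; apply: contrapT => /negP Nc0.
have Ncpos : 0 < N (c, eps) by rewrite lt_def Nc0 N_ge0.
have co : open_polydisc x0 r c.
  apply: contrapT => cS'; have : N (x0, eps) < N (c, eps) by apply: bd.
  by rewrite ltNge cmin // inE; apply: polydisc_center; exact: ltW.
(* The Newton direction [v] at the minimiser [c]. *)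
pose w i := meval (c 0) (perturb F F1 eps i).
pose W := \col_i w i; pose Mc := M ((c, c), eps).
have uMc : Mc \in unitmx by rewrite unitmxE unitfE; exact: detM.
pose v : 'rV[K]_n := - (invmx Mc *m W)^T.
pose newton (t : K) := c + t *: v.
have newtonc : continuous newton.
  by move=> t; exact: (cvgD (cvg_cst c) (@scalel_continuous _ _ v t)).
pose defect i t := w i + \sum_j M ((newton t, c), eps) i j * v 0 j.
have defectc i : continuous (defect i).
  have cm j : continuous (fun t => M ((newton t, c), eps) i j).
    move=> t.
    apply: (@continuous_comp _ _ _ (fun t => ((newton t, c), eps)) (fun p => M p i j));
      last exact: cM.
    apply: (@continuous_comp _ _ _ (fun t => (newton t, c)) (fun p => (p, eps)));
      last exact: pair_continuous_l.
    apply: (@continuous_comp _ _ _ newton (fun x => (x, c))); first exact: newtonc.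
    exact: pair_continuous_l.
  pose f j t := M ((newton t, c), eps) i j * v 0 j.
  have cf : continuous (fun t => \sum_j f j t).
    have := @continuous_big K 'I_n _ 0 xpredT (@add_continuous K) K (index_enum _) f.
    by apply=> j _ u; exact: (cvgM (cm j u) (cvg_cst (v 0 j))).
  by move=> t; exact: (cvgD (cvg_cst (w i)) (cf t)).
pose E t := \sum_i nu (defect i t).
have Ec : continuous E.
  apply: continuous_big => [|/= i _]; first exact: add_continuous.
  by move=> t; apply: (@continuous_comp _ _ _ _ nu); [exact: defectc|exact: av_continuous].
have E0 : E 0 = 0.
  rewrite /E big1 // => i _; apply/eqP; rewrite av_eq0; apply/eqP.
  have e : (Mc *m v^T) i 0 = - w i.
    by rewrite /v linearN /= trmxK mulmxN mulKVmx // !mxE.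
  rewrite /defect /newton scale0r addr0 -[RHS](subrr (w i)) -e mxE.
  by congr (_ + _); apply: eq_bigr => j _; rewrite [v^T _ _]mxE.
have near_small : \forall t \near (0 : K), E t < N (c, eps) by
  apply: (cvgr_lt _ (Ec 0)); rewrite E0.
have near_in : \forall t \near (0 : K), open_polydisc x0 r (newton t).
  apply: newtonc; apply: open_nbhs_nbhs; split; first exact: open_open_polydisc.
  by rewrite /newton scale0r addr0.
have [k [Ek ck]] := filter_ex (nbhs0_harmonic nu (filterI near_small near_in)).
set t : K := k.+1%:R^-1 in Ek ck.
(* A step of length [t] multiplies the value by [1 - t], up to [t] times a small defect. *)
have step i : meval (newton t 0) (perturb F F1 eps i) = (1 - t) * w i + t * defect i t.
  have -> : meval (newton t 0) (perturb F F1 eps i) =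
      w i + t * (\sum_j M (newton t, c, eps) i j * v 0 j).
    rewrite -[LHS](subrK (w i)) addrC MP; congr (_ + _); rewrite mulr_sumr.
    by apply: eq_bigr => j _; rewrite !mxE addrAC subrr add0r mulrCA.
  by rewrite /defect; ring.
have nut : nu t = k.+1%:R^-1 by rewrite avV av_nat.
have nu1t : nu (1 - t) = 1 - k.+1%:R^-1.
  have k0 : (k.+1%:R : K) != 0 by rewrite pnatr_eq0.
  have k0' : (k.+1%:R : R) != 0 by rewrite pnatr_eq0.
  have -> : 1 - t = k%:R / k.+1%:R.
    by apply: (mulIf k0); rewrite mulrBl mul1r mulVf // divfK // -natr1 addrK.
  rewrite avM avV !av_nat; apply: (mulIf k0').
  by rewrite mulrBl mul1r mulVf // divfK // -natr1 addrK.
suff : N (newton t, eps) < N (c, eps).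
  by rewrite ltNge cmin // inE; apply: open_polydisc_sub.
have : N (newton t, eps) <= (1 - k.+1%:R^-1) * N (c, eps) + k.+1%:R^-1 * E t.
  rewrite /N /E !mulr_sumr -big_split ler_sum // => i _ /=.
  by rewrite step (le_trans (avD _ _ _)) // !avM nut nu1t.
move/le_lt_trans; apply.
have kpos : 0 < (k.+1%:R : R)^-1 by rewrite invr_gt0 ltr0n.
by rewrite mulrBl mul1r -addrA gtrDl addrC subr_lt0 ltr_pM2l.
Qed.

End Persistence.

(** * Conservation of the number of zeros *)

Lemma near_all_seq (T : eqType) (I : Type) (F : set_system I) (FF : Filter F)
    (r : seq T) (P : T -> I -> Prop) :
  (forall x, x \in r -> \forall i \near F, P x i) ->
  \forall i \near F, forall x, x \in r -> P x i.
Proof.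
elim: r => [_|x r IH h]; first by apply: nearW => i x; rewrite in_nil.
have hr : \forall i \near F, forall y, y \in r -> P y i.
  by apply: IH => y yr; apply: h; rewrite inE yr orbT.
apply: filterS2 (h x (mem_head _ _)) hr => i Px Pr y.
by rewrite inE => /predU1P[->//|]; exact: Pr.
Qed.

Section Conservation.
Variables (K : numFieldType) (R : realType) (nu : proper_absval K R) (n : nat).
Implicit Types (F : 'I_n -> mpoly n K) (x y : 'rV[K]_n).

Lemma polydisc_separation x y : x != y ->
  exists2 r : R, 0 < r & forall z, polydisc nu x r z -> polydisc nu y r z -> False.
Proof.
move=> xy; have [i xyi] : exists i, x 0 i != y 0 i.
  apply/not_existsP => h; move/eqP: xy; apply; apply/rowP => i.
  by apply/eqP/negPn/negP; exact: h.
have e0 : 0 < nu (x 0 i - y 0 i) by rewrite av_gt0 subr_eq0.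
exists (nu (x 0 i - y 0 i) / 3); first by rewrite divr_gt0.
move=> z /(_ i) zx /(_ i) zy; have := avD nu (x 0 i - z 0 i) (z 0 i - y 0 i).
rewrite addrA subrK (avB nu (x 0 i) (z 0 i)) leNgt => /negP; apply.
by move: zx zy e0; lra.
Qed.

(** Outside small polydiscs around the unperturbed zeros, the bounded region is compact and
    contains no zero, hence none after a small perturbation; in each of these polydiscs there is
    exactly one. *)
Theorem conservation_of_number F F1 (xs : seq 'rV[K]_n) (W : 'rV[K]_n -> K -> Prop) (rho : R) :
  uniq xs -> (forall x, common_zero F x <-> x \in xs) ->
  (forall x, x \in xs -> \det (jacobian F x) != 0) ->
  (forall x, x \in xs -> \forall y \near x & eps \near (0 : K), W y eps) ->
  (\forall eps \near (0 : K), common_zero (perturb F F1 eps) `<=` polydisc nu 0 rho) ->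
  \forall eps \near (0 : K), exists ys : seq 'rV[K]_n,
    [/\ size ys = size xs, uniq ys, forall y, common_zero (perturb F F1 eps) y <-> y \in ys
      & forall y, y \in ys -> W y eps].
Proof.
move=> uxs xsP Jxs Wxs bnd.
have [d d0 dP] : exists2 d : R, 0 < d & forall x y, x \in xs -> y \in xs -> x != y ->
    forall z, polydisc nu x d z -> polydisc nu y d z -> False.
  have : \forall d \near (0 : R)^'+, forall x, x \in xs -> forall y, y \in xs -> x != y ->
      forall z, polydisc nu x d z -> polydisc nu y d z -> False.
    apply: near_all_seq => x _; apply: near_all_seq => y _.
    have [->|/polydisc_separation[r r0 rP]] := eqVneq x y; first by apply: nearW.
    have := nbhs_right_lt r0; apply: filterS => d dr _ z zx zy.
    by apply: (rP z); apply: polydisc_le (ltW dr) _ _.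
  move=> h; have [d [d0 dP]] := filter_ex (filterI (nbhs_right_gt 0) h).
  by exists d => // x y xx yy; exact: dP.
pose isolated eps x r y := [/\ polydisc nu x r y, common_zero (perturb F F1 eps) y, W y eps &
  forall z, polydisc nu x r z -> common_zero (perturb F F1 eps) z -> z = y].
have local x : exists r, x \in xs -> [/\ 0 < r, polydisc nu x r `<=` polydisc nu x d &
   \forall eps \near (0 : K), exists y, isolated eps x r y].
  have [xx|_] := boolP (x \in xs); last by exists 0.
  have [[W1 W2] [/= W1n W2n] W12] := Wxs _ xx.
  have Ux : nbhs x (W1 `&` polydisc nu x d).
    by apply: filterI => //; exact: nbhs_polydisc.
  have [r r0 [rW rP]] := nondegenerate_zero_persists nu F1 ((xsP x).2 xx) (Jxs _ xx) Ux.
  exists r => _; split=> //; first by move=> y /rW[].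
  apply: filterS2 W2n rP => eps W2e [y [yr Fy uy]]; exists y; split=> //.
  by apply: (W12 (y, eps)); split=> //=; have [] := rW _ yr.
have [r rP] := choice local.
pose A := polydisc nu 0 rho `&` ~` (\bigcup_(x in [set` xs]) open_polydisc nu x (r x)).
have cA : compact A.
  apply: compact_closedI; first exact: compact_polydisc.
  by apply/open_closedC/bigcup_open => x _; exact: open_open_polydisc.
have noA : \forall eps \near (0 : K), forall x, A x ->
    exists i, meval (x 0) (perturb F F1 eps i) != 0.
  apply: (no_common_zero_near (G := fun i (p : 'rV[K]_n * K) =>
    meval (p.1 0) (perturb F F1 p.2 i)) cA).
    by move=> i; exact: perturb_continuous.
  move=> x [_ xA] /=; apply/not_existsP => h; apply: xA.
  have xx : x \in xs.
    apply/xsP => i; apply/eqP/negPn/negP => /negP h'; apply: (h i).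
    by rewrite meval_perturb mul0r addr0; apply/negP.
  exists x => //= i; rewrite subrr av0; by have [] := rP _ xx.
have loc : \forall eps \near (0 : K), forall x, x \in xs -> exists y, isolated eps x (r x) y.
  apply: (@near_all_seq _ _ (nbhs (0 : K)) _ xs (fun x eps => exists y, isolated eps x (r x) y)).
  by move=> x /rP[].
apply: filterS3 bnd noA loc => eps bnd noA loc.
have {loc} /choice[f fP] x : exists y, x \in xs -> isolated eps x (r x) y.
  by have [/loc[y yP]|_] := boolP (x \in xs); [exists y|exists 0].
have sub x : x \in xs -> polydisc nu x (r x) `<=` polydisc nu x d by move/rP => [].
exists (map f xs); split; first by rewrite size_map.
- rewrite map_inj_in_uniq // => x y xx yy e; apply/eqP; apply: contrapT => /negP xy.
  have [fx _ _ _] := fP _ xx; have [fy _ _ _] := fP _ yy.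
  apply: (dP x y xx yy xy (f x)); first exact: sub _ xx _ fx.
  by rewrite e; exact: sub _ yy _ fy.
- move=> y; split=> [Fy|/mapP[x /fP[_ + _ _ ->]] //].
  have [x xx yx] : (\bigcup_(x in [set` xs]) open_polydisc nu x (r x)) y.
    apply: contrapT => yU; have [|i] := noA y; first by split=> //; exact: bnd.
    by rewrite Fy eqxx.
  have [_ _ _ u] := fP _ xx; rewrite (u y) ?map_f //.
  exact: open_polydisc_sub.
- by move=> _ /mapP[x xx ->]; have [] := fP _ xx.
Qed.

End Conservation.

(** * The Lagrange system of a quotient *)

Section LagrangeSystem.
Variables (K : fieldType) (s : nat).
Implicit Types (f g : mpoly s K) (t : 'rV[K]_s) (x : 'rV[K]_s.+1).

Lemma meval_mwiden f (v : 'I_s.+1 -> K) : meval v (mwiden f) = meval (v \o widen) f.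
Proof.
elim/mpoly_ring_ind: f => [c|i|p q IHp IHq|p q IHp IHq].
- by rewrite mwidenC !mevalC.
- by rewrite mwidenX mnmwiden1 !mevalXU.
- by rewrite mwidenD !mevalD IHp IHq.
- by rewrite mwidenM !mevalM IHp IHq.
Qed.

Lemma mderiv_mwiden f i : mderiv (widen i) (mwiden f) = mwiden (mderiv i f).
Proof.
elim/mpoly_ring_ind: f => [c|j|p q IHp IHq|p q IHp IHq].
- by rewrite mwidenC !mderivC mwiden0.
- by rewrite mwidenX mnmwiden1 !mderivXU mwidenC -val_eqE.
- by rewrite mwidenD !mderivD IHp IHq mwidenD.
- by rewrite mwidenM !mderivM IHp IHq mwidenD !mwidenM.
Qed.

Lemma mderiv_mwiden_max f : mderiv ord_max (mwiden f) = 0.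
Proof.
elim/mpoly_ring_ind: f => [c|j|p q IHp IHq|p q IHp IHq].
- by rewrite mwidenC mderivC.
- by rewrite mwidenX mnmwiden1 mderivXU -val_eqE /= gtn_eqF // mpolyC0.
- by rewrite mwidenD mderivD IHp IHq addr0.
- by rewrite mwidenM mderivM IHp IHq mulr0 mul0r addr0.
Qed.

Definition with_multiplier t (l : K) : 'rV[K]_s.+1 :=
  \row_k if unlift ord_max k is Some i then t 0 i else l.

Definition base_point x : 'rV[K]_s := \row_i x 0 (widen i).

Lemma with_multiplier_max t l : with_multiplier t l 0 ord_max = l.
Proof. by rewrite mxE unlift_none. Qed.

Lemma with_multiplier_widen t l i : with_multiplier t l 0 (widen i) = t 0 i.
Proof. by rewrite mxE widen_lift liftK. Qed.

Lemma base_pointK x : with_multiplier (base_point x) (x 0 ord_max) = x.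
Proof.
apply/rowP => k; case: (unliftP ord_max k) => [i ->|->].
  by rewrite -widen_lift with_multiplier_widen mxE.
by rewrite with_multiplier_max.
Qed.

Lemma with_multiplierK t l : base_point (with_multiplier t l) = t.
Proof. by apply/rowP => i; rewrite mxE with_multiplier_widen. Qed.

(** The polynomial [f - l g] and its partial derivatives in the original variables; the multiplier
    [l] is the last variable. A common zero is a critical point of [f / g] together with its
    critical value, or a point where [f] and [g] vanish with proportional differentials. *)
Definition lagrange f g : 'I_s.+1 -> mpoly s.+1 K := fun k =>
  if unlift ord_max k is Some i
  then mwiden (mderiv i f) - mpolyX K (mnm1 ord_max) * mwiden (mderiv i g)
  else mwiden f - mpolyX K (mnm1 ord_max) * mwiden g.

Lemma lagrange_max f g :
  lagrange f g ord_max = mwiden f - mpolyX K (mnm1 ord_max) * mwiden g.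
Proof. by rewrite /lagrange unlift_none. Qed.

Lemma lagrange_widen f g i : lagrange f g (widen i) =
  mwiden (mderiv i f) - mpolyX K (mnm1 ord_max) * mwiden (mderiv i g).
Proof. by rewrite /lagrange widen_lift liftK. Qed.

Lemma meval_base x f : meval (x 0 \o widen) f = meval (base_point x 0) f.
Proof. by apply: meval_eq => i /=; rewrite mxE. Qed.

Lemma meval_lagrange_max f g x : meval (x 0) (lagrange f g ord_max) =
  meval (base_point x 0) f - x 0 ord_max * meval (base_point x 0) g.
Proof. by rewrite lagrange_max mevalB mevalM mevalXU !meval_mwiden !meval_base. Qed.

Lemma meval_lagrange_widen f g x i : meval (x 0) (lagrange f g (widen i)) =
  meval (base_point x 0) (mderiv i f) - x 0 ord_max * meval (base_point x 0) (mderiv i g).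
Proof. by rewrite lagrange_widen mevalB mevalM mevalXU !meval_mwiden !meval_base. Qed.

Lemma lagrange_perturb f g f1 g1 eps :
  lagrange (f + eps *: f1) (g + eps *: g1) =1
  (fun k => lagrange f g k + eps *: lagrange f1 g1 k).
Proof.
move=> k; case: (unliftP ord_max k) => [i ->|->]; rewrite -?widen_lift.
  rewrite !lagrange_widen !mderivD !mderivZ !mwidenD !mwidenZ.
  by rewrite mulrDr opprD addrACA -scalerAr -scalerBr.
rewrite !lagrange_max !mwidenD !mwidenZ.
by rewrite mulrDr opprD addrACA -scalerAr -scalerBr.
Qed.

Definition multiplier_point f g t (l : K) : Prop :=
  meval (t 0) f = l * meval (t 0) g /\
  forall i, meval (t 0) (mderiv i f) = l * meval (t 0) (mderiv i g).

Lemma lagrange_zeroP f g x : (forall k, meval (x 0) (lagrange f g k) = 0) <->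
  multiplier_point f g (base_point x) (x 0 ord_max).
Proof.
split=> [h|[h0 h] k].
  split=> [|i]; apply/eqP; rewrite -subr_eq0.
    by rewrite -meval_lagrange_max h.
  by rewrite -meval_lagrange_widen h.
case: (unliftP ord_max k) => [i ->|->]; rewrite -?widen_lift.
  by rewrite meval_lagrange_widen h subrr.
by rewrite meval_lagrange_max h0 subrr.
Qed.

Definition hessian f g t l i j : K :=
  meval (t 0) (mderiv j (mderiv i f)) - l * meval (t 0) (mderiv j (mderiv i g)).

(** At a common zero the last row of the Jacobian matrix is [(0, -g)], so that the matrix is
    invertible as soon as [g] does not vanish and the Hessian of [f - l g] is invertible, here
    diagonal. *)
Lemma lagrange_nondegenerate f g t l (x := with_multiplier t l) :
  multiplier_point f g t l -> meval (t 0) g != 0 ->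
  (forall i j, i != j -> hessian f g t l i j = 0) ->
  (forall i, hessian f g t l i i != 0) ->
  \det (\matrix_(k, j) meval (x 0) (mderiv j (lagrange f g k))) != 0.
Proof.
move=> [_ Fd] g0 Hd Hnd; apply/det0P => -[v v0 vM].
set M := \matrix_(_, _) _ in vM.
have xb h : meval (x 0 \o widen) h = meval (t 0) h by rewrite meval_base with_multiplierK.
have xm : x 0 ord_max = l by rewrite with_multiplier_max.
have dX i : mderiv (widen i) (mpolyX K (mnm1 (@ord_max s))) = 0.
  by rewrite mderivXU -val_eqE /= ltn_eqF // mpolyC0.
have dXm : mderiv ord_max (mpolyX K (mnm1 (@ord_max s))) = 1.
  by rewrite mderivXU eqxx mpolyC1.
have Mmw j : M ord_max (widen j) = 0.
  rewrite mxE lagrange_max mderivB mderivM dX mul0r add0r !mderiv_mwiden.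
  by rewrite mevalB mevalM mevalXU !meval_mwiden !xb xm Fd subrr.
have Mmm : M ord_max ord_max = - meval (t 0) g.
  rewrite mxE lagrange_max mderivB mderivM dXm !mderiv_mwiden_max mulr0 addr0 sub0r mul1r.
  by rewrite mevalN meval_mwiden xb.
have Mww i j : M (widen i) (widen j) = hessian f g t l i j.
  rewrite mxE lagrange_widen mderivB mderivM dX mul0r add0r !mderiv_mwiden.
  by rewrite mevalB mevalM mevalXU !meval_mwiden !xb xm.
have vw j : v 0 (widen j) = 0.
  have := congr1 (fun N : 'rV[K]_s.+1 => N 0 (widen j)) vM.
  rewrite !mxE big_ord_recr /= Mmw mulr0 addr0 (bigD1 j) //= big1 => [|i ij].
    by rewrite addr0 Mww => /eqP; rewrite mulf_eq0 (negPf (Hnd j)) orbF => /eqP.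
  by rewrite Mww Hd ?mulr0.
have vm : v 0 ord_max = 0.
  have := congr1 (fun N : 'rV[K]_s.+1 => N 0 ord_max) vM.
  rewrite !mxE big_ord_recr /= big1 => [|i _]; last by rewrite vw mul0r.
  by rewrite add0r Mmm => /eqP; rewrite mulf_eq0 oppr_eq0 (negPf g0) orbF => /eqP.
case/negP: v0; apply/eqP/rowP => k; rewrite mxE.
by case: (unliftP ord_max k) => [i ->|->]; rewrite -?widen_lift.
Qed.

Definition singular_zero f : set 'rV[K]_s :=
  [set t | meval (t 0) f = 0 /\ forall i, meval (t 0) (mderiv i f) = 0].

(** The critical points of [f / g], with denominators cleared. *)
Definition alg_critical f g : set 'rV[K]_s :=
  [set t | meval (t 0) g != 0 /\ forall i,
     meval (t 0) (mderiv i f) * meval (t 0) g = meval (t 0) f * meval (t 0) (mderiv i g)].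

Lemma alg_critical_multiplier f g t : alg_critical f g t ->
  multiplier_point f g t (meval (t 0) f / meval (t 0) g).
Proof.
move=> [g0 h]; split; first by rewrite divfK.
by move=> i; apply: (mulIf g0); rewrite h mulrAC divfK.
Qed.

Lemma multiplier_alg_critical f g t l :
  multiplier_point f g t l -> meval (t 0) g != 0 -> alg_critical f g t.
Proof. by move=> [h0 h] g0; split=> // i; rewrite h h0 mulrAC. Qed.

Lemma alg_criticalC f g :
  (forall t, ~ singular_zero f t) -> (forall t, ~ singular_zero g t) ->
  alg_critical f g = alg_critical g f.
Proof.
have sub p q : (forall t, ~ singular_zero p t) -> alg_critical p q `<=` alg_critical q p.
  move=> np t [q0 h]; split; last by move=> i; rewrite mulrC -h mulrC.
  apply/eqP => p0; apply: (np t); split=> // i.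
  by apply/eqP; have /eqP := h i; rewrite p0 mul0r mulf_eq0 (negPf q0) orbF.
by move=> nf ng; apply/seteqP; split; exact: sub.
Qed.

End LagrangeSystem.

(** * Zeros at infinity *)

Section Infinity.
Variables (K : numFieldType) (R : realType) (nu : proper_absval K R) (s : nat).
Implicit Types (P : mpoly s K) (t : 'rV[K]_s).

(** [h] extends [eta^m P(t / eta)] continuously to [eta = 0], where it computes the part of
    degree [m] of [P]. *)
Definition homogenization m P (h : 'rV[K]_s * K -> K) : Prop :=
  continuous h /\
  forall t eta, eta != 0 -> h (t, eta) = eta ^+ m * meval ((eta^-1 *: t) 0) P.

Lemma homogenization_exists m P : (msize P <= m.+1)%N -> exists h, homogenization m P h.
Proof.
move=> Pm; exists (fun p : 'rV[K]_s * K => \sum_(k : bmultinom s m.+1) mcoeff k P *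
  (p.2 ^+ (m - mdeg k) * meval (p.1 0) (mpolyX K k))); split.
  apply: continuous_big => [|/= k _]; first exact: add_continuous.
  have cX : continuous (fun e : K => e ^+ (m - mdeg k)).
    elim: (_ - _)%N => [|l IH]; first exact: cst_continuous.
    rewrite (_ : (fun _ => _) = (fun e : K => e * e ^+ l)); last first.
      by apply/funext => e; rewrite exprS.
    by move=> e; exact: (cvgM (@cvg_id _ (nbhs e)) (IH e)).
  have c1 := comp_snd_continuous (X := 'rV[K]_s) cX.
  have c2 := comp_fst_continuous (Y := K) (@meval_continuous _ _ (mpolyX K k)).
  by move=> p; exact: (cvgM (cvg_cst (mcoeff k P)) (cvgM (c1 p) (c2 p))).
move=> t eta eta0 /=; rewrite [in RHS](mpolywE Pm) raddf_sum mulr_sumr /=.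
apply: eq_bigr => k _; rewrite mevalZ [RHS]mulrCA; congr (_ * _); rewrite !mevalX.
under [in RHS]eq_bigr do rewrite mxE exprMn.
rewrite big_split /= mulrA; congr (_ * _).
rewrite prodrXr -mdegE exprVn; have km : (mdeg k <= m)%N by rewrite -ltnS bmdeg.
by rewrite exprB // unitfE.
Qed.

(** Dividing a point with a large coordinate by its largest coordinate [1 / eta] turns the
    equations into their homogenizations at a point of a compact set, with [eta] small. *)
Lemma no_zeros_at_infinity (I : Type) (A B A1 B1 : I -> mpoly s K) (D E : I -> nat) hA hB :
  (forall k l, (D k + E l = D l + E k)%N) ->
  (forall k, homogenization (D k) (A k) (hA k)) ->
  (forall k, homogenization (E k) (B k) (hB k)) ->
  (forall k, msize (A1 k) <= (D k).+1)%N -> (forall k, msize (B1 k) <= (E k).+1)%N ->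
  (forall t i, t 0 i = 1 -> exists k l,
     hA k (t, 0) * hB l (t, 0) != hA l (t, 0) * hB k (t, 0)) ->
  exists rho, \forall eps \near (0 : K), forall t,
    (forall k l, meval (t 0) (A k + eps *: A1 k) * meval (t 0) (B l + eps *: B1 l) =
       meval (t 0) (A l + eps *: A1 l) * meval (t 0) (B k + eps *: B1 k)) ->
    polydisc nu 0 rho t.
Proof.
move=> DE HA HB sA sB top.
have [hA1 HA1] := choice (fun k => homogenization_exists (sA k)).
have [hB1 HB1] := choice (fun k => homogenization_exists (sB k)).
pose a k (p : 'rV[K]_s * (K * K)) := hA k (p.1, p.2.1) + p.2.2 * hA1 k (p.1, p.2.1).
pose b k (p : 'rV[K]_s * (K * K)) := hB k (p.1, p.2.1) + p.2.2 * hB1 k (p.1, p.2.1).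
have cpt (h : 'rV[K]_s * K -> K) : continuous h ->
    continuous (fun p : 'rV[K]_s * (K * K) => h (p.1, p.2.1)).
  move=> ch; have cp : continuous (fun p : 'rV[K]_s * (K * K) => (p.1, p.2.1)).
    move=> [t [e1 e2]] V [[V1 V2] [/= V1n V2n] V12].
    exists (V1, V2 `*` setT) => /=; last first.
      by move=> [t' [e1' e2']] /= [h1 [h2 _]]; apply: (V12 (t', e1')).
    by split=> //; exists (V2, setT) => //; split=> //; exact: filterT.
  by move=> p; apply: (@continuous_comp _ _ _ (fun p : 'rV[K]_s * (K * K) => (p.1, p.2.1)) h);
    [exact: cp|exact: ch].
have ceps : continuous (fun p : 'rV[K]_s * (K * K) => p.2.2).
  apply: (comp_snd_continuous (X := 'rV[K]_s)).
  exact: (comp_snd_continuous (X := K) (fun z : K => @cvg_id _ (nbhs z))).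
have ca k : continuous (a k).
  move=> p; have [/cpt c _] := HA k; have [/cpt c1 _] := HA1 k.
  exact: (cvgD (c p) (cvgM (ceps p) (c1 p))).
have cb k : continuous (b k).
  move=> p; have [/cpt c _] := HB k; have [/cpt c1 _] := HB1 k.
  exact: (cvgD (c p) (cvgM (ceps p) (c1 p))).
pose X i := polydisc nu 0 1 `&` [set t : 'rV[K]_s | t 0 i = 1].
have cX i : compact (X i).
  apply: compact_closedI; first exact: compact_polydisc.
  rewrite (_ : [set _ | _] = (fun t : 'rV[K]_s => t 0 i) @^-1` [set 1]); last by [].
  apply: closed_comp => [t _|]; first exact: coord_continuous.
  exact: accessible_closed_set1 (hausdorff_accessible (@norm_hausdorff _ _)) _.
pose cross (kl : I * I) (p : 'rV[K]_s * (K * K)) := a kl.1 p * b kl.2 p - a kl.2 p * b kl.1 p.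
have ccross kl : continuous (cross kl).
  by move=> p; exact: (cvgB (cvgM (ca kl.1 p) (cb kl.2 p)) (cvgM (ca kl.2 p) (cb kl.1 p))).
have tube : \forall q \near ((0, 0) : K * K), forall i, i \in enum 'I_s -> forall t, X i t ->
    exists kl, cross kl (t, q) != 0.
  apply: (@near_all_seq _ _ (nbhs ((0, 0) : K * K)) _ (enum 'I_s)
    (fun i q => forall t, X i t -> exists kl, cross kl (t, q) != 0)) => i _.
  apply: (no_common_zero_near (cX i) ccross) => t [_ /top[k [l kl]]]; exists (k, l).
  by rewrite /cross /= subr_eq0 /a /b /= !mul0r !addr0.
have [[Q1 Q2] [/= /(nbhs_avP nu)[r r0 rQ] Q2n] Q12] := tube.
exists r^-1; apply: filterS Q2n => eps Q2e t teq.
apply: contrapT => t_far.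
have [i ti] : exists i, forall j, nu (t 0 j) <= nu (t 0 i).
  have [j _] : exists j, ~ (nu (t 0 j - (0 : 'rV[K]_s) 0 j) <= r^-1).
    by apply/existsNP => h; apply: t_far => j; exact: h.
  exists [arg max_(i > j) nu (t 0 i)]%O; case: arg_maxP => // i _ im k; exact: im.
have ri : r^-1 < nu (t 0 i).
  rewrite ltNge; apply/negP => h; apply: t_far => j.
  by rewrite mxE subr0 (le_trans (ti j)).
have ti0 : t 0 i != 0 by rewrite -(av_gt0 nu) (lt_trans _ ri) ?invr_gt0.
pose eta := (t 0 i)^-1; have eta0 : eta != 0 by rewrite invr_eq0.
have Xi : X i (eta *: t).
  split=> [j|]; last by rewrite /= mxE mulVf.
  by rewrite !mxE subr0 avM avV mulrC ler_pdivrMr ?mul1r // av_gt0.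
have Q1e : Q1 eta by apply: rQ; rewrite subr0 avV -(invrK r) ltf_pV2 // posrE ?invr_gt0 // av_gt0.
have /(_ i) := Q12 (eta, eps) (conj Q1e Q2e).
rewrite mem_enum => /(_ isT _ Xi)[[k l]].
have [_ eA] := HA k; have [_ eA'] := HA l; have [_ eB] := HB k; have [_ eB'] := HB l.
have [_ eA1] := HA1 k; have [_ eA1'] := HA1 l; have [_ eB1] := HB1 k; have [_ eB1'] := HB1 l.
rewrite /cross /a /b /= eA // eA' // eB // eB' // eA1 // eA1' // eB1 // eB1' //.
rewrite scalerA mulVf // scale1r => /negP; apply; apply/eqP.
have := teq k l; rewrite !mevalD !mevalZ.
have : eta ^+ D k * eta ^+ E l = eta ^+ D l * eta ^+ E k by rewrite -!exprD DE.
move: (meval _ (A k)) (meval _ (A1 k)) (meval _ (A l)) (meval _ (A1 l)) (meval _ (B k))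
  (meval _ (B1 k)) (meval _ (B l)) (meval _ (B1 l)) (eta ^+ D k) (eta ^+ E k) (eta ^+ D l)
  (eta ^+ E l) => u1 u2 u3 u4 u5 u6 u7 u8 c1 c2 c3 c4 ec e.
rewrite (_ : _ - _ = c1 * c4 * ((u1 + eps * u2) * (u7 + eps * u8)) -
  c3 * c2 * ((u3 + eps * u4) * (u5 + eps * u6))); last by ring.
by rewrite ec e subrr.
Qed.

End Infinity.

(** * Persistence of critical points *)

Section CriticalPointsPersist.
Variables (K : numFieldType) (R : realType) (nu : proper_absval K R) (s : nat).
Implicit Types (f g : mpoly s K) (t : 'rV[K]_s).

Lemma card_eq_seq (T : choiceType) (r : seq T) (A : set T) :
  uniq r -> (forall x, A x <-> x \in r) -> (A #= `I_(size r))%card.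
Proof.
case: r => [|x0 r] ur rA.
  have -> : A = set0 by apply/seteqP; split=> x // /rA; rewrite in_nil.
  by rewrite II0 card_eq0.
have -> : A = nth x0 (x0 :: r) @` `I_(size (x0 :: r)).
  apply/seteqP; split=> [x /rA xr|_ [k kr <-]]; last by apply/rA; exact: mem_nth.
  have xi : (index x (x0 :: r) < size (x0 :: r))%N by rewrite index_mem.
  by exists (index x (x0 :: r)); [exact: xi|exact: nth_index].
apply: inj_card_eq => k l; rewrite !inE => kr lr /eqP.
by rewrite nth_uniq // => /eqP.
Qed.

(** The hypersurface [a f = b g], a member of the pencil spanned by [f] and [g], is singular at
    [t]. *)
Definition singular_member f g t (a b : K) : Prop :=
  a * meval (t 0) f = b * meval (t 0) g /\
  forall i, a * meval (t 0) (mderiv i f) = b * meval (t 0) (mderiv i g).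

Definition jet f (k : 'I_s.+1) : mpoly s K :=
  if unlift ord_max k is Some i then mderiv i f else f.

Lemma jet_max f : jet f ord_max = f. Proof. by rewrite /jet unlift_none. Qed.

Lemma jet_widen f i : jet f (widen i) = mderiv i f.
Proof. by rewrite /jet widen_lift liftK. Qed.

Lemma singular_memberP f g t a b : singular_member f g t a b <->
  (forall k, a * meval (t 0) (jet f k) = b * meval (t 0) (jet g k)).
Proof.
split=> [[h0 h] k|h].
  by case: (unliftP ord_max k) => [i ->|->]; rewrite -?widen_lift ?jet_widen ?jet_max.
by split=> [|i]; [have := h ord_max; rewrite !jet_max|have := h (widen i); rewrite !jet_widen].
Qed.

Lemma jet_perturb f f1 eps k : jet (f + eps *: f1) k = jet f k + eps *: jet f1 k.
Proof.
by rewrite /jet; case: unlift => [i|//]; rewrite mderivD mderivZ.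
Qed.

Lemma singular_member_multiplier f g t l : singular_member f g t 1 l <-> multiplier_point f g t l.
Proof.
split=> -[h0 h]; first by split=> [|i]; [move: h0|move: (h i)]; rewrite mul1r.
by split=> [|i]; rewrite mul1r.
Qed.

Lemma singular_member_singular_zero f g t : singular_member f g t 0 1 <-> singular_zero g t.
Proof.
split=> -[h0 h]; first by split=> [|i]; [move: h0|move: (h i)]; rewrite mul1r mul0r.
by split=> [|i]; rewrite mul1r mul0r.
Qed.

(** Critical points of the quotient correspond to common zeros of the Lagrange system, to which
    the conservation of number applies: multipliers stay bounded because [g] has no singular zero.
    The zeros that persist keep [g] and the multiplier away from [0], so that none of them is a
    singular zero of the perturbed [g], or of the perturbed [f]. *)
Theorem critical_points_persist f g f1 g1 (zs : seq ('rV[K]_s * K)) (rho : R) :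
  uniq zs -> (forall t l, multiplier_point f g t l <-> (t, l) \in zs) ->
  (forall t l, (t, l) \in zs -> [/\ l != 0, meval (t 0) g != 0,
     forall i j, i != j -> hessian f g t l i j = 0 & forall i, hessian f g t l i i != 0]) ->
  (forall t, ~ singular_zero g t) ->
  (\forall eps \near (0 : K), forall t a b, (a != 0) || (b != 0) ->
     singular_member (f + eps *: f1) (g + eps *: g1) t a b -> polydisc nu 0 rho t) ->
  \forall eps \near (0 : K),
    [/\ (alg_critical (f + eps *: f1) (g + eps *: g1) #= `I_(size zs))%card,
        forall t, ~ singular_zero (f + eps *: f1) t &
        forall t, ~ singular_zero (g + eps *: g1) t].
Proof.
move=> uzs zsP znd ng bnd.
(* Multipliers stay bounded: [mu f - g] has no singular zero in the polydisc for small [mu]. *)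
have [r r0 rP] : exists2 r : R, 0 < r & \forall eps \near (0 : K), forall mu, nu mu < r ->
    forall t, ~ singular_member (f + eps *: f1) (g + eps *: g1) t mu 1.
  pose G k (p : 'rV[K]_s * (K * K)) :=
    p.2.1 * (meval (p.1 0) (jet f k) + p.2.2 * meval (p.1 0) (jet f1 k))
    - (meval (p.1 0) (jet g k) + p.2.2 * meval (p.1 0) (jet g1 k)).
  have cG k : continuous (G k).
    have c1 : continuous (fun p : 'rV[K]_s * (K * K) => p.2.1).
      apply: (comp_snd_continuous (X := 'rV[K]_s)).
      exact: (comp_fst_continuous (Y := K) (fun z : K => @cvg_id _ (nbhs z))).
    have c2 : continuous (fun p : 'rV[K]_s * (K * K) => p.2.2).
      apply: (comp_snd_continuous (X := 'rV[K]_s)).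
      exact: (comp_snd_continuous (X := K) (fun z : K => @cvg_id _ (nbhs z))).
    have c P : continuous (fun p : 'rV[K]_s * (K * K) => meval (p.1 0) P).
      exact: (comp_fst_continuous (Y := (K * K)%type) (@meval_continuous _ _ P)).
    move=> p; exact: (cvgB (cvgM (c1 p) (cvgD (c (jet f k) p) (cvgM (c2 p) (c (jet f1 k) p))))
      (cvgD (c (jet g k) p) (cvgM (c2 p) (c (jet g1 k) p)))).
  have tube : \forall q \near ((0, 0) : K * K), forall t, polydisc nu 0 rho t ->
      exists k, G k (t, q) != 0.
    apply: (no_common_zero_near (@compact_polydisc _ _ nu _ 0 rho) cG) => t _.
    apply/not_existsP => h; apply: (ng t).
    apply/(singular_member_singular_zero f)/singular_memberP => k.
    rewrite mul0r mul1r; apply/esym/eqP/negPn/negP => hk; apply: (h k).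
    by rewrite /G /= !mul0r addr0 sub0r oppr_eq0.
  have [[Q1 Q2] [/= /(nbhs_avP nu)[r r0 rQ] Q2n] Q12] := tube.
  exists r => //; apply: filterS2 Q2n bnd => eps Q2e bnd mu mur t tsing.
  have tr : polydisc nu 0 rho t by apply: (bnd t mu 1); rewrite ?oner_eq0 ?orbT.
  have Q1mu : Q1 mu by apply: rQ; rewrite subr0.
  have [k] := Q12 (mu, eps) (conj Q1mu Q2e) t tr.
  move/singular_memberP: tsing => /(_ k); rewrite /G /= !jet_perturb !mevalD !mevalZ mul1r.
  by move=> ->; rewrite subrr eqxx.
pose xs := [seq with_multiplier z.1 z.2 | z <- zs].
have xsP x : x \in xs <-> common_zero (lagrange f g) x.
  split=> [/mapP[[t l] /zsP tl ->]|/lagrange_zeroP/zsP h].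
    by apply/lagrange_zeroP; rewrite with_multiplierK with_multiplier_max.
  by rewrite -(base_pointK x); apply: (map_f (fun z => with_multiplier z.1 z.2) h).
have uxs : uniq xs.
  rewrite map_inj_uniq // => -[t l] [t' l'] /= e.
  have := congr1 (fun x : 'rV[K]_s.+1 => x 0 ord_max) e; rewrite !with_multiplier_max => ->.
  by rewrite -(with_multiplierK t l) e with_multiplierK.
pose W (x : 'rV[K]_s.+1) eps :=
  meval (x 0) (mwiden g) + eps * meval (x 0) (mwiden g1) != 0 /\ x 0 ord_max != 0.
have pertE eps : perturb (lagrange f g) (lagrange f1 g1) eps =
    lagrange (f + eps *: f1) (g + eps *: g1).
  by apply/funext => k; rewrite lagrange_perturb.
have := @conservation_of_number _ _ nu _ (lagrange f g) (lagrange f1 g1) xs W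
  (Num.max rho r^-1) uxs.
move=> /(_ (fun x => iff_sym (xsP x))) cons.
have {cons} : \forall eps \near (0 : K), exists ys : seq 'rV[K]_s.+1,
    [/\ size ys = size xs, uniq ys,
        forall y, common_zero (perturb (lagrange f g) (lagrange f1 g1) eps) y <-> y \in ys
      & forall y, y \in ys -> W y eps].
  apply: cons.
  - move=> _ /mapP[[t l] tl ->]; have [l0 g0 hd hn] := znd _ _ tl.
    by apply: lagrange_nondegenerate => //; apply/zsP.
  - move=> _ /mapP[[t l] tl ->] /=; have [l0 g0 hd hn] := znd _ _ tl.
    pose w1 (p : 'rV[K]_s.+1 * K) := meval (p.1 0) (mwiden g) + p.2 * meval (p.1 0) (mwiden g1).
    have cw1 : continuous w1.
      have c P : continuous (fun p : 'rV[K]_s.+1 * K => meval (p.1 0) P).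
        exact: (comp_fst_continuous (Y := K) (@meval_continuous _ _ P)).
      have c2 : continuous (fun p : 'rV[K]_s.+1 * K => p.2).
        exact: (comp_snd_continuous (X := 'rV[K]_s.+1) (fun z : K => @cvg_id _ (nbhs z))).
      by move=> p; exact: (cvgD (c (mwiden g) p) (cvgM (c2 p) (c (mwiden g1) p))).
    have w1n : \forall p \near (with_multiplier t l, 0 : K), w1 p != 0.
      apply: (cvgr_neq0 _ (cw1 _)).
      by rewrite /w1 /= mul0r addr0 meval_mwiden meval_base with_multiplierK.
    have w2n : \forall p \near (with_multiplier t l, 0 : K), (p.1 : 'rV[K]_s.+1) 0 ord_max != 0.
      have cc : continuous (fun p : 'rV[K]_s.+1 * K => p.1 0 ord_max).
        exact: (comp_fst_continuous (@coord_continuous K 1 s.+1 0 ord_max)).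
      by apply: (cvgr_neq0 _ (cc _)); rewrite /= with_multiplier_max.
    by apply: filterS2 w1n w2n => -[y e] /=; split.
  - apply: filterS2 bnd rP => eps bnd rP x.
    rewrite pertE => /lagrange_zeroP/singular_member_multiplier h.
    have hb : polydisc nu 0 rho (base_point x) by apply: bnd h; rewrite oner_eq0.
    move=> k; rewrite mxE subr0 le_max; case: (unliftP ord_max k) => [i ->|->].
      by rewrite -widen_lift; have := hb i; rewrite !mxE subr0 => ->.
    apply/orP; right; rewrite leNgt; apply/negP => lr.
    have l0 : x 0 ord_max != 0 by rewrite -(av_gt0 nu) (lt_trans _ lr) ?invr_gt0.
    apply: (rP (x 0 ord_max)^-1 _ (base_point x)).
      by rewrite avV -(invrK r) ltf_pV2 // posrE ?invr_gt0 // av_gt0.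
    move: h => [h0 h]; split=> [|i].
      by rewrite -[meval _ (f + _)]mul1r h0 mulrA mulVf.
    by rewrite -[meval _ (mderiv i (f + _))]mul1r h mulrA mulVf.
apply: filterS2 rP => eps rP [ys [sys uys ysP yW]].
have ng' t : ~ singular_zero (g + eps *: g1) t.
  by move/(singular_member_singular_zero (f + eps *: f1)); apply: rP; rewrite av0.
have Wg y : y \in ys -> meval (base_point y 0) (g + eps *: g1) != 0.
  by move/yW => [+ _]; rewrite !meval_mwiden !meval_base mevalD mevalZ.
have ysP' y : y \in ys <->
    multiplier_point (f + eps *: f1) (g + eps *: g1) (base_point y) (y 0 ord_max).
  by rewrite -ysP pertE; exact: lagrange_zeroP.
split=> //.
- have <- : size [seq base_point y | y <- ys] = size zs by rewrite size_map sys size_map.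
  apply: card_eq_seq => [|t].
    rewrite map_inj_in_uniq // => x y xx yy e; rewrite -(base_pointK x) -(base_pointK y) e.
    congr with_multiplier; have [hx _] := (ysP' _).1 xx; have [hy _] := (ysP' _).1 yy.
    by apply: (mulIf (Wg _ yy)); rewrite -hy -e -hx e.
  split=> [tc|/mapP[y yy ->]].
    have := alg_critical_multiplier tc; set l := _ / _ => h.
    have hy : with_multiplier t l \in ys by rewrite ysP' with_multiplierK with_multiplier_max.
    by rewrite -(with_multiplierK t l) map_f.
  by apply: multiplier_alg_critical (Wg _ yy); apply/ysP'.
- move=> t [f0 fd].
  have hy : with_multiplier t 0 \in ys.
    rewrite ysP' with_multiplierK with_multiplier_max.
    by split=> [|i]; rewrite mul0r.
  by have [_] := yW _ hy; rewrite with_multiplier_max eqxx.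
Qed.

End CriticalPointsPersist.

(** * Reduction of the general pair to one example *)

Section GenericPairs.
Variables (F : numClosedFieldType) (s d e : nat).
Hypothesis s_gt0 : (0 < s)%N.
Local Notation n := #|pair_monomials s d e|.

Definition pair_of (v : 'I_n -> F) : mpoly s F * mpoly s F :=
  (\sum_(m : bmultinom s d.+1) v (enum_rank (inl m : pair_monomials s d e)) *: mpolyX F m,
   \sum_(m : bmultinom s e.+1) v (enum_rank (inr m : pair_monomials s d e)) *: mpolyX F m).

Lemma msize_sum_bounded b (c : bmultinom s b -> F) :
  (msize (\sum_(m : bmultinom s b) c m *: mpolyX F m) <= b)%N.
Proof.
apply: (leq_trans (msize_sum _ _ _)); apply/bigmax_leqP_seq => m _ _.
by rewrite (leq_trans (msizeZ_le _ _)) // msizeX; exact: bmdeg.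
Qed.

Lemma mcoeff_sum_bounded b (c : bmultinom s b -> F) m0 :
  mcoeff m0 (\sum_(m : bmultinom s b) c m *: mpolyX F m) =
  if insub m0 is Some m then c m else 0.
Proof.
rewrite raddf_sum /=; case: insubP => [m _ mm0|nm].
  rewrite (bigD1 m) //= mcoeffZ mcoeffX mm0 eqxx mulr1 big1 ?addr0 // => m' m'm.
  by rewrite mcoeffZ mcoeffX -mm0 -bmeqP (negPf m'm) mulr0.
rewrite big1 // => m' _; rewrite mcoeffZ mcoeffX; case: eqP => [e'|]; last by rewrite mulr0.
by case/negP: nm; rewrite -e'; exact: bmdeg.
Qed.

Lemma pair_of_bounded v : poly_pairs d e (pair_of v).
Proof. by split; exact: msize_sum_bounded. Qed.

Lemma pair_ofK v : pair_coords (pair_of v) =1 v.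
Proof.
move=> k; rewrite /pair_coords /=.
by case E: (enum_val k) => [m|m]; rewrite mcoeff_sum_bounded valK -E enum_valK.
Qed.

Lemma pair_coordsK fg : poly_pairs d e fg -> pair_of (pair_coords fg) = fg.
Proof.
case: fg => f g [/= fd ge]; rewrite /pair_of; congr (_, _).
  rewrite [RHS](mpolywE fd); apply: eq_bigr => m _; congr (_ *: _).
  by rewrite /pair_coords enum_rankK.
rewrite [RHS](mpolywE ge); apply: eq_bigr => m _; congr (_ *: _).
by rewrite /pair_coords enum_rankK.
Qed.

Lemma pair_of_line v w eps : pair_of (fun i => v i + eps * w i) =
  ((pair_of v).1 + eps *: (pair_of w).1, (pair_of v).2 + eps *: (pair_of w).2).
Proof.
by congr (_, _); rewrite /= scaler_sumr -big_split; apply: eq_bigr => m _ /=;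
  rewrite scalerDl scalerA.
Qed.

Definition poly_term b (c : bmultinom s b -> GRing.term F) (mon : bmultinom s b -> multinom s)
    (x : 'I_s -> GRing.term F) : GRing.term F :=
  \big[GRing.Add/GRing.Const 0]_(m : bmultinom s b)
    GRing.Mul (c m) (\big[GRing.Mul/GRing.Const 1]_(i < s) GRing.Exp (x i) (mon m i)).

Lemma eval_poly_term env b c mon x : GRing.eval env (@poly_term b c mon x) =
  \sum_(m : bmultinom s b)
    GRing.eval env (c m) * meval (fun i => GRing.eval env (x i)) (mpolyX F (mon m)).
Proof.
rewrite /poly_term (big_morph (GRing.eval env) (id1 := 0) (op1 := +%R)) //.
apply: eq_bigr => m _ /=; congr (_ * _).
by rewrite (big_morph (GRing.eval env) (id1 := 1) (op1 := *%R)) // mevalX.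
Qed.

Definition value_term b (r : bmultinom s b -> nat) x :=
  poly_term (fun m : bmultinom s b => GRing.Var F (r m)) (fun m => m) x.

Definition deriv_term b (r : bmultinom s b -> nat) x (i : 'I_s) :=
  poly_term (fun m : bmultinom s b => GRing.NatMul (GRing.Var F (r m)) (m i))
    (fun m => mnm_sub m (mnm1 i)) x.

Lemma eval_value_term env b r x : GRing.eval env (@value_term b r x) =
  meval (fun i => GRing.eval env (x i)) (\sum_(m : bmultinom s b) env`_(r m) *: mpolyX F m).
Proof.
rewrite eval_poly_term raddf_sum; apply: eq_bigr => m _ /=.
by rewrite mevalZ.
Qed.

Lemma eval_deriv_term env b r x i : GRing.eval env (@deriv_term b r x i) =
  meval (fun i => GRing.eval env (x i))
    (mderiv i (\sum_(m : bmultinom s b) env`_(r m) *: mpolyX F m)).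
Proof.
rewrite eval_poly_term (raddf_sum (mderiv i)) raddf_sum; apply: eq_bigr => m _ /=.
by rewrite mderivZ mevalZ mderivX mevalZ mulrA mulr_natr.
Qed.

Definition critical_formula (k : nat) : GRing.formula F :=
  let x (i : 'I_s) := GRing.Var F (n + k * s + i) in
  let rf m := enum_rank (inl m : pair_monomials s d e) : nat in
  let rg m := enum_rank (inr m : pair_monomials s d e) : nat in
  GRing.And (GRing.Not (GRing.Equal (value_term rg x) (GRing.Const 0)))
    (foldr GRing.And (GRing.Bool true)
       [seq GRing.Equal (GRing.Mul (deriv_term rf x i) (value_term rg x))
                        (GRing.Mul (value_term rf x) (deriv_term rg x i)) | i <- enum 'I_s]).

Lemma critical_formulaP env k : GRing.holds env (critical_formula k) <->
  alg_critical (pair_of (fun i : 'I_n => env`_i)).1 (pair_of (fun i : 'I_n => env`_i)).2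
    (nth_point n s env k).
Proof.
rewrite /critical_formula /= holds_ands /alg_critical /=.
have E P : meval (fun i : 'I_s => env`_(n + k * s + i)) P = meval (nth_point n s env k 0) P.
  by apply: meval_eq => i; rewrite mxE.
rewrite eval_value_term /= E.
split=> [[g0 h]|[g0 h]]; split; try by move/eqP: g0.
  move=> i; have := h i; rewrite mem_enum /= !eval_value_term !eval_deriv_term !E; exact.
by move=> i _; rewrite /= !eval_value_term !eval_deriv_term !E.
Qed.

(** The truth of the count is the same at all pairs off some hypersurface. A line through the
    example that is not contained in this hypersurface meets it in finitely many points, hence
    contains small perturbations of the example off the hypersurface. *)
Lemma general_pair_card N (f g : mpoly s F) : poly_pairs d e (f, g) ->
  (forall f1 g1 : mpoly s F, poly_pairs d e (f1, g1) -> \forall k \near \oo,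
     (alg_critical (f + k.+1%:R^-1 *: f1) (g + k.+1%:R^-1 *: g1) #= `I_N)%card) ->
  holds_for_general_pair d e
    [set fg : mpoly s F * mpoly s F | (alg_critical fg.1 fg.2 #= `I_N)%card].
Proof.
move=> fg_bd near_fg.
have [Q [b [Q0 HQ]]] := card_generic (A := fun v => alg_critical (pair_of v).1 (pair_of v).2)
  s_gt0 critical_formulaP N.
have [w wP] := mpoly_nonvanishing Q0.
pose v := pair_coords (d := d) (e := e) (f, g).
(* The hypersurface does not contain the whole line from [v] to [w]. *)
pose q : {poly F} := mmap polyC (fun i => (v i)%:P + (w i - v i) *: 'X) Q.
have qE eps : q.[eps] = meval (fun i => v i + eps * (w i - v i)) Q.
  rewrite /q /meval /mmap horner_sum; apply: eq_bigr => m _.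
  rewrite hornerM hornerC; congr (_ * _); rewrite /mmap1 horner_prod.
  by apply: eq_bigr => i _; rewrite horner_exp !hornerE mulrC.
have q0 : q != 0.
  apply: contraNneq wP => q0; have := qE 1; rewrite q0 horner0 => /esym/eqP.
  by congr (_ == 0); apply: meval_eq => i; rewrite mul1r addrC subrK.
have [k [qk Nk]] : exists k, q.[k.+1%:R^-1] != 0 /\
    (alg_critical (f + k.+1%:R^-1 *: (pair_of (fun i => w i - v i)).1)
       (g + k.+1%:R^-1 *: (pair_of (fun i => w i - v i)).2) #= `I_N)%card.
  have [k0 _ kP] := near_fg _ _ (pair_of_bounded (fun i => w i - v i)).
  apply: contrapT => /forallNP H; suff : (size q < size q)%N by rewrite ltnn.
  rewrite -[X in (X < _)%N](size_iota k0) -(size_map (fun k => k.+1%:R^-1 : F)).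
  apply: max_poly_roots => //.
    apply/allP => _ /mapP[k + ->]; rewrite mem_iota => /andP[k0k _]; apply/rootP.
    apply/eqP/negPn/negP => qk; apply: (H k); split=> //; exact: (kP k k0k).
  rewrite map_inj_uniq ?iota_uniq // => x y /invr_inj/eqP.
  by rewrite eqr_nat => /eqP[].
have {qk Nk} b_true : b.
  have /HQ <- : meval (fun i => v i + k.+1%:R^-1 * (w i - v i)) Q != 0 by rewrite -qE.
  by rewrite pair_of_line pair_coordsK.
exists [set fg | poly_pairs d e fg /\ meval (pair_coords fg) Q = 0]; split.
- exists [set Q]; apply/seteqP; split=> fg [fgb h]; split=> //; last exact: h.
  by move=> _ ->.
- split=> [fg []//|h].
  have [_ /eqP] := h _ (pair_of_bounded w); rewrite (meval_eq _ (pair_ofK w)).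
  by apply/negP.
- move=> fg [fgb nz] /=; have /HQ : meval (pair_coords fg) Q != 0.
    by apply/eqP => z; apply: nz.
  by rewrite b_true (pair_coordsK fgb) => ->.
Qed.

End GenericPairs.

(** * Derivatives of quotients *)

Section Derivatives.
Variables (K : numFieldType) (s : nat).
Implicit Types (P : mpoly s K) (t v : 'rV[K]_s).

Lemma is_derive_coord (j : 'I_s) t v : is_derive t v (fun x : 'rV[K]_s => x 0 j : K^o) (v 0 j).
Proof.
have lim : (fun h : K => h^-1 *: (((fun x : 'rV[K]_s => x 0 j : K^o) \o shift t) (h *: v)
    - (t 0 j : K^o))) @ 0^' --> (v 0 j : K^o).
  apply: cvg_near_cst; near=> h.
  rewrite /= !mxE addrK scalerA mulVf ?scale1r //.
  by near: h; rewrite near_withinE; near=> h.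
by apply: DeriveDef; [apply/cvg_ex; exists (v 0 j)|exact: cvg_lim lim].
Unshelve. all: by end_near. Qed.

Lemma is_derive_meval P t (i : 'I_s) :
  is_derive t (delta_mx 0 i) (fun x : 'rV[K]_s => meval (x 0) P : K^o) (meval (t 0) (mderiv i P)).
Proof.
elim/mpoly_ring_ind: P => [c|j|P Q dP dQ|P Q dP dQ].
- rewrite mderivC meval0 (_ : (fun _ => _) = cst (c : K^o)); first exact: is_derive_cst.
  by apply/funext => x; rewrite mevalC.
- have -> : meval (t 0) (mderiv i (mpolyX K (mnm1 j))) = (delta_mx 0 i : 'rV[K]_s) 0 j.
    by rewrite mxE /= mderivXU mevalC eq_sym.
  rewrite (_ : (fun _ => _) = (fun x : 'rV[K]_s => x 0 j : K^o)); first exact: is_derive_coord.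
  by apply/funext => x; rewrite mevalXU.
- rewrite mderivD mevalD (_ : (fun _ => _) = (fun x : 'rV[K]_s => meval (x 0) P : K^o) +
    (fun x : 'rV[K]_s => meval (x 0) Q : K^o)); first exact: is_deriveD.
  by apply/funext => x; rewrite mevalD.
- rewrite mderivM mevalD !mevalM (_ : (fun _ => _) = (fun x : 'rV[K]_s => meval (x 0) P : K) *
    (fun x : 'rV[K]_s => meval (x 0) Q : K)); last by apply/funext => x; rewrite mevalM.
  apply: (is_derive_eq (is_deriveM dP dQ)).
  by rewrite addrC /GRing.scale /=; congr (_ + _); rewrite mulrC.
Qed.

Lemma is_derive_quotient P Q t (i : 'I_s) : meval (t 0) Q != 0 ->
  is_derive t (delta_mx 0 i) (fun x : 'rV[K]_s => meval (x 0) P / meval (x 0) Q : K^o)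
    ((meval (t 0) (mderiv i P) * meval (t 0) Q - meval (t 0) P * meval (t 0) (mderiv i Q))
     / meval (t 0) Q ^+ 2).
Proof.
move=> Q0; have dQ := is_derive_meval Q t i; have exQ := @ex_derive _ _ _ _ _ _ _ dQ.
have dV : is_derive t (delta_mx 0 i) (fun x : 'rV[K]_s => (meval (x 0) Q)^-1 : K^o)
    (- (meval (t 0) Q) ^- 2 *: (meval (t 0) (mderiv i Q) : K^o)).
  apply: DeriveDef; first exact: derivableV.
  by rewrite deriveV // (@derive_val _ _ _ _ _ _ _ dQ).
apply: (is_derive_eq (is_deriveM (is_derive_meval P t i) dV)).
by rewrite /GRing.scale /=; field.
Qed.

End Derivatives.

Lemma critical_pointsE (R : realType) s (f g : mpoly s R[i]) :
  critical_points f g = alg_critical f g.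
Proof.
apply/seteqP; split=> t [g0 h]; split=> // i.
  have dq := @is_derive_quotient _ _ f g t i g0.
  have := h i; rewrite /ratfun => dr.
  have := @derive_val _ _ _ _ _ _ _ dq; rewrite (@derive_val _ _ _ _ _ _ _ dr).
  move=> /esym/eqP; rewrite mulf_eq0 invr_eq0 expf_eq0 (negPf g0) andbF orbF subr_eq0.
  by move/eqP.
have := @is_derive_quotient _ _ f g t i g0.
by rewrite h subrr mul0r.
Qed.

(** * Sums of polynomials in separate variables *)

Section Separated.
Variables (K : numFieldType) (s : nat).
Implicit Types (p : {poly K}) (P : 'I_s -> {poly K}) (t : 'rV[K]_s).

(** [p(X_i)] *)
Definition in_variable (i : 'I_s) p : mpoly s K := (map_poly (@mpolyC s K) p).[mpolyX K (mnm1 i)].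

Definition separated P (c : K) : mpoly s K := \sum_i in_variable i (P i) + mpolyC s c.

Lemma in_variableE i p :
  in_variable i p = \sum_(k < size p) p`_k *: mpolyX K (mnm1 i) ^+ k.
Proof.
rewrite /in_variable horner_poly; apply: eq_bigr => k _.
by rewrite mul_mpolyC.
Qed.

Lemma meval_in_variable i p t : meval (t 0) (in_variable i p) = p.[t 0 i].
Proof.
rewrite in_variableE raddf_sum horner_coef; apply: eq_bigr => k _ /=.
by rewrite mevalZ rmorphXn /= mevalXU.
Qed.

Lemma in_variable_is_ring_hom i : [/\ forall c, in_variable i c%:P = mpolyC s c,
   in_variable i 'X = mpolyX K (mnm1 i), {morph in_variable i : p q / p + q} &
   {morph in_variable i : p q / p * q}].
Proof.
rewrite /in_variable; split=> [c||p q|p q].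
- by rewrite map_polyC hornerC.
- by rewrite map_polyX hornerX.
- by rewrite rmorphD hornerD.
- by rewrite rmorphM hornerM.
Qed.

Lemma mderiv_in_variable i j p :
  mderiv j (in_variable i p) = if i == j then in_variable i p^`() else 0.
Proof.
have [iC iX iD iM] := in_variable_is_ring_hom i.
have i0 : in_variable i 0 = 0 by rewrite -polyC0 iC mpolyC0.
elim/poly_ind: p => [|p c IH]; first by rewrite deriv0 i0 mderiv0 if_same.
rewrite derivD derivM derivX derivC addr0 mulr1 !iD !iM iX iC mderivD mderivM mderivC IH.
rewrite mderivXU addr0 eq_sym; case: eqP => _; last by rewrite mul0r mpolyC0 mulr0 addr0.
by rewrite mpolyC1 mulr1.
Qed.

Lemma meval_separated P c t : meval (t 0) (separated P c) = \sum_i (P i).[t 0 i] + c.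
Proof.
rewrite mevalD mevalC raddf_sum; congr (_ + _).
by apply: eq_bigr => i _; rewrite /= meval_in_variable.
Qed.

Lemma mderiv_separated P c j : mderiv j (separated P c) = in_variable j (P j)^`().
Proof.
rewrite mderivD mderivC addr0 raddf_sum (bigD1 j) //= mderiv_in_variable eqxx.
rewrite big1 ?addr0 // => i /negPf ij.
by rewrite mderiv_in_variable ij.
Qed.

Lemma in_variable_separated j p :
  in_variable j p = separated (fun i => if i == j then p else 0) 0.
Proof.
have iC i : in_variable i 0 = 0.
  by have [iC _ _ _] := in_variable_is_ring_hom i; rewrite -polyC0 iC mpolyC0.
rewrite /separated mpolyC0 addr0 (bigD1 j) //= eqxx big1 ?addr0 // => i /negPf ->.
exact: iC.
Qed.

Lemma msize_separated P c m : (forall i, (size (P i) <= m.+1)%N) ->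
  (msize (separated P c) <= m.+1)%N.
Proof.
move=> Pm; apply: (leq_trans (msizeD_le _ _)); rewrite geq_max; apply/andP; split; last first.
  by rewrite msizeC; case: (c != 0).
apply: (leq_trans (msize_sum _ _ _)); apply/bigmax_leqP_seq => i _ _.
rewrite in_variableE; apply: (leq_trans (msize_sum _ _ _)); apply/bigmax_leqP_seq => k _ _.
rewrite (leq_trans (msizeZ_le _ _)) // mpolyXn msizeX mdegMn mdeg1 mul1n.
exact: leq_trans (ltn_ord k) (Pm i).
Qed.

Lemma homogenization_separated P c m : (forall i, (size (P i) <= m.+1)%N) ->
  exists2 h, homogenization m (separated P c) h &
    forall t, h (t, 0) = \sum_i (P i)`_m * t 0 i ^+ m + c * (m == 0)%:R.
Proof.
move=> Pm.
pose h' (p : 'rV[K]_s * K) :=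
  \sum_i \sum_(k < m.+1) (P i)`_k * (p.2 ^+ (m - k) * p.1 0 i ^+ k) + c * p.2 ^+ m.
have cX l : continuous (fun e : K => e ^+ l).
  elim: l => [|l IH]; first exact: cst_continuous.
  rewrite (_ : (fun _ => _) = (fun e : K => e * e ^+ l)); last first.
    by apply/funext => e; rewrite exprS.
  by move=> e; exact: (cvgM (@cvg_id _ (nbhs e)) (IH e)).
have c2 l : continuous (fun p : 'rV[K]_s * K => p.2 ^+ l).
  exact: (comp_snd_continuous (X := 'rV[K]_s) (cX l)).
have c1 i l : continuous (fun p : 'rV[K]_s * K => p.1 0 i ^+ l).
  apply: (comp_fst_continuous (Y := K) (f := fun t : 'rV[K]_s => t 0 i ^+ l)) => t.
  apply: (@continuous_comp _ _ _ (fun t : 'rV[K]_s => t 0 i) (fun z => z ^+ l)); last exact: cX.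
  exact: coord_continuous.
exists h'; last first.
  move=> t; rewrite /h' /= expr0n; congr (_ + _); apply: eq_bigr => i _.
  rewrite big_ord_recr /= subnn expr0 mul1r big1 ?add0r // => k _.
  by rewrite expr0n subn_eq0 leqNgt ltn_ord mul0r mulr0.
split.
  pose S i (p : 'rV[K]_s * K) := \sum_(k < m.+1) (P i)`_k * (p.2 ^+ (m - k) * p.1 0 i ^+ k).
  have cS i : continuous (S i).
    apply: continuous_big => [|/= k _]; first exact: add_continuous.
    by move=> p; exact: (cvgM (cvg_cst (P i)`_k) (cvgM (c2 _ p) (c1 i k p))).
  have cSS : continuous (fun p : 'rV[K]_s * K => \sum_i S i p).
    by apply: continuous_big => [|/= i _]; [exact: add_continuous|exact: cS].
  by move=> p; exact: (cvgD (cSS p) (cvgM (cvg_cst c) (c2 m p))).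
move=> t eta eta0; rewrite meval_separated mulrDr [_ * c]mulrC; congr (_ + _).
rewrite mulr_sumr; apply: eq_bigr => i _.
rewrite (horner_coef_wide _ (Pm i)) mulr_sumr; apply: eq_bigr => k _.
rewrite mxE exprMn [RHS]mulrCA; congr (_ * _); rewrite mulrA; congr (_ * _).
by rewrite exprVn exprB ?unitfE // -ltnS.
Qed.

End Separated.

(** * Univariate polynomials *)

Section Univariate.
Variable F : numClosedFieldType.
Implicit Types p q : {poly F}.

Definition roots_of p : seq F := sval (closed_field_poly_normal p).

Lemma roots_ofE p : p = lead_coef p *: \prod_(z <- roots_of p) ('X - z%:P).
Proof. exact: svalP (closed_field_poly_normal p). Qed.

Lemma mem_roots_of p z : p != 0 -> (z \in roots_of p) = root p z.
Proof.
by move=> p0; rewrite {2}(roots_ofE p) rootZ ?lead_coef_eq0 // root_prod_XsubC.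
Qed.

Lemma size_roots_of p : p != 0 -> size (roots_of p) = (size p).-1.
Proof.
by move=> p0; rewrite {2}(roots_ofE p) size_scale ?lead_coef_eq0 // size_prod_XsubC.
Qed.

Lemma uniq_simple_roots (r : seq F) :
  (forall z, z \in r -> ~~ root (\prod_(x <- r) ('X - x%:P))^`() z) -> uniq r.
Proof.
elim: r => //= x r IH h; set Q := \prod_(y <- r) ('X - y%:P) in IH.
have dE z : (\prod_(y <- x :: r) ('X - y%:P))^`().[z] = Q.[z] + (z - x) * Q^`().[z].
  by rewrite big_cons derivM derivXsubC mul1r hornerD hornerM hornerXsubC.
have xr : x \notin r.
  have := h x (mem_head _ _); rewrite /root dE subrr mul0r addr0.
  by rewrite -/(root _ _) root_prod_XsubC.
rewrite xr IH // => z zr; have := h z; rewrite inE zr orbT => /(_ isT).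
apply: contra; rewrite /root dE => /eqP ->; rewrite mulr0 addr0.
by rewrite -/(root _ _) root_prod_XsubC.
Qed.

Lemma uniq_roots_of p : p != 0 -> (forall z, root p z -> ~~ root p^`() z) -> uniq (roots_of p).
Proof.
move=> p0 simple; apply: uniq_simple_roots => z; rewrite mem_roots_of // => /simple.
by rewrite {1}(roots_ofE p) derivZ rootZ // lead_coef_eq0.
Qed.

Definition integral p : {poly F} := \poly_(k < (size p).+1) (p`_k.-1 / k%:R).

Lemma coef_integral p k : (integral p)`_k = p`_k.-1 / k%:R.
Proof.
rewrite coef_poly; case: ltnP => // kp; case: k kp => // k kp.
by rewrite nth_default ?mul0r.
Qed.

Lemma deriv_integral p : (integral p)^`() = p.
Proof.
apply/polyP => k; rewrite coef_deriv coef_integral /= -[LHS]mulr_natr divfK //.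
Qed.

Lemma size_integral p : (size (integral p) <= (size p).+1)%N.
Proof. exact: size_poly. Qed.

Lemma deriv_eq0 p : p^`() = 0 -> (size p <= 1)%N.
Proof.
move=> p0; apply/leq_sizeP => -[//|k] _.
have := congr1 (fun q : {poly F} => q`_k) p0; rewrite coef_deriv coef0 => /eqP.
by rewrite mulrn_eq0 /= => /eqP.
Qed.

Lemma exists_avoiding (bad : seq F) : exists c, c \notin bad.
Proof.
have [k] := @poly_nonroot _ (\prod_(z <- bad) ('X - z%:P)) (monic_neq0 (monic_prod_XsubC _ _ _)).
by rewrite -/(root _ _) root_prod_XsubC; exists k%:R.
Qed.

Lemma wronskian_neq0 p q : coprimep p q -> q != 0 -> (size q < size p)%N ->
  p^`() * q - p * q^`() != 0.
Proof.
move=> cpq q0 qp; apply/eqP => /eqP; rewrite subr_eq0 => /eqP e.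
have q_q' : q %| q^`() by rewrite -(@Gauss_dvdpr _ _ p) 1?coprimep_sym // -e dvdp_mull.
have {q_q'} q'0 : q^`() = 0.
  apply/eqP; apply: contraTT qp => q'0; have := dvdp_leq q'0 q_q'.
  by rewrite leqNgt lt_size_deriv.
move/eqP: e; rewrite q'0 mulr0 mulf_eq0 (negPf q0) orbF => /eqP/deriv_eq0 p1.
by have := leq_trans qp p1; rewrite ltnS leqn0 size_poly_eq0 (negPf q0).
Qed.

(** The exceptional values of [c] are those of [- p / q] at the roots of [bad] and at the zeros of
    the derivative of [p / q]. *)
Lemma generic_combination p q (bad : {poly F}) :
  coprimep p q -> q != 0 -> (size q < size p)%N -> bad != 0 ->
  exists cs : seq F, forall c, c \notin cs ->
    [/\ size (p + c *: q) = size p, forall z, root (p + c *: q) z -> ~~ root bad z &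
      uniq (roots_of (p + c *: q))].
Proof.
move=> cpq q0 qp bad0; pose W := p^`() * q - p * q^`().
have W0 : W != 0 by exact: wronskian_neq0.
exists [seq - p.[z] / q.[z] | z <- roots_of (W * bad)] => c cP.
have sz : size (p + c *: q) = size p.
  by rewrite size_polyDl // (leq_ltn_trans (size_scale_leq _ _)).
have nz : p + c *: q != 0 by rewrite -size_poly_gt0 sz (leq_ltn_trans _ qp).
have avoid z : root (p + c *: q) z -> ~~ root (W * bad) z.
  move=> rz; apply: contra cP => Wz; apply/mapP; exists z.
    by rewrite mem_roots_of // mulf_neq0.
  have qz : q.[z] != 0.
    apply/eqP => qz; move: rz; rewrite rootE hornerD hornerZ qz mulr0 addr0 => pz.
    by have := coprimep_root cpq pz; rewrite qz eqxx.
  by move: rz; rewrite rootE hornerD hornerZ addr_eq0 => /eqP ->; rewrite opprK mulfK.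
split=> // [z /avoid|]; first by rewrite rootM negb_or => /andP[].
apply: uniq_roots_of => // z rz; apply: contra (avoid z rz); rewrite rootM => dz; apply/orP; left.
move: rz dz; rewrite !rootE derivD derivZ !(hornerD, hornerZ, hornerM, hornerN).
rewrite !addr_eq0 => /eqP -> /eqP ->; rewrite mulNr opprK mulNr; apply/eqP; ring.
Qed.

End Univariate.

(** * Critical points of quotients in separate variables *)

Section SeparatedCount.
Variables (F : numClosedFieldType) (s : nat).
Implicit Types (P Q : 'I_s -> {poly F}) (t : 'rV[F]_s).

Lemma multiplier_point_separated P Q c c' t l :
  multiplier_point (separated P c) (separated Q c') t l <->
  \sum_i (P i).[t 0 i] + c = l * (\sum_i (Q i).[t 0 i] + c') /\
  forall i, (P i)^`().[t 0 i] = l * (Q i)^`().[t 0 i].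
Proof.
rewrite /multiplier_point !meval_separated.
by split=> -[h0 h]; split=> // i; have := h i; rewrite !mderiv_separated !meval_in_variable.
Qed.

Lemma hessian_separated P Q c c' t l i j :
  hessian (separated P c) (separated Q c') t l i j =
  if i == j then ((P i)^`()^`() - l *: (Q i)^`()^`()).[t 0 i] else 0.
Proof.
rewrite /hessian !mderiv_separated !mderiv_in_variable; case: eqP => _.
  by rewrite !meval_in_variable hornerD hornerN hornerZ.
by rewrite !meval0 mulr0 subrr.
Qed.

Lemma finitely_many_root_points (p : 'I_s -> {poly F}) : (forall i, p i != 0) ->
  exists ts : seq 'rV[F]_s, forall t, (forall i, root (p i) (t 0 i)) -> t \in ts.
Proof.
move=> p0; pose M := (\sum_i size (roots_of (p i)))%N.
exists [seq \row_i nth 0 (roots_of (p i)) (k i) | k : {ffun 'I_s -> 'I_M.+1}] => t pt.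
apply/mapP; exists [ffun i => inord (index (t 0 i) (roots_of (p i)))]; first by rewrite mem_enum.
apply/rowP => i; rewrite mxE ffunE inordK ?nth_index ?mem_roots_of //.
by rewrite ltnS (leq_trans (index_size _ _)) // /M (bigD1 i) //= leq_addr.
Qed.

Lemma size_roots_XnsubC n (l : F) : (0 < n)%N -> size (roots_of ('X^n - l%:P)) = n.
Proof. by move=> n0; rewrite size_roots_of ?size_XnsubC // -size_poly_eq0 size_XnsubC. Qed.

Lemma mem_roots_XnsubC n (l z : F) : (0 < n)%N -> (z \in roots_of ('X^n - l%:P)) = (z ^+ n == l).
Proof.
move=> n0; rewrite mem_roots_of -?size_poly_eq0 ?size_XnsubC //.
by rewrite rootE hornerD hornerN hornerXn hornerC subr_eq0.
Qed.

Lemma uniq_roots_XnsubC n (l : F) : (0 < n)%N -> l != 0 -> uniq (roots_of ('X^n - l%:P)).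
Proof.
move=> n0 l0; apply: uniq_roots_of => [|z]; first by rewrite -size_poly_eq0 size_XnsubC.
rewrite !rootE !(hornerD, hornerN, hornerXn, hornerC) derivB derivXn derivC subr0 subr_eq0.
move=> /eqP zl; rewrite hornerMn hornerXn mulrn_eq0 negb_or -lt0n n0 /=.
by apply: contra l0 => /eqP z0; rewrite -zl -(prednK n0) exprS z0 mulr0.
Qed.

(* For [mu] outside the roots of [bad], the points with proportional gradients and multiplier
   [mu ^+ gamma] are the values [T k mu] of finitely many branches [k]. The last equation on the
   branch [k] is [Num k / Den k + c = 0], and [G k] vanishes at the zeros of the denominator of the
   quotient. *)
Variables (P Q : 'I_s -> {poly F}) (c' : F) (gamma : nat).
Variables (B : finType) (T : B -> F -> 'rV[F]_s) (bad : {poly F}) (Num Den G : B -> {poly F}).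
Hypothesis gamma_gt0 : (0 < gamma)%N.
Hypothesis bad_neq0 : bad != 0.
Hypothesis bad_0 : root bad 0.
Hypothesis branchP : forall mu, ~~ root bad mu -> forall t,
  (forall i, (P i)^`().[t 0 i] = mu ^+ gamma * (Q i)^`().[t 0 i]) <-> exists k, t = T k mu.
Hypothesis branch_inj : forall mu, ~~ root bad mu -> injective (T^~ mu).
Hypothesis branch_simple : forall mu, ~~ root bad mu -> forall k i,
  ((P i)^`()^`() - mu ^+ gamma *: (Q i)^`()^`()).[T k mu 0 i] != 0.
Hypothesis Den_neq0 : forall k, Den k != 0.
Hypothesis Num_Den_coprime : forall k, coprimep (Num k) (Den k).
Hypothesis size_Num : forall k, (size (Den k) < size (Num k))%N.
Hypothesis Num_Den : forall mu, ~~ root bad mu -> forall k, (Den k).[mu] != 0 /\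
  \sum_i (P i).[T k mu 0 i] - mu ^+ gamma * (\sum_i (Q i).[T k mu 0 i] + c') =
  (Num k).[mu] / (Den k).[mu].
Hypothesis G_neq0 : forall k, G k != 0.
Hypothesis GP : forall mu, ~~ root bad mu -> forall k, ~~ root (G k) mu ->
  \sum_i (Q i).[T k mu 0 i] + c' != 0.
Hypothesis pencil_neq0 : forall l i, (P i)^`() - l *: (Q i)^`() != 0.

(** The points with proportional gradients form a curve, which is a union of rational curves
    parametrised by [mu]; on each of them the roots of the last equation are simple for a general
    constant [c]. Each critical point is obtained [gamma] times, once for each root [mu] of order
    [gamma] of its multiplier. *)
Theorem separated_count : exists c (zs : seq ('rV[F]_s * F)),
  [/\ uniq zs,
      forall t l, multiplier_point (separated P c) (separated Q c') t l <-> (t, l) \in zs,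
      forall t l, (t, l) \in zs -> [/\ l != 0, meval (t 0) (separated Q c') != 0,
        forall i j, i != j -> hessian (separated P c) (separated Q c') t l i j = 0 &
        forall i, hessian (separated P c) (separated Q c') t l i i != 0]
    & (gamma * size zs = \sum_(k : B) (size (Num k)).-1)%N].
Proof.
have /choice[ex exP] : forall k, exists cs : seq F, forall c, c \notin cs ->
    [/\ size (Num k + c *: Den k) = size (Num k),
        forall z, root (Num k + c *: Den k) z -> ~~ root (bad * G k) z &
        uniq (roots_of (Num k + c *: Den k))].
  by move=> k; apply: generic_combination => //; rewrite mulf_neq0.
have /choice[ts tsP] : forall mu, exists ts : seq 'rV[F]_s, forall t,
    (forall i, root ((P i)^`() - mu ^+ gamma *: (Q i)^`()) (t 0 i)) -> t \in ts.
  by move=> mu; apply: finitely_many_root_points.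
pose level mu t := mu ^+ gamma * (\sum_i (Q i).[t 0 i] + c') - \sum_i (P i).[t 0 i].
have [c] := exists_avoiding (flatten [seq ex k | k <- enum B] ++
  flatten [seq [seq level mu t | t <- ts mu] | mu <- roots_of bad]).
rewrite mem_cat negb_or => /andP[c_ex c_bad].
have {c_ex} exPc k : c \notin ex k.
  by apply: contra c_ex => ck; apply/flattenP; exists (ex k) => //; rewrite map_f // mem_enum.
have good mu t :
    multiplier_point (separated P c) (separated Q c') t (mu ^+ gamma) -> ~~ root bad mu.
  move=> /multiplier_point_separated[h0 h]; apply: contra c_bad => bmu.
  apply/flattenP; exists [seq level mu t | t <- ts mu].
    by apply: (map_f (fun mu => [seq level mu t | t <- ts mu])); rewrite mem_roots_of.
  apply/mapP; exists t; last by rewrite /level -h0 addrC addKr.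
  by apply: tsP => i; rewrite rootE hornerD hornerN hornerZ h subrr.
pose H k := Num k + c *: Den k.
have H0 k : H k != 0.
  by have [sz _ _] := exP k c (exPc k); rewrite -size_poly_gt0 sz (leq_ltn_trans _ (size_Num k)).
have zeroP mu t : ~~ root bad mu ->
    multiplier_point (separated P c) (separated Q c') t (mu ^+ gamma) <->
    exists2 k, t = T k mu & root (H k) mu.
  move=> gmu; rewrite multiplier_point_separated.
  have E k : (\sum_i (P i).[T k mu 0 i] + c = mu ^+ gamma * (\sum_i (Q i).[T k mu 0 i] + c'))
      <-> root (H k) mu.
    have [D0 e] := Num_Den gmu k; rewrite rootE hornerD hornerZ.
    have -> : (Num k).[mu] + c * (Den k).[mu] = ((Num k).[mu] / (Den k).[mu] + c) * (Den k).[mu].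
      by rewrite mulrDl divfK.
    rewrite mulf_eq0 (negPf D0) orbF -e; split=> [h|/eqP h].
      by rewrite addrAC h subrr.
    by apply/eqP; rewrite -subr_eq0 addrAC h.
  split=> [[h0 /(branchP gmu)[k tk]]|[k -> /E h0]].
    by exists k => //; apply/E; rewrite -tk.
  by split=> //; apply/(branchP gmu); exists k.
pose L := [seq (k, mu) | k <- enum B, mu <- roots_of (H k)].
have L_P k mu : ((k, mu) \in L) = root (H k) mu.
  rewrite -mem_roots_of //; apply/allpairsPdep/idP => [[k' [mu' [_ h [-> ->]]]] //|h].
  by exists k, mu; rewrite mem_enum.
have uL : uniq L.
  apply: allpairs_uniq_dep; first exact: enum_uniq.
    by move=> k _; have [] := exP k c (exPc k).
  by move=> [k mu] [k' mu'] _ _ /= [-> ->].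
have L_good k mu : (k, mu) \in L -> ~~ root bad mu /\ ~~ root (G k) mu.
  rewrite L_P => /(let: And3 _ h _ := exP k c (exPc k) in h mu).
  by rewrite rootM negb_or => /andP.
pose zs := undup [seq (T p.1 p.2, p.2 ^+ gamma) | p <- L].
have zsP t l : (t, l) \in zs <-> exists k mu, [/\ (k, mu) \in L, t = T k mu & l = mu ^+ gamma].
  rewrite mem_undup; split=> [/mapP[[k mu] /= kL [-> ->]]|[k [mu [kL -> ->]]]].
    by exists k, mu.
  exact: (map_f (fun p => (T p.1 p.2, p.2 ^+ gamma)) kL).
exists c, zs; split; first exact: undup_uniq.
- move=> t l; rewrite zsP; split=> [h|[k [mu [kL -> ->]]]].
    have [mu mul] : exists mu, mu ^+ gamma = l.
      have : size (roots_of ('X^gamma - l%:P)) != 0%N by rewrite size_roots_XnsubC // -lt0n.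
      case E : (roots_of _) => [|mu r] // _; exists mu.
      by apply/eqP; rewrite -mem_roots_XnsubC // E mem_head.
    have gmu : ~~ root bad mu by apply: (good mu t); rewrite mul.
    move: h; rewrite -mul => /(zeroP mu t gmu)[k tk Hk].
    by exists k, mu; rewrite L_P.
  have [gmu _] := L_good _ _ kL; apply/(zeroP mu _ gmu); exists k => //.
  by rewrite -L_P.
- move=> t l /zsP[k [mu [kL -> ->]]]; have [gmu Gmu] := L_good _ _ kL; split.
  + apply: contra gmu; rewrite expf_eq0 => /andP[_ /eqP ->]; exact: bad_0.
  + by rewrite meval_separated; exact: GP.
  + by move=> i j /negPf ij; rewrite hessian_separated ij.
  + by move=> i; rewrite hessian_separated eqxx; exact: branch_simple.
have <- : size L = (\sum_(k : B) (size (Num k)).-1)%N.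
  rewrite size_allpairs_dep sumnE big_map big_enum /=; apply: eq_bigr => k _.
  by rewrite size_roots_of //; have [-> _ _] := exP k c (exPc k).
pose L2 := [seq (T p.1 p.2, p.2) | p <- L].
pose L3 := [seq (z.1, mu) | z <- zs, mu <- roots_of ('X^gamma - (z.2)%:P)].
have <- : size L2 = size L by rewrite size_map.
have uL2 : uniq L2.
  rewrite map_inj_in_uniq // => -[k mu] [k' mu'] kL kL' /= [e emu]; move: e; rewrite emu.
  by have [gmu' _] := L_good _ _ kL'; move=> /(branch_inj gmu') ->.
have uL3 : uniq L3.
  apply: allpairs_uniq_dep; first exact: undup_uniq.
    move=> [t l] /zsP[k [mu [kL _ ->]]] /=; apply: uniq_roots_XnsubC => //.
    have [gmu _] := L_good _ _ kL.
    by apply: contra gmu; rewrite expf_eq0 => /andP[_ /eqP ->]; exact: bad_0.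
  move=> [[t l] mu] [[t' l'] mu'] /allpairsPdep[[t1 l1] [mu1 [_ + [e1 e2 e3]]]].
  rewrite /= in e1 e2 e3 *; rewrite mem_roots_XnsubC // => /eqP h1.
  move=> /allpairsPdep[[t2 l2] [mu2 [_ + [f1 f2 f3]]]].
  rewrite /= in f1 f2 f3 *; rewrite mem_roots_XnsubC // => /eqP h2 [ett emm].
  by rewrite e2 f2 -h1 -h2 -e3 -f3 ett emm.
have <- : size L3 = size L2.
  apply/perm_size/uniq_perm => // -[t mu]; apply/allpairsPdep/mapP.
    move=> [[t1 l1] [mu1 [/zsP[k [mu2 [kL -> ->]]] + [-> ->]]]] /=.
    rewrite mem_roots_XnsubC // => /eqP e.
    have [gmu2 _] := L_good _ _ kL.
    have h : multiplier_point (separated P c) (separated Q c') (T k mu2) (mu1 ^+ gamma).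
      by rewrite e; apply/(zeroP mu2 _ gmu2); exists k => //; rewrite -L_P.
    have [k' tk Hk] := (zeroP mu1 _ (good _ _ h)).1 h.
    by exists (k', mu1); rewrite ?L_P //= tk.
  move=> [[k mu1] kL [-> ->]]; exists (T k mu1, mu1 ^+ gamma), mu1; split=> //=.
    by apply/zsP; exists k, mu1.
  by rewrite mem_roots_XnsubC.
rewrite size_allpairs_dep sumnE big_map (eq_bigr (fun=> gamma)) => [|z _].
  by rewrite big_const_seq count_predT iter_addn_0.
by rewrite size_roots_XnsubC.
Qed.

End SeparatedCount.

(** * Boundedness of critical points *)

Section SeparatedInfinity.
Variables (K : numFieldType) (R : realType) (nu : proper_absval K R) (s : nat).
Implicit Types (P Q : 'I_s -> {poly K}) (f g : mpoly s K) (t : 'rV[K]_s).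

Lemma size_deriv_le (p : {poly K}) m : (0 < m)%N -> (size p <= m.+1)%N -> (size p^`() <= m.-1.+1)%N.
Proof.
move=> m0 pm; rewrite prednK //; apply/leq_sizeP => k mk.
by rewrite coef_deriv nth_default ?mul0rn // (leq_trans pm).
Qed.

Lemma msize_mderiv_le f i m : (0 < m)%N -> (msize f <= m.+1)%N -> (msize (mderiv i f) <= m.-1.+1)%N.
Proof.
move=> m0 fm; rewrite prednK // msizeE; apply/bigmax_leqP_seq => k + _.
rewrite mcoeff_msupp mcoeff_deriv; apply: contraR; rewrite -ltnNge ltnS => mk.
rewrite (memN_msupp_eq0 (m := _)) ?mul0rn // msize_mdeg_ge //.
by rewrite mdegD mdeg1 addn1 (leq_trans fm).
Qed.

Lemma homogenization_partial P c j m : (0 < m)%N -> (forall i, (size (P i) <= m.+1)%N) ->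
  exists2 h, homogenization m.-1 (mderiv j (separated P c)) h &
    forall t, h (t, 0) = ((P j)^`())`_m.-1 * t 0 j ^+ m.-1.
Proof.
move=> m0 Pm; rewrite mderiv_separated in_variable_separated.
have [|h hh hE] := @homogenization_separated K s (fun i => if i == j then (P j)^`() else 0) 0 m.-1.
  by move=> i; case: eqP => _; [exact: size_deriv_le|rewrite size_poly0].
exists h => // t; rewrite hE mul0r addr0 (bigD1 j) //= eqxx big1 ?addr0 // => i /negPf ->.
by rewrite coef0 mul0r.
Qed.

(** At a singular point of a member of the pencil, the gradients of [f] and [g] are proportional,
    and so are their extensions by [f0] and [g0]; no such point can be close to infinity if the
    leading forms of the extended gradients are nowhere proportional. The extension matters because
    the leading forms of the gradients alone may be proportional: one takes [f] and [g] themselves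
    if their degrees differ, and their Euler defects, defined below, if the degrees agree. *)
Lemma singular_members_bounded f g f1 g1 f0 g0 f01 g01 (d e : nat) D0 E0 hA hB hA0 hB0 :
  (0 < d)%N -> (0 < e)%N -> (D0 + e.-1 = d.-1 + E0)%N ->
  (msize f1 <= d.+1)%N -> (msize g1 <= e.+1)%N ->
  (msize f01 <= D0.+1)%N -> (msize g01 <= E0.+1)%N ->
  (forall i, homogenization d.-1 (mderiv i f) (hA i)) ->
  (forall i, homogenization e.-1 (mderiv i g) (hB i)) ->
  homogenization D0 f0 hA0 -> homogenization E0 g0 hB0 ->
  (forall t a b eps, singular_member (f + eps *: f1) (g + eps *: g1) t a b ->
     a * meval (t 0) (f0 + eps *: f01) = b * meval (t 0) (g0 + eps *: g01)) ->
  (forall t i, t 0 i = 1 ->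
     (forall j, hA j (t, 0) * hB i (t, 0) = hA i (t, 0) * hB j (t, 0)) ->
     hA0 (t, 0) * hB i (t, 0) = hA i (t, 0) * hB0 (t, 0) -> False) ->
  exists rho, \forall eps \near (0 : K), forall t a b, (a != 0) || (b != 0) ->
     singular_member (f + eps *: f1) (g + eps *: g1) t a b -> polydisc nu 0 rho t.
Proof.
move=> d0 e0 DE sf1 sg1 sf01 sg01 HA HB HA0 HB0 last top.
pose fam T (u : 'I_s -> T) u0 (k : 'I_s.+1) := if unlift ord_max k is Some i then u i else u0.
have famI T (u : 'I_s -> T) u0 i : fam T u u0 (widen i) = u i by rewrite /fam widen_lift liftK.
have famM T (u : 'I_s -> T) u0 : fam T u u0 ord_max = u0 by rewrite /fam unlift_none.
pose A := fam _ (fun i => mderiv i f) f0; pose B := fam _ (fun i => mderiv i g) g0.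
pose A1 := fam _ (fun i => mderiv i f1) f01; pose B1 := fam _ (fun i => mderiv i g1) g01.
pose D := fam _ (fun=> d.-1) D0; pose E := fam _ (fun=> e.-1) E0.
have [||||||rho rhoP] := @no_zeros_at_infinity _ _ nu _ 'I_s.+1 A B A1 B1 D E
  (fam _ hA hA0) (fam _ hB hB0).
- move=> k l; rewrite /D /E /fam; case: unlift => [?|]; case: unlift => [?|] //=; lia.
- by move=> k; rewrite /A /D /fam; case: unlift.
- by move=> k; rewrite /B /E /fam; case: unlift.
- by move=> k; rewrite /A1 /D /fam; case: unlift => [i|//]; exact: msize_mderiv_le.
- by move=> k; rewrite /B1 /E /fam; case: unlift => [i|//]; exact: msize_mderiv_le.
- move=> t i ti; apply: contrapT => H.
  have cross k l : fam _ hA hA0 k (t, 0) * fam _ hB hB0 l (t, 0) =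
                   fam _ hA hA0 l (t, 0) * fam _ hB hB0 k (t, 0).
    by apply/eqP/negPn/negP => kl; apply: H; exists k, l.
  apply: (top t i ti) => [j|].
    by have := cross (widen j) (widen i); rewrite !famI.
  by have := cross ord_max (widen i); rewrite !famI !famM.
exists rho; apply: filterS rhoP => eps rhoP t a b ab sing; apply: rhoP.
have prop k : a * meval (t 0) (A k + eps *: A1 k) = b * meval (t 0) (B k + eps *: B1 k).
  rewrite /A /A1 /B /B1 /fam; case: unlift => [i|]; last exact: last.
  by have [_ /(_ i)] := sing; rewrite !mderivD !mderivZ.
move=> k l; case/orP: ab => [a0|b0].
  by apply: (mulfI a0); rewrite mulrA prop [RHS]mulrA prop mulrAC -!mulrA.
by apply: (mulfI b0); rewrite mulrCA -prop [RHS]mulrCA -prop; ring.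
Qed.

(** [d f - sum_j X_j d_j f], the partial derivative of the homogenization of [f] with respect to
    the new variable. *)
Definition euler_defect d f : mpoly s K := d%:R *: f - \sum_j mpolyX K (mnm1 j) * mderiv j f.

Lemma euler_defect_linear d f f1 eps :
  euler_defect d (f + eps *: f1) = euler_defect d f + eps *: euler_defect d f1.
Proof.
rewrite /euler_defect scalerBr scalerDr scalerA [_ * eps]mulrC -scalerA addrACA -opprD.
congr (_ - _); rewrite scaler_sumr -big_split; apply: eq_bigr => j _ /=.
by rewrite mderivD mderivZ mulrDr scalerAr.
Qed.

(** By the identity of Euler, the terms of degree [d] cancel. *)
Lemma msize_euler_defect d f : (0 < d)%N -> (msize f <= d.+1)%N ->
  (msize (euler_defect d f) <= d)%N.
Proof.
move=> d0 fd; have -> : euler_defect d f = \sum_(m : bmultinom s d.+1)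
    (mcoeff m f * (d%:R - (mdeg m)%:R)) *: mpolyX K m.
  rewrite /euler_defect {1}(mpolywE fd) scaler_sumr.
  have -> : \sum_j mpolyX K (mnm1 j) * mderiv j f =
      \sum_(m : bmultinom s d.+1) (mcoeff m f * (mdeg m)%:R) *: mpolyX K m.
    have dE j : mderiv j f = \sum_(m : bmultinom s d.+1) mderiv j (mcoeff m f *: mpolyX K m).
      by rewrite [f in LHS](mpolywE fd) raddf_sum.
    under eq_bigr do rewrite dE mulr_sumr.
    rewrite exchange_big; apply: eq_bigr => m _ /=.
    rewrite mdegE natr_sum mulr_sumr scaler_suml; apply: eq_bigr => j _.
    rewrite mderivZ mderivX -!scalerAr scalerA.
    case: (posnP (m j)) => [->|mj]; first by rewrite mulr0 !scale0r.
    rewrite -mpolyXD; congr (_ *: mpolyX _ _); apply/mnmP => k.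
    rewrite mnmDE mnmBE mnm1E; case: eqP => [<-|_]; last by rewrite subn0.
    by rewrite addnC subnK.
  rewrite -sumrB; apply: eq_bigr => m _; rewrite scalerA -scalerBl; congr (_ *: _).
  by rewrite mulrBr mulrC.
apply: (leq_trans (msize_sum _ _ _)); apply/bigmax_leqP_seq => m _ _.
have [->|md] := eqVneq (mdeg m) d; first by rewrite subrr mulr0 scale0r msize0.
rewrite (leq_trans (msizeZ_le _ _)) // msizeX.
by rewrite ltn_neqAle md -ltnS bmdeg.
Qed.

Lemma euler_defect_separated d P c :
  euler_defect d (separated P c) = separated (fun i => d%:R *: P i - 'X * (P i)^`()) (d%:R * c).
Proof.
have iZ (i : 'I_s) a (p : {poly K}) : in_variable i (a *: p) = a *: in_variable i p.
  have [iC _ _ iM] := @in_variable_is_ring_hom K s i.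
  by rewrite -mul_polyC iM iC mul_mpolyC.
have iB (i : 'I_s) (p q : {poly K}) : in_variable i (p - q) = in_variable i p - in_variable i q.
  have [_ _ iD _] := @in_variable_is_ring_hom K s i.
  by rewrite iD -scaleN1r iZ scaleN1r.
rewrite /euler_defect /separated scalerDr addrAC -[d%:R *: mpolyC s c]mul_mpolyC -mpolyCM.
congr (_ + _).
rewrite scaler_sumr -sumrB; apply: eq_bigr => i _.
have [_ iX _ iM] := @in_variable_is_ring_hom K s i.
by rewrite iB iZ iM iX mderiv_separated.
Qed.

Lemma singular_member_euler d f g t a b : singular_member f g t a b ->
  a * meval (t 0) (euler_defect d f) = b * meval (t 0) (euler_defect d g).
Proof.
have E p : meval (t 0) (euler_defect d p) =
    d%:R * meval (t 0) p - \sum_j t 0 j * meval (t 0) (mderiv j p).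
  rewrite mevalB mevalZ (raddf_sum (meval (t 0))); congr (_ - _); apply: eq_bigr => j _ /=.
  by rewrite mevalM mevalXU.
move=> [h0 h]; rewrite !E !mulrBr; congr (_ - _); first by rewrite mulrCA h0 mulrCA.
rewrite !mulr_sumr; apply: eq_bigr => j _.
by rewrite mulrCA h mulrCA.
Qed.

End SeparatedInfinity.

Section GeneralCount.
Variables (K : numClosedFieldType) (R : realType) (nu : proper_absval K R) (s d e : nat).

(** The same example serves for both orders of the degrees: its perturbations have no singular zero,
    so that [f / g] and [g / f] have the same critical points. *)
Lemma general_count_of_example (f g : mpoly s K) (zs : seq ('rV[K]_s * K)) :
  (0 < s)%N -> poly_pairs d e (f, g) ->
  uniq zs -> (forall t l, multiplier_point f g t l <-> (t, l) \in zs) ->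
  (forall t l, (t, l) \in zs -> [/\ l != 0, meval (t 0) g != 0,
     forall i j, i != j -> hessian f g t l i j = 0 & forall i, hessian f g t l i i != 0]) ->
  (forall t, ~ singular_zero g t) ->
  (forall f1 g1 : mpoly s K, poly_pairs d e (f1, g1) -> exists rho,
     \forall eps \near (0 : K), forall t a b, (a != 0) || (b != 0) ->
       singular_member (f + eps *: f1) (g + eps *: g1) t a b -> polydisc nu 0 rho t) ->
  holds_for_general_pair d e
    [set fg : mpoly s K * mpoly s K | (alg_critical fg.1 fg.2 #= `I_(size zs))%card] /\
  holds_for_general_pair e d
    [set fg : mpoly s K * mpoly s K | (alg_critical fg.1 fg.2 #= `I_(size zs))%card].
Proof.
move=> s0 [fd ge] uzs zsP znd ng bnd.
have near_count f1 g1 : poly_pairs d e (f1, g1) -> \forall k \near \oo,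
    [/\ (alg_critical (f + k.+1%:R^-1 *: f1) (g + k.+1%:R^-1 *: g1) #= `I_(size zs))%card,
        forall t, ~ singular_zero (f + k.+1%:R^-1 *: f1) t &
        forall t, ~ singular_zero (g + k.+1%:R^-1 *: g1) t].
  move=> /bnd[rho /(critical_points_persist uzs zsP znd ng) h].
  exact: (nbhs0_harmonic nu h).
split.
  apply: (general_pair_card s0 (f := f) (g := g)) => // f1 g1 /near_count.
  by apply: filterS => k [].
apply: (general_pair_card s0 (f := g) (g := f)) => // g1 f1 [/= g1e f1d].
have := near_count f1 g1 (conj f1d g1e); apply: filterS => k [h nf ng'].
by rewrite alg_criticalC.
Qed.

End GeneralCount.

(** * Simple roots and independent powers *)

Section SimpleRoots.
Variable F : numClosedFieldType.

Definition first_nats b : seq F := [seq k.+1%:R | k <- iota 0 b].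

(** [(X - 1) ... (X - b)] *)
Definition falling b : {poly F} := \prod_(z <- first_nats b) ('X - z%:P).

Lemma uniq_first_nats b : uniq (first_nats b).
Proof. by rewrite map_inj_uniq ?iota_uniq // => x y /eqP; rewrite eqr_nat => /eqP[]. Qed.

Lemma size_first_nats b : size (first_nats b) = b.
Proof. by rewrite size_map size_iota. Qed.

Definition falling_root b (k : 'I_b) : F := (first_nats b)`_k.

Lemma falling_root_mem b (k : 'I_b) : falling_root k \in first_nats b.
Proof. by rewrite mem_nth // size_first_nats. Qed.

Lemma falling_root_inj b : injective (@falling_root b).
Proof.
by move=> k l /eqP; rewrite nth_uniq ?size_first_nats ?uniq_first_nats // => /eqP/val_inj.
Qed.

Lemma falling_root_surj b z : z \in first_nats b -> exists k : 'I_b, z = falling_root k.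
Proof.
move=> zr; have zi : (index z (first_nats b) < b)%N.
  by rewrite -[X in (_ < X)%N](size_first_nats b) index_mem.
by exists (Ordinal zi); rewrite /falling_root nth_index.
Qed.

Lemma falling_monic b : falling b \is monic. Proof. exact: monic_prod_XsubC. Qed.

Lemma falling_neq0 b : falling b != 0. Proof. exact: monic_neq0 (falling_monic b). Qed.

Lemma size_falling b : size (falling b) = b.+1.
Proof. by rewrite size_prod_XsubC size_first_nats. Qed.

Lemma falling_lead b : (falling b)`_b = 1.
Proof. by have /monicP := falling_monic b; rewrite lead_coefE size_falling. Qed.

Lemma root_falling b z : root (falling b) z = (z \in first_nats b).
Proof. exact: root_prod_XsubC. Qed.

Lemma deriv_falling_neq0 b z : z \in first_nats b -> (falling b)^`().[z] != 0.
Proof.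
move=> zr; rewrite /falling (big_rem z zr) /= derivM derivXsubC mul1r hornerD hornerM hornerXsubC.
rewrite subrr mul0r addr0 -/(root _ _) root_prod_XsubC mem_rem_uniq ?uniq_first_nats //.
by rewrite inE eqxx.
Qed.

(** [p (a X)] *)
Definition dilate (p : {poly F}) a : {poly F} := \poly_(k < size p) (p`_k * a ^+ k).

Lemma coef_dilate p a k : (dilate p a)`_k = p`_k * a ^+ k.
Proof. by rewrite coef_poly; case: ltnP => // h; rewrite nth_default ?mul0r. Qed.

Lemma horner_dilate p a x : (dilate p a).[x] = p.[a * x].
Proof.
rewrite horner_poly horner_coef; apply: eq_bigr => k _.
by rewrite exprMn mulrA.
Qed.

(** When [q i] is the derivative of [Q i], this makes [0] a regular value of
    [\sum_i Q i (X_i) + c]. *)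
Lemma constant_avoiding s (Q q : 'I_s -> {poly F}) : (forall i, q i != 0) ->
  exists c, forall t : 'rV[F]_s, (forall i, root (q i) (t 0 i)) -> \sum_i (Q i).[t 0 i] + c != 0.
Proof.
move=> q0; have [ts tsP] := finitely_many_root_points q0.
have [c cP] := exists_avoiding [seq - \sum_i (Q i).[t 0 i] | t : 'rV[F]_s <- ts].
exists c => t /tsP tt; apply: contra cP; rewrite addrC addr_eq0 => /eqP ->.
exact: (map_f (fun t : 'rV[F]_s => - \sum_i (Q i).[t 0 i]) tt).
Qed.

(** The last nonzero term exceeds the sum of all others in absolute value, because
    [1 + 3 + ... + 3 ^ (m - 1) < 3 ^ m]. *)
Lemma powers_of_3_independent s (u : 'I_s -> F) : (forall j, u j = 0 \/ `|u j| = 1) ->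
  \sum_(j < s) 3 ^+ j * u j = 0 -> forall j, u j = 0.
Proof.
move=> u01 sum0 j0; apply/eqP/negPn/negP => uj0.
have [m [um mmax]] : exists m, u m != 0 /\ forall i, u i != 0 -> (i <= m)%N.
  pose P (i : 'I_s) := u i != 0.
  have Pj0 : P j0 by [].
  by exists [arg max_(i > j0 | P i) (i : nat)]%N; case: arg_maxnP.
move/eqP: sum0; rewrite (bigD1 m) //= addr_eq0 => /eqP/(congr1 Num.norm).
rewrite normrM normrN normrX normr_nat.
have -> : `|u m| = 1 by case: (u01 m) => // h; rewrite h eqxx in um.
rewrite mulr1 => e; have : `|\sum_(j < s | j != m) 3 ^+ j * u j| < 3 ^+ m; last by rewrite -e ltxx.
have lt3 n : \sum_(k < n) (3 : F) ^+ k < 3 ^+ n.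
  elim: n => [|n IH]; first by rewrite big_ord0 expr0 ltr01.
  rewrite big_ord_recr /= exprS (_ : 3 * 3 ^+ n = 3 ^+ n + 3 ^+ n + 3 ^+ n); last by ring.
  by apply: ltr_wpDr; rewrite ?ltrD2r // exprn_ge0 ?ler0n.
apply: le_lt_trans (ler_norm_sum _ _ _) (le_lt_trans _ (lt3 m)).
rewrite (big_ord_widen s (fun k => (3 : F) ^+ k)) 1?ltnW // big_mkcond [X in _ <= X]big_mkcond /=.
apply: ler_sum => i _; case: eqP => [->|/eqP im]; first by rewrite ltnn.
have [->|ui] := eqVneq (u i) 0.
  by rewrite mulr0 normr0; case: ifP => // _; rewrite exprn_ge0 ?ler0n.
rewrite ltn_neqAle (mmax _ ui) andbT val_eqE im normrM normrX normr_nat.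
have -> : `|u i| = 1 by case: (u01 i) => // h; rewrite h eqxx in ui.
by rewrite mulr1.
Qed.

End SimpleRoots.

(** * An example with distinct degrees *)

Section DistinctDegrees.
Variables (K : numClosedFieldType) (R : realType) (nu : proper_absval K R) (s b gamma : nat).
Hypothesis s_gt0 : (0 < s)%N.
Hypothesis gamma_gt0 : (0 < gamma)%N.
Local Notation e := b.+1.
Local Notation d := (gamma + b).+1.
Local Notation w := (falling K b).

(* With the multiplier [mu ^+ gamma], the gradients are proportional exactly when each coordinate is
   a root of [w] or the product of [mu] by a root of unity of order dividing [gamma]. The last
   equation has degree [gamma] in [mu] if all coordinates are roots of [w], and [d] otherwise: the
   powers of [3] keep its leading coefficient from vanishing, and the leading forms at infinity from
   becoming proportional. *)
Let cf (i : 'I_s) : K := 3 ^+ i.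
Let P (i : 'I_s) : {poly K} := cf i *: integral ('X^gamma * w).
Let Q (i : 'I_s) : {poly K} := cf i *: integral w.

Let cf_neq0 i : cf i != 0. Proof. by rewrite expf_neq0 // pnatr_eq0. Qed.

Let derivP i : (P i)^`() = cf i *: ('X^gamma * w).
Proof. by rewrite derivZ deriv_integral. Qed.

Let derivQ i : (Q i)^`() = cf i *: w.
Proof. by rewrite derivZ deriv_integral. Qed.

Let coefP i : (P i)`_d = cf i / d%:R.
Proof. by rewrite coefZ coef_integral /= coefXnM ltnNge leq_addr /= addKn falling_lead mul1r. Qed.

Let coefQ i : (Q i)`_e = cf i / e%:R.
Proof. by rewrite coefZ coef_integral /= falling_lead mul1r. Qed.

Let sizeP i : (size (P i) <= d.+1)%N.
Proof.
rewrite (leq_trans (size_scale_leq _ _)) // (leq_trans (size_integral _)) // ltnS.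
by rewrite size_Mmonic ?falling_monic ?monic_neq0 ?monicXn // size_polyXn size_falling addSn addnS.
Qed.

Let sizeQ i : (size (Q i) <= e.+1)%N.
Proof.
by rewrite (leq_trans (size_scale_leq _ _)) // (leq_trans (size_integral _)) // size_falling.
Qed.

Local Notation B := {ffun 'I_s -> 'I_b + 'I_gamma}.

Let zeta (k : 'I_gamma) : K := (roots_of ('X^gamma - 1%:P))`_k.
Local Notation tau := (@falling_root K b).

Let zeta_pow k : zeta k ^+ gamma = 1.
Proof. by apply/eqP; rewrite -mem_roots_XnsubC // mem_nth // size_roots_XnsubC. Qed.

Let zeta_inj : injective zeta.
Proof.
move=> k l /eqP; rewrite nth_uniq ?size_roots_XnsubC ?uniq_roots_XnsubC ?oner_eq0 //.
by move/eqP/val_inj.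
Qed.

Let zeta_surj z : z ^+ gamma = 1 -> exists k, z = zeta k.
Proof.
move/eqP; rewrite -mem_roots_XnsubC // => zr.
have zi : (index z (roots_of ('X^gamma - 1%:P)) < gamma)%N.
  by rewrite -[X in (_ < X)%N](@size_roots_XnsubC K gamma 1 gamma_gt0) index_mem.
by exists (Ordinal zi); rewrite /zeta nth_index.
Qed.

Let zeta_norm k : `|zeta k| = 1.
Proof.
apply/eqP; rewrite -(@pexpr_eq1 _ _ gamma) ?normr_ge0 //.
by rewrite -normrX zeta_pow normr1.
Qed.

Let T (k : B) (mu : K) : 'rV[K]_s :=
  \row_i match k i with inl j => tau j | inr l => zeta l * mu end.

Let bad : {poly K} := 'X * \prod_(z <- first_nats K b) ('X^gamma - (z ^+ gamma)%:P).

Let bad_neq0 : bad != 0.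
Proof.
rewrite mulf_neq0 ?polyX_eq0 // prodf_seq_neq0; apply/allP => z _ /=.
by rewrite -size_poly_eq0 size_XnsubC.
Qed.

Let badP mu : ~~ root bad mu <->
  mu != 0 /\ forall z, z \in first_nats K b -> mu ^+ gamma != z ^+ gamma.
Proof.
rewrite rootM negb_or rootX.
have -> : ~~ root (\prod_(z <- first_nats K b) ('X^gamma - (z ^+ gamma)%:P)) mu =
    all (fun z => mu ^+ gamma != z ^+ gamma) (first_nats K b).
  rewrite rootE horner_prod prodf_seq_neq0; apply: eq_all => z /=.
  by rewrite hornerD hornerN hornerXn hornerC subr_eq0.
by split=> [/andP[-> /allP]|[-> /allP]].
Qed.

Let gradient mu i (x : K) : (P i)^`().[x] = mu ^+ gamma * (Q i)^`().[x] <->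
  x ^+ gamma = mu ^+ gamma \/ x \in first_nats K b.
Proof.
rewrite derivP derivQ !hornerZ hornerM hornerXn mulrCA -root_falling rootE.
split=> [h|[->|/eqP ->]]; rewrite ?mulr0 //.
have /eqP : (x ^+ gamma - mu ^+ gamma) * (cf i * w.[x]) = 0 by rewrite mulrBl h subrr.
by rewrite !mulf_eq0 subr_eq0 (negPf (cf_neq0 i)) => /orP[/eqP|]; [left|right].
Qed.

Let branchP mu : ~~ root bad mu -> forall t : 'rV[K]_s,
  (forall i, (P i)^`().[t 0 i] = mu ^+ gamma * (Q i)^`().[t 0 i]) <-> exists k, t = T k mu.
Proof.
move=> /badP[mu0 _] t; split=> [h|[k ->] i]; last first.
  apply/gradient; rewrite mxE; case: (k i) => [j|l]; [right; exact: falling_root_mem|left].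
  by rewrite exprMn zeta_pow mul1r.
have /choice[k kP] : forall i, exists x : 'I_b + 'I_gamma,
    t 0 i = match x with inl j => tau j | inr l => zeta l * mu end.
  move=> i; have /gradient[e1|/falling_root_surj[j ->]] := h i; last by exists (inl j).
  have [l lE] : exists l, t 0 i / mu = zeta l.
    by apply: zeta_surj; rewrite expr_div_n e1 divff // expf_neq0.
  by exists (inr l); rewrite -lE divfK.
by exists [ffun i => k i]; apply/rowP => i; rewrite mxE ffunE.
Qed.

Let branch_inj mu : ~~ root bad mu -> injective (T^~ mu).
Proof.
move=> /badP[mu0 h] k k' /rowP e; apply/ffunP => i; have := e i; rewrite !mxE.
have neq j l : tau j <> zeta l * mu.
  move=> jl; have := h _ (falling_root_mem K j); rewrite jl exprMn zeta_pow mul1r eqxx; exact.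
case: (k i) (k' i) => [j|l] [j'|l'].
- by move/falling_root_inj => ->.
- by move/neq.
- by move/esym/neq.
- by move/(mulIf mu0)/zeta_inj => ->.
Qed.

Let branch_simple mu : ~~ root bad mu -> forall k i,
  ((P i)^`()^`() - mu ^+ gamma *: (Q i)^`()^`()).[T k mu 0 i] != 0.
Proof.
move=> /badP[mu0 h] k i; set x := T k mu 0 i.
have -> : ((P i)^`()^`() - mu ^+ gamma *: (Q i)^`()^`()).[x] =
    cf i * (gamma%:R * x ^+ gamma.-1 * w.[x] + (x ^+ gamma - mu ^+ gamma) * w^`().[x]).
  rewrite derivP derivQ !derivZ derivM derivXn.
  rewrite !(hornerD, hornerN, hornerZ, hornerM, hornerMn, hornerXn).
  by rewrite -mulr_natl; ring.
rewrite mulf_neq0 ?cf_neq0 // {}/x mxE; case: (k i) => [j|l].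
  have /eqP -> : w.[tau j] == 0 by rewrite -/(root _ _) root_falling falling_root_mem.
  rewrite mulr0 add0r mulf_neq0 ?deriv_falling_neq0 ?falling_root_mem //.
  by rewrite subr_eq0 eq_sym h ?falling_root_mem.
have l0 : zeta l != 0 by rewrite -normr_eq0 zeta_norm oner_eq0.
rewrite exprMn [in X in X - _]exprMn zeta_pow mul1r subrr mul0r addr0 -exprMn.
rewrite !mulf_neq0 ?pnatr_eq0 -?lt0n ?expf_neq0 ?mulf_neq0 //.
rewrite -/(root _ _) root_falling; apply/negP => /h.
by rewrite exprMn zeta_pow mul1r eqxx.
Qed.

Let pencil_neq0 l i : (P i)^`() - l *: (Q i)^`() != 0.
Proof.
have -> : (P i)^`() - l *: (Q i)^`() = cf i *: (('X^gamma - l%:P) * w).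
  by rewrite derivP derivQ mulrBl scalerBr mul_polyC !scalerA [l * _]mulrC.
rewrite scaler_eq0 negb_or cf_neq0 mulf_neq0 ?falling_neq0 //.
by rewrite -size_poly_eq0 size_XnsubC.
Qed.

Variable c' : K.
Hypothesis c'P : forall t : 'rV[K]_s, (forall i, root ((Q i)^`()) (t 0 i)) ->
  \sum_i (Q i).[t 0 i] + c' != 0.

Let Num (k : B) : {poly K} := \sum_i match k i with
  | inl j => ((P i).[tau j])%:P - (Q i).[tau j] *: 'X^gamma
  | inr l => dilate (P i) (zeta l) - 'X^gamma * dilate (Q i) (zeta l) end - c' *: 'X^gamma.

Let G (k : B) : {poly K} := \sum_i match k i with
  | inl j => ((Q i).[tau j])%:P
  | inr l => dilate (Q i) (zeta l) end + c'%:P.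

Let NumE k mu : \sum_i (P i).[T k mu 0 i] - mu ^+ gamma * (\sum_i (Q i).[T k mu 0 i] + c') =
  (Num k).[mu].
Proof.
rewrite /Num hornerD hornerN hornerZ hornerXn horner_sum mulrDr mulr_sumr opprD addrA -sumrB.
congr (_ - _); last by rewrite mulrC.
apply: eq_bigr => i _; rewrite mxE; case: (k i) => [j|l].
  by rewrite hornerD hornerN (hornerZ _ 'X^gamma) hornerC hornerXn mulrC.
by rewrite hornerD hornerN hornerM hornerXn !horner_dilate.
Qed.

Let GE k mu : \sum_i (Q i).[T k mu 0 i] + c' = (G k).[mu].
Proof.
rewrite /G hornerD horner_sum hornerC; congr (_ + _).
apply: eq_bigr => i _; rewrite mxE; case: (k i) => [j|l]; first by rewrite hornerC.
by rewrite horner_dilate.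
Qed.

Let u (k : B) i : K := if k i is inr l then zeta l ^+ e else 0.

Let constant_branch (k : B) := [forall i, if k i is inl _ then true else false].

Let sum_u k : ~~ constant_branch k -> \sum_i cf i * u k i != 0.
Proof.
rewrite negb_forall => /existsP[i ki]; apply/eqP => /powers_of_3_independent u0.
have /u0/(_ i) : forall j, u k j = 0 \/ `|u k j| = 1.
  by move=> j; rewrite /u; case: (k j) => [?|l]; [left|right; rewrite normrX zeta_norm expr1n].
rewrite /u; case: (k i) ki => // l _ /(congr1 Num.norm)/eqP.
by rewrite normrX zeta_norm expr1n normr0 oner_eq0.
Qed.

Let sum_tau k : constant_branch k -> \sum_i (if k i is inl j then (Q i).[tau j] else 0) + c' != 0.
Proof.
move=> /forallP kc.
pose t : 'rV[K]_s := \row_i if k i is inl j then tau j else 0.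
have -> : \sum_i (if k i is inl j then (Q i).[tau j] else 0) = \sum_i (Q i).[t 0 i].
  by apply: eq_bigr => i _; rewrite mxE; case: (k i) (kc i).
apply: c'P => i; rewrite mxE; case: (k i) (kc i) => // j _.
by rewrite derivQ rootZ ?cf_neq0 // root_falling falling_root_mem.
Qed.

Let de_neq : d%:R^-1 - e%:R^-1 != 0 :> K.
Proof.
by rewrite subr_eq0 (inj_eq invr_inj) eqr_nat eqSS -[X in _ != X]add0n eqn_add2r -lt0n.
Qed.

Let size_Num_le k : (size (Num k) <= d.+1)%N.
Proof.
apply/leq_sizeP => m dm; rewrite coefB coefZ coefXn.
have gm : (gamma < m)%N by rewrite (leq_trans _ dm) // ltnS -addnS leq_addr.
rewrite (gtn_eqF gm) mulr0 subr0 coef_sum big1 // => i _; case: (k i) => [j|l].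
  rewrite coefB coefC coefZ coefXn (gtn_eqF gm) mulr0 subr0.
  by rewrite (gtn_eqF (leq_ltn_trans (leq0n _) gm)).
rewrite coefB coefXnM ltnNge ltnW //= !coef_dilate !nth_default ?mul0r ?subr0 //.
  by apply: leq_trans (sizeQ i) _; rewrite leq_subRL ?(ltnW gm) // !addnS.
by rewrite (leq_trans (sizeP i)).
Qed.

Let size_Num k : size (Num k) = if constant_branch k then gamma.+1 else d.+1.
Proof.
case: ifPn => kc.
  have kE i : exists j, k i = inl j by case: (k i) (forallP kc i) => // j; exists j.
  have -> : Num k = \sum_i (if k i is inl j then (P i).[tau j] else 0)%:P -
      (\sum_i (if k i is inl j then (Q i).[tau j] else 0) + c') *: 'X^gamma.
    rewrite /Num scalerDl opprD addrA scaler_suml -sumrB; congr (_ - _).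
    by apply: eq_bigr => i _; have [j ->] := kE i.
  rewrite addrC -scaleNr size_polyDl size_scale ?oppr_eq0 ?sum_tau ?size_polyXn //.
  rewrite -(raddf_sum (@polyC K)) (leq_ltn_trans (size_polyC_leq1 _)) //.
apply/eqP; rewrite eqn_leq size_Num_le /= ltnNge; apply/negP => /leq_sizeP/(_ d (leqnn _)).
have gd : (gamma < d)%N by rewrite ltnS leq_addr.
rewrite coefB coefZ coefXn (gtn_eqF gd) mulr0 subr0 coef_sum.
rewrite (eq_bigr (fun i => (d%:R^-1 - e%:R^-1) * (cf i * u k i))) => [|i _].
  by rewrite -mulr_sumr => /eqP; rewrite mulf_eq0 (negPf de_neq) /= (negPf (sum_u kc)).
rewrite /u; case: (k i) => [j|l].
  by rewrite coefB coefC coefZ coefXn (gtn_eqF gd) !mulr0 subr0.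
rewrite coefB coefXnM ltnNge ltnW //= !coef_dilate -addnS addKn addnS coefP coefQ.
have -> : zeta l ^+ d = zeta l ^+ e by rewrite -addnS exprD zeta_pow mul1r.
by ring.
Qed.

Let G_neq0 k : G k != 0.
Proof.
have [kc|kc] := boolP (constant_branch k).
  have kE i : exists j, k i = inl j by case: (k i) (forallP kc i) => // j; exists j.
  have -> : G k = (\sum_i (if k i is inl j then (Q i).[tau j] else 0) + c')%:P.
    rewrite polyCD raddf_sum; congr (_ + _).
    by apply: eq_bigr => i _; have [j ->] := kE i.
  by rewrite polyC_eq0 sum_tau.
apply: contra_neq (sum_u kc) => /(congr1 (fun p : {poly K} => p`_e)).
rewrite coefD coefC addr0 coef0 coef_sum => h.
rewrite (eq_bigr (fun i => e%:R * (if k i is inr l then cf i / e%:R * zeta l ^+ e else 0))).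
  rewrite -mulr_sumr (_ : \sum_i _ = 0) ?mulr0 // -[RHS]h; apply: eq_bigr => i _.
  by case: (k i) => [j|l]; rewrite ?coefC // coef_dilate coefQ.
move=> i _; rewrite /u; case: (k i) => [j|l]; first by rewrite !mulr0.
by rewrite mulrA [e%:R * _]mulrC divfK // pnatr_eq0.
Qed.

Let count_branches :
  (\sum_(k : B) (size (Num k)).-1 + d * b ^ s = d * (gamma + b) ^ s + gamma * b ^ s)%N.
Proof.
have cB : #|{: B}| = ((gamma + b) ^ s)%N by rewrite card_ffun card_sum !card_ord addnC.
have cC : #|[pred k : B | constant_branch k]| = (b ^ s)%N.
  rewrite -[X in (_ ^ X)%N](card_ord s) -[X in (X ^ _)%N](card_ord b).
  rewrite -(card_codom (@inl_inj 'I_b 'I_gamma)) -card_ffun_on; apply: eq_card => k.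
  apply/forallP/ffun_onP => h i; have := h i.
    by case: (k i) => // j _; exact: codom_f.
  by case/codomP => j ->.
rewrite (bigID [pred k : B | constant_branch k]) /=.
rewrite (eq_bigr (fun=> gamma)) => [|k kc]; last by rewrite size_Num kc.
rewrite [X in (_ + X + _)%N](eq_bigr (fun=> d)) => [|k /negPf kc]; last by rewrite size_Num kc.
rewrite !sum_nat_const cC -cB -(cardC [pred k : B | constant_branch k]) cC.
rewrite [X in (_ + X * _ + _ = _)%N](_ : _ = #|[predC [pred k : B | constant_branch k]]|).
  move: #|_| (b ^ s)%N => m n; lia.
exact: eq_card.
Qed.

Let no_infinity (t : 'rV[K]_s) i0 : t 0 i0 = 1 ->
  (forall j, t 0 j ^+ (gamma + b) = t 0 j ^+ b) ->
  \sum_i cf i * t 0 i ^+ e = 0 -> False.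
Proof.
move=> ti tj /(powers_of_3_independent (u := fun i => t 0 i ^+ e)) h.
have /h/(_ i0) : forall j, t 0 j ^+ e = 0 \/ `|t 0 j ^+ e| = 1.
  move=> j; have [->|t0] := eqVneq (t 0 j) 0; first by left; rewrite expr0n.
  right; have : t 0 j ^+ gamma = 1.
    by apply: (mulIf (expf_neq0 b t0)); rewrite -exprD tj mul1r.
  move=> /(congr1 Num.norm); rewrite normrX normr1 => /eqP.
  by rewrite pexpr_eq1 ?normr_ge0 // normrX => /eqP ->; rewrite expr1n.
by rewrite ti expr1n => /eqP; rewrite oner_eq0.
Qed.

Lemma distinct_degrees_example : exists N,
  [/\ (gamma * N + e * b ^ s = d * (gamma + b) ^ s)%N,
    holds_for_general_pair d e
      [set fg : mpoly s K * mpoly s K | (alg_critical fg.1 fg.2 #= `I_N)%card] &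
    holds_for_general_pair e d
      [set fg : mpoly s K * mpoly s K | (alg_critical fg.1 fg.2 #= `I_N)%card]].
Proof.
have [| | | | | | | | | | |c [zs [uzs zsP znd zsize]]] := @separated_count K s P Q c' gamma
  [the finType of B] T bad Num (fun=> 1) G gamma_gt0 bad_neq0.
- by rewrite /bad rootM rootX eqxx.
- exact: branchP.
- exact: branch_inj.
- exact: branch_simple.
- by move=> k; exact: oner_neq0.
- by move=> k; exact: coprimep1.
- by move=> k; rewrite size_poly1 size_Num; case: ifP.
- by move=> mu _ k; rewrite hornerC oner_eq0 NumE divr1.
- exact: G_neq0.
- by move=> mu _ k; rewrite rootE GE.
- exact: pencil_neq0.
exists (size zs).
have sf : (msize (separated P c) <= d.+1)%N by apply: msize_separated.
have sg : (msize (separated Q c') <= e.+1)%N by apply: msize_separated.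
have [||h1 h2] := @general_count_of_example _ _ nu s d e (separated P c) (separated Q c') zs
  s_gt0 (conj sf sg) uzs zsP znd; last first.
  by split=> //; have := count_branches; rewrite -zsize -addnS mulnDl; lia.
- move=> f1 g1 [/= sf1 sg1].
  have /choice[hA hAP] j : exists h, homogenization (gamma + b) (mderiv j (separated P c)) h /\
      forall t : 'rV[K]_s, h (t, 0) = cf j * t 0 j ^+ (gamma + b).
    have [|h hh hE] := @homogenization_partial _ _ P c j d _ sizeP => //.
    exists h; split=> // t; rewrite hE derivP coefZ coefXnM ltnNge leq_addr /= addKn.
    by rewrite falling_lead mulr1.
  have /choice[hB hBP] j : exists h, homogenization b (mderiv j (separated Q c')) h /\
      forall t : 'rV[K]_s, h (t, 0) = cf j * t 0 j ^+ b.
    have [|h hh hE] := @homogenization_partial _ _ Q c' j e _ sizeQ => //.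
    by exists h; split=> // t; rewrite hE derivQ coefZ falling_lead mulr1.
  have [hA0 hA0P hA0E] := @homogenization_separated _ _ P c d sizeP.
  have [hB0 hB0P hB0E] := @homogenization_separated _ _ Q c' e sizeQ.
  apply: (@singular_members_bounded _ _ nu s (separated P c) (separated Q c') f1 g1
    (separated P c) (separated Q c') f1 g1 d e d e hA hB hA0 hB0) => //.
  + by rewrite /= addSn addnS.
  + by move=> j; case: (hAP j).
  + by move=> j; case: (hBP j).
  + by move=> t a b0 eps [].
  move=> t i ti cross last.
  have tj j : t 0 j ^+ (gamma + b) = t 0 j ^+ b.
    have := cross j; rewrite !(proj2 (hAP _)) !(proj2 (hBP _)) ti !expr1n !mulr1.
    rewrite mulrAC [RHS]mulrA; rewrite [cf i * _]mulrC.
    by move/(mulfI (mulf_neq0 (cf_neq0 j) (cf_neq0 i))).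
  apply: (no_infinity ti tj).
  have := last; rewrite hA0E hB0E (proj2 (hAP _)) (proj2 (hBP _)) ti !expr1n mulr1 !mulr0 !addr0.
  rewrite mulrC => /(mulfI (cf_neq0 i))/eqP; rewrite -subr_eq0 -sumrB.
  rewrite (eq_bigr (fun j => (d%:R^-1 - e%:R^-1) * (cf j * t 0 j ^+ e))) => [|j _].
    by rewrite -mulr_sumr mulf_eq0 (negPf de_neq) => /eqP.
  by rewrite coefP coefQ !exprS tj; ring.
- move=> t [h0 h]; have := c'P (t := t); rewrite -meval_separated h0 eqxx => F.
  suff : false by [].
  apply: F => i; rewrite rootE; have := h i; rewrite mderiv_separated meval_in_variable => ->.
  by rewrite eqxx.
Qed.

End DistinctDegrees.

Lemma count_distinct_degrees (K : numClosedFieldType) (R : realType) (nu : proper_absval K R)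
    (s b gamma N : nat) : (0 < s)%N -> (0 < gamma)%N ->
  (gamma * N + b.+1 * b ^ s = (gamma + b).+1 * (gamma + b) ^ s)%N ->
  holds_for_general_pair (gamma + b).+1 b.+1
    [set fg : mpoly s K * mpoly s K | (alg_critical fg.1 fg.2 #= `I_N)%card] /\
  holds_for_general_pair b.+1 (gamma + b).+1
    [set fg : mpoly s K * mpoly s K | (alg_critical fg.1 fg.2 #= `I_N)%card].
Proof.
move=> s0 gamma0 NE.
pose Q (i : 'I_s) : {poly K} := 3 ^+ i *: integral (falling K b).
have [i|c' c'P] := @constant_avoiding K s Q (fun i => (Q i)^`()).
  by rewrite derivZ deriv_integral scaler_eq0 negb_or expf_neq0 ?pnatr_eq0 // falling_neq0.
have [M [ME h h']] := distinct_degrees_example nu s0 gamma0 c'P.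
suff -> : N = M by [].
apply/eqP; rewrite -(eqn_pmul2l gamma0) -(eqn_add2r (b.+1 * b ^ s)); apply/eqP.
by rewrite NE ME.
Qed.

(** * Sums of partial fractions *)

Section PartialFractions.
Variables (K : fieldType) (s : nat) (a : 'I_s -> K).
Hypothesis a_inj : injective a.
Implicit Types (A : pred 'I_s) (m : nat) (p c : {poly K}).

(** [X ^ m p(1 / X)] *)
Definition reversal m p : {poly K} := \poly_(k < m.+1) p`_(m - k).

Lemma horner_reversal m p y : (size p <= m.+1)%N -> y != 0 ->
  (reversal m p).[y] = y ^+ m * p.[y^-1].
Proof.
move=> pm y0; rewrite horner_poly (horner_coef_wide _ pm) mulr_sumr [RHS](reindex_inj rev_ord_inj).
apply: eq_bigr => k _ /=; rewrite subSS mulrCA; congr (_ * _).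
have km : (k <= m)%N by rewrite -ltnS.
by rewrite exprVn -{2}(subnKC km) exprD mulfK ?expf_neq0.
Qed.

Definition poles m A : {poly K} := \prod_(i | A i) ('X - (a i)%:P) ^+ m.

(** The numerator of [c + \sum_(i | A i) p(1 / (X - a i))] over the denominator [poles m A]. *)
Definition fraction_numerator m A c p : {poly K} := poles m A * c +
  \sum_(i | A i) (reversal m p \Po ('X - (a i)%:P)) * poles m [pred j | A j & j != i].

Lemma horner_poles m A x : (poles m A).[x] = \prod_(i | A i) (x - a i) ^+ m.
Proof. by rewrite horner_prod; apply: eq_bigr => i _; rewrite horner_exp hornerXsubC. Qed.

Lemma horner_poles_neq0 m A x : (forall i, A i -> x != a i) -> (poles m A).[x] != 0.
Proof.
move=> h; rewrite horner_poles prodf_seq_neq0; apply/allP => i _ /=; apply/implyP => /h xi.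
by rewrite expf_neq0 // subr_eq0.
Qed.

Lemma polesD1 m A i : A i -> poles m A = ('X - (a i)%:P) ^+ m * poles m [pred j | A j & j != i].
Proof. by move=> Ai; rewrite /poles (bigD1 i). Qed.

Lemma horner_fraction m A c p x : (size p <= m.+1)%N -> (forall i, A i -> x != a i) ->
  (fraction_numerator m A c p).[x] =
  (poles m A).[x] * (c.[x] + \sum_(i | A i) p.[(x - a i)^-1]).
Proof.
move=> pm h; rewrite hornerD hornerM mulrDr horner_sum mulr_sumr; congr (_ + _).
apply: eq_bigr => i Ai; rewrite hornerM horner_comp hornerXsubC horner_reversal ?subr_eq0 ?h //.
by rewrite (polesD1 _ Ai) hornerM horner_exp hornerXsubC mulrAC.
Qed.

Lemma fraction_numerator_pole m A c p i : (0 < m)%N -> A i -> p`_m != 0 ->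
  (fraction_numerator m A c p).[a i] != 0.
Proof.
move=> m0 Ai pm; have P0 (B : pred 'I_s) : B i -> (poles m B).[a i] = 0.
  by move=> Bi; rewrite (polesD1 _ Bi) hornerM horner_exp hornerXsubC subrr expr0n gtn_eqF ?mul0r.
rewrite hornerD hornerM P0 // mul0r add0r horner_sum (bigD1 i) //=.
rewrite [X in _ + X]big1 => [|j /andP[Aj ji]].
  rewrite addr0 hornerM horner_comp hornerXsubC subrr horner_coef0 coef_poly subn0 mulf_neq0 //.
  apply: horner_poles_neq0 => j /= /andP[_ ij].
  by rewrite eq_sym (inj_eq a_inj).
by rewrite hornerM P0 ?mulr0 //= Ai eq_sym.
Qed.

Lemma fraction_coprime m A c p : (0 < m)%N -> p`_m != 0 ->
  coprimep (fraction_numerator m A c p) (poles m A).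
Proof.
move=> m0 pm; rewrite /poles; elim/big_rec: _ => [|i q Ai h]; first exact: coprimep1.
rewrite coprimepMr h andbT coprimep_expr // coprimep_XsubC.
exact: fraction_numerator_pole.
Qed.

Lemma poles_neq0 m A : poles m A != 0.
Proof.
rewrite prodf_seq_neq0; apply/allP => i _.
by rewrite /= expf_neq0 ?polyXsubC_eq0 ?implybT.
Qed.

Lemma size_poles m A : size (poles m A) = (m * #|A|).+1.
Proof.
rewrite size_prod => [|i _]; last by rewrite expf_neq0 ?polyXsubC_eq0.
rewrite (eq_bigr (fun=> m.+1)) => [|i _]; last by rewrite size_exp_XsubC.
rewrite sum_nat_const mulnS subSn ?leq_addr // addKn mulnC //.
Qed.

Lemma size_fraction m A c p : (1 < size c)%N ->
  size (fraction_numerator m A c p) = (m * #|A| + size c)%N.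
Proof.
move=> c1; have c0 : c != 0 by rewrite -size_poly_gt0 ltnW.
have sM : size (poles m A * c) = (m * #|A| + size c)%N.
  by rewrite size_mul ?poles_neq0 // size_poles.
rewrite size_polyDl sM // (leq_ltn_trans (size_sum _ _ _)) //.
rewrite -(prednK (ltnW c1)) addnS ltnS; apply/bigmax_leqP => i Ai.
apply: leq_trans (size_polyMleq _ _) _; rewrite size_poles addnS /=.
rewrite (cardD1x Ai) mulnDr muln1 addnAC leq_add2r.
have := size_comp_poly_leq (reversal m p) ('X - (a i)%:P).
rewrite size_XsubC muln1 => /leq_trans; apply.
have r : ((size (reversal m p)).-1 <= m)%N.
  by have := size_poly m.+1 (fun k => p`_(m - k)); rewrite -/(reversal m p); case: size.
by rewrite -addn1 leq_add // -ltnS prednK // ltnW.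
Qed.

End PartialFractions.

(** * An example with equal degrees *)

Section EqualDegrees.
Variables (K : numClosedFieldType) (R : realType) (nu : proper_absval K R) (s b : nat).
Hypothesis s_gt0 : (0 < s)%N.
Local Notation m := b.+1.
Local Notation d := b.+2.
Local Notation w := (falling K b).

(* With the multiplier [mu], the partial derivatives differ by the factors [(i - mu) X + 1] and [w],
   so that each coordinate is a root of [w] or [1 / (mu - i)]. If [n] coordinates are of the
   second kind, clearing denominators in the last equation gives degree [1 + n (d - 1)] in [mu]. *)
Let a (i : 'I_s) : K := (i : nat)%:R.
Let q : {poly K} := integral ('X * w).
Let W : {poly K} := integral w.
Let P (i : 'I_s) : {poly K} := a i *: q + W.
Let Q (_ : 'I_s) : {poly K} := q.

Let a_inj : injective a.
Proof. by move=> i j /eqP; rewrite eqr_nat => /eqP/val_inj. Qed.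

Let derivq : q^`() = 'X * w. Proof. exact: deriv_integral. Qed.

Let derivP i : (P i)^`() = a i *: ('X * w) + w.
Proof. by rewrite derivD derivZ derivq deriv_integral. Qed.

Let q0 : q.[0] = 0. Proof. by rewrite horner_coef0 coef_integral invr0 mulr0. Qed.

Let coefq : q`_d = d%:R^-1.
Proof. by rewrite coef_integral coefXM /= falling_lead mul1r. Qed.

Let coefW : W`_m = m%:R^-1.
Proof. by rewrite coef_integral /= falling_lead mul1r. Qed.

Let sizeq : (size q <= d.+1)%N.
Proof.
by rewrite (leq_trans (size_integral _)) // mulrC size_mulX ?falling_neq0 // size_falling.
Qed.

Let sizeW : (size W <= d)%N.
Proof. by rewrite (leq_trans (size_integral _)) // size_falling. Qed.

Let sizeP i : (size (P i) <= d.+1)%N.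
Proof.
rewrite (leq_trans (size_polyD _ _)) // geq_max (leq_trans (size_scale_leq _ _)) //=.
exact: leqW.
Qed.

Local Notation B := {ffun 'I_s -> option 'I_b}.

Local Notation tau := (@falling_root K b).

Let T (k : B) (mu : K) : 'rV[K]_s :=
  \row_i if k i is Some j then tau j else (mu - a i)^-1.

Let bad : {poly K} := 'X * \prod_i ('X - (a i)%:P) *
  \prod_i \prod_(z <- first_nats K b) (z *: ('X - (a i)%:P) - 1).

Let bad_neq0 : bad != 0.
Proof.
rewrite !mulf_neq0 ?polyX_eq0 // prodf_seq_neq0; apply/allP => i _ /=.
  by rewrite polyXsubC_eq0.
rewrite prodf_seq_neq0; apply/allP => z _ /=; apply/eqP => /(congr1 (horner^~ (a i))).
rewrite hornerD hornerN hornerZ hornerXsubC subrr mulr0 !hornerC sub0r => /eqP.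
by rewrite oppr_eq0 oner_eq0.
Qed.

Let badP mu : ~~ root bad mu -> (forall i, mu != a i) /\
  forall i z, z \in first_nats K b -> (mu - a i)^-1 != z.
Proof.
rewrite !rootM !negb_or => /andP[/andP[_ h1] h2].
have mua i : mu != a i.
  apply: contra h1; rewrite rootE horner_prod => /eqP ->.
  by rewrite (bigD1 i) //= hornerXsubC subrr mul0r.
split=> // i z zr; apply: contra h2 => /eqP e.
rewrite rootE horner_prod (bigD1 i) //= horner_prod.
suff -> : \prod_(y <- first_nats K b) (y *: ('X - (a i)%:P) - 1).[mu] = 0 by rewrite mul0r.
apply/eqP; rewrite prodf_seq_eq0; apply/hasP; exists z => //=.
by rewrite hornerD hornerN hornerZ hornerXsubC !hornerC -e mulVf ?subrr // subr_eq0.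
Qed.

Let gradient mu i (x : K) : (forall j, mu != a j) ->
  (P i)^`().[x] = mu ^+ 1 * (Q i)^`().[x] <-> x = (mu - a i)^-1 \/ x \in first_nats K b.
Proof.
move=> mua; have mi : mu - a i != 0 by rewrite subr_eq0.
have -> : (x = (mu - a i)^-1) <-> ((a i - mu) * x + 1 = 0).
  split=> [->|h]; first by rewrite -opprB mulNr divff // addNr.
  apply: (mulfI mi); rewrite divff //; apply/eqP; rewrite -subr_eq0 -oppr_eq0 -h.
  by apply/eqP; ring.
rewrite derivP derivq -root_falling rootE hornerD hornerZ hornerM hornerX.
have -> : (a i * (x * w.[x]) + w.[x] = mu ^+ 1 * (x * w.[x])) <->
    ((a i - mu) * x + 1) * w.[x] = 0.
  have -> : ((a i - mu) * x + 1) * w.[x] =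
      a i * (x * w.[x]) + w.[x] - mu ^+ 1 * (x * w.[x]) by ring.
  by split=> [->|/eqP]; rewrite ?subrr // subr_eq0 => /eqP.
split=> [/eqP|[->|/eqP ->]]; rewrite ?mul0r ?mulr0 //.
by rewrite mulf_eq0 => /orP[/eqP|]; [left|right].
Qed.

Let branchP mu : ~~ root bad mu -> forall t : 'rV[K]_s,
  (forall i, (P i)^`().[t 0 i] = mu ^+ 1 * (Q i)^`().[t 0 i]) <-> exists k, t = T k mu.
Proof.
move=> /badP[mua _] t; split=> [h|[k ->] i]; last first.
  by apply/gradient => //; rewrite mxE; case: (k i) => [j|]; [right; exact: falling_root_mem|left].
have /choice[k kP] : forall i, exists x : option 'I_b,
    t 0 i = if x is Some j then tau j else (mu - a i)^-1.
  move=> i; have /gradient[//|->|/falling_root_surj[j ->]] := h i; first by exists None.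
  by exists (Some j).
by exists [ffun i => k i]; apply/rowP => i; rewrite mxE ffunE.
Qed.

Let branch_inj mu : ~~ root bad mu -> injective (T^~ mu).
Proof.
move=> /badP[mua h] k k' /rowP e; apply/ffunP => i; have := e i; rewrite !mxE.
have neq j : tau j <> (mu - a i)^-1.
  by move=> /esym/eqP; rewrite (negPf (h _ _ (falling_root_mem K j))).
case: (k i) (k' i) => [j|] [j'|] //.
- by move/falling_root_inj => ->.
- by move/neq.
- by move/esym/neq.
Qed.

Let branch_simple mu : ~~ root bad mu -> forall k i,
  ((P i)^`()^`() - mu ^+ 1 *: (Q i)^`()^`()).[T k mu 0 i] != 0.
Proof.
move=> /badP[mua h] k i; set x := T k mu 0 i.
have mi : mu - a i != 0 by rewrite subr_eq0.
have -> : ((P i)^`()^`() - mu ^+ 1 *: (Q i)^`()^`()).[x] =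
    (a i - mu) * w.[x] + ((a i - mu) * x + 1) * w^`().[x].
  rewrite derivP derivq derivD derivZ derivM derivX.
  by rewrite !(hornerD, hornerN, hornerZ, hornerM, hornerX, hornerC); ring.
rewrite {}/x mxE; case: (k i) => [j|].
  have /eqP -> : w.[tau j] == 0 by rewrite -/(root _ _) root_falling falling_root_mem.
  rewrite mulr0 add0r mulf_neq0 ?deriv_falling_neq0 ?falling_root_mem //.
  apply: contra (h i _ (falling_root_mem K j)) => /eqP e.
  apply/eqP; apply: (mulfI mi); rewrite divff //.
  by apply/eqP; rewrite -subr_eq0; apply/eqP; rewrite -[RHS]e; ring.
have -> : (a i - mu) / (mu - a i) + 1 = 0 by rewrite -opprB mulNr divff // addNr.
rewrite mul0r addr0 mulf_neq0 //; first by rewrite -opprB oppr_eq0.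
rewrite -/(root _ _) root_falling; apply/negP => hh.
by have := h i _ hh; rewrite eqxx.
Qed.

Let pencil_neq0 l i : (P i)^`() - l *: (Q i)^`() != 0.
Proof.
have -> : (P i)^`() - l *: (Q i)^`() = ((a i - l) *: 'X + 1) * w.
  by rewrite derivP derivq -!mul_polyC polyCB; ring.
rewrite mulf_neq0 ?falling_neq0 //; apply/eqP => /(congr1 (horner^~ 0)).
by rewrite hornerD hornerZ hornerX mulr0 !hornerC add0r => /eqP; rewrite oner_eq0.
Qed.

Variable c' : K.
Hypothesis c'P : forall t : 'rV[K]_s, (forall i, root (q^`()) (t 0 i)) ->
  \sum_i (Q i).[t 0 i] + c' != 0.

Let free (k : B) : pred 'I_s := [pred i | k i == None].

Let cP (k : B) : K := \sum_i if k i is Some j then (P i).[tau j] else 0.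
Let cQ (k : B) : K := \sum_(i < s) (if k i is Some j then q.[tau j] else 0) + c'.

Let q1 : {poly K} := drop_poly 1 q.
Let S : {poly K} := W - q1.

Let q1E : q = q1 * 'X.
Proof.
rewrite -{1}(poly_take_drop 1 q) expr1 (_ : take_poly 1 q = 0) ?add0r //.
apply/polyP => k; rewrite coef_take_poly coef0; case: k => //=.
by rewrite -horner_coef0 q0.
Qed.

Let sizeS : (size S <= m.+1)%N.
Proof.
rewrite (leq_trans (size_polyD _ _)) // size_polyN geq_max sizeW size_drop_poly.
by rewrite leq_subLR add1n.
Qed.

Let coefS : S`_m != 0.
Proof.
rewrite coefB coefW coef_drop_poly addn1 coefq subr_eq0 (inj_eq invr_inj) eqr_nat.
by rewrite neq_ltn ltnSn.
Qed.

Let Num (k : B) := fraction_numerator a m (free k) ((cP k)%:P - cQ k *: 'X) S.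
Let G (k : B) := fraction_numerator a d (free k) (cQ k)%:P q.

Let NumE mu : (forall i, mu != a i) -> forall k,
  \sum_i (P i).[T k mu 0 i] - mu ^+ 1 * (\sum_i (Q i).[T k mu 0 i] + c') =
  (Num k).[mu] / (poles a m (free k)).[mu].
Proof.
move=> mua k; rewrite /Num horner_fraction ?poles_neq0 // mulrAC divff ?mul1r; last first.
  exact: horner_poles_neq0.
rewrite hornerD hornerN hornerZ hornerX hornerC mulrDr mulr_sumr opprD addrA -sumrB.
rewrite /cP /cQ mulrDl opprD mulr_suml [mu ^+ 1 * c']mulrC [in RHS]addrA -sumrB.
rewrite [in RHS]addrAC (big_mkcond (free k)) -big_split /=; congr (_ - _).
apply: eq_bigr => i _; rewrite mxE /free /=; case: (k i) => [j|] /=; first by rewrite addr0 mulrC.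
have QE : Q i = q1 * 'X := q1E.
rewrite QE mul0r subrr add0r hornerD hornerZ hornerD hornerN q1E !hornerM hornerX.
have mi : mu - a i != 0 by rewrite subr_eq0.
have -> : mu ^+ 1 * (q1.[(mu - a i)^-1] * (mu - a i)^-1) =
  a i * (q1.[(mu - a i)^-1] * (mu - a i)^-1) + q1.[(mu - a i)^-1].
  by rewrite -[X in _ = _ + X](mulfK mi); ring.
by ring.
Qed.

Let GE mu : (forall i, mu != a i) -> forall k,
  \sum_i (Q i).[T k mu 0 i] + c' = (G k).[mu] / (poles a d (free k)).[mu].
Proof.
move=> mua k; rewrite /G horner_fraction // mulrAC divff ?mul1r; last first.
  exact: horner_poles_neq0.
rewrite hornerC /cQ addrAC; congr (_ + _).
rewrite (big_mkcond (free k)) -big_split /=; apply: eq_bigr => i _; rewrite mxE /free /=.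
by case: (k i) => [j|] /=; rewrite ?addr0 ?add0r.
Qed.

Let cQ_neq0 k : cQ k != 0.
Proof.
pose t : 'rV[K]_s := \row_i if k i is Some j then tau j else 0.
have -> : cQ k = \sum_i (Q i).[t 0 i] + c'.
  by congr (_ + _); apply: eq_bigr => i _; rewrite mxE; case: (k i); rewrite ?q0.
apply: c'P => i; rewrite derivq mxE rootM rootX; case: (k i) => [j|]; last by rewrite eqxx.
by rewrite root_falling falling_root_mem orbT.
Qed.

Let G_neq0 k : G k != 0.
Proof.
case: (pickP (free k)) => [i ki|none].
  have : (G k).[a i] != 0 by apply: fraction_numerator_pole; rewrite // coefq invr_eq0 pnatr_eq0.
  by apply: contra => /eqP ->; rewrite horner0.
by rewrite /G /fraction_numerator /poles !big_pred0 // addr0 mul1r polyC_eq0.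
Qed.

Let size_c k : size ((cP k)%:P - cQ k *: 'X) = 2.
Proof.
rewrite addrC -scaleNr size_polyDl size_scale ?oppr_eq0 // size_polyX //.
by rewrite ltnS size_polyC_leq1.
Qed.

Let size_Num k : size (Num k) = (m * #|free k|).+2.
Proof. by rewrite size_fraction size_c // addn2. Qed.

Let count_branches : (\sum_(k : B) (size (Num k)).-1 = s.+1 * m ^ s)%N.
Proof.
rewrite (eq_bigr (fun k : B => 1 + \sum_(i < s) if k i == None then m else 0)%N); last first.
  by move=> k _; rewrite size_Num /= -big_mkcond sum_nat_const mulnC.
rewrite big_split sum1_card card_ffun card_option !card_ord /= mulSn; congr (_ + _)%N.
rewrite exchange_big /= (eq_bigr (fun=> m ^ s)%N) => [|i _].
  by rewrite sum_nat_const card_ord.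
pose F (j : 'I_s) (x : option 'I_b) := if j == i then if x == None then m else 0%N else 1%N.
rewrite (eq_bigr (fun k : B => \prod_j F j (k j))%N) => [|k _]; last first.
  rewrite (bigD1 i) //= /F eqxx big1 ?muln1 // => j /negPf -> //.
rewrite -(bigA_distr_bigA F) /= (eq_bigr (fun=> m)).
  by rewrite prod_nat_const card_ord.
move=> j _; rewrite /F; case: eqP => _; last by rewrite sum1_card card_option card_ord.
by rewrite (bigD1 None) //= big1 ?addn0 // => -[].
Qed.

Lemma equal_degrees_example :
  holds_for_general_pair d d
    [set fg : mpoly s K * mpoly s K | (alg_critical fg.1 fg.2 #= `I_(s.+1 * m ^ s)%N)%card].
Proof.
have [| | | | | | | | | | |c [zs [uzs zsP znd zsize]]] := @separated_count K s P Q c' 1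
  [the finType of B] T bad Num (fun k => poles a m (free k)) G isT bad_neq0.
- by rewrite /bad !rootM rootX eqxx.
- exact: branchP.
- exact: branch_inj.
- exact: branch_simple.
- by move=> k; exact: poles_neq0.
- by move=> k; exact: fraction_coprime.
- by move=> k; rewrite size_Num size_poles.
- by move=> mu /badP[mua _] k; rewrite -NumE //; split=> //; exact: horner_poles_neq0.
- exact: G_neq0.
- move=> mu /badP[mua _] k Gmu; rewrite GE // mulf_neq0 // invr_eq0; exact: horner_poles_neq0.
- exact: pencil_neq0.
rewrite -count_branches -zsize mul1n.
have sf : (msize (separated P c) <= d.+1)%N by apply: msize_separated.
have sg : (msize (separated Q c') <= d.+1)%N by apply: msize_separated.
have [||//] := @general_count_of_example _ _ nu s d d (separated P c) (separated Q c') zs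
  s_gt0 (conj sf sg) uzs zsP znd.
- move=> t [h0 h]; have := c'P (t := t); rewrite -meval_separated h0 eqxx => F.
  suff : false by [].
  apply: F => i; rewrite rootE; have := h i; rewrite mderiv_separated meval_in_variable => ->.
  by rewrite eqxx.
move=> f1 g1 [/= sf1 sg1].
have /choice[hA hAP] j : exists h, homogenization m (mderiv j (separated P c)) h /\
    forall t : 'rV[K]_s, h (t, 0) = a j * t 0 j ^+ m.
  have [|h hh hE] := @homogenization_partial _ _ P c j d _ sizeP => //.
  exists h; split=> // t; rewrite hE derivP coefD coefZ coefXM /= falling_lead mulr1.
  by rewrite [w`_m]nth_default ?addr0 // size_falling.
have /choice[hB hBP] j : exists h, homogenization m (mderiv j (separated Q c')) h /\
    forall t : 'rV[K]_s, h (t, 0) = t 0 j ^+ m.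
  have [|h hh hE] := @homogenization_partial _ _ Q c' j d _ (fun=> sizeq) => //.
  by exists h; split=> // t; rewrite hE derivq coefXM /= falling_lead mul1r.
have coef_euler (p : {poly K}) k : (d%:R *: p - 'X * p^`())`_k = (d%:R - k%:R) * p`_k.
  rewrite coefB coefZ coefXM; case: k => [|k] /=; first by rewrite !subr0.
  by rewrite coef_deriv -[_ *+ k.+1]mulr_natl mulrBl.
have size_euler (p : {poly K}) : (size p <= d.+1)%N -> (size (d%:R *: p - 'X * p^`())%R <= m.+1)%N.
  move=> pd; apply/leq_sizeP => k mk; rewrite coef_euler.
  have [->|kd] := eqVneq k d; first by rewrite subrr mul0r.
  by rewrite [p`_k]nth_default ?mulr0 // (leq_trans pd) // ltn_neqAle eq_sym kd.
have dm1 : d%:R - m%:R = 1 :> K by rewrite -natrB // subSnn.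
have [hA0 + hA0E] := @homogenization_separated _ _
  (fun i => d%:R *: P i - 'X * (P i)^`()) (d%:R * c) m (fun i => size_euler _ (sizeP i)).
have [hB0 + hB0E] := @homogenization_separated _ _
  (fun i => d%:R *: Q i - 'X * (Q i)^`()) (d%:R * c') m (fun i => size_euler _ sizeq).
rewrite -!euler_defect_separated => hB0P hA0P.
apply: (@singular_members_bounded _ _ nu s (separated P c) (separated Q c') f1 g1
  (euler_defect d (separated P c)) (euler_defect d (separated Q c'))
  (euler_defect d f1) (euler_defect d g1) d d m m hA hB hA0 hB0) => //.
- exact: msize_euler_defect.
- exact: msize_euler_defect.
- by move=> j; case: (hAP j).
- by move=> j; case: (hBP j).
- by move=> t x y eps /(singular_member_euler d); rewrite !euler_defect_linear.
move=> t i ti cross.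
have tj j : j != i -> t 0 j ^+ m = 0.
  move=> ji; have := cross j; rewrite !(proj2 (hAP _)) !(proj2 (hBP _)) ti !expr1n !mulr1.
  by move/eqP; rewrite -subr_eq0 -mulrBl mulf_eq0 subr_eq0 (inj_eq a_inj) (negPf ji) => /eqP.
have sumE (x : 'I_s -> K) : \sum_j x j * t 0 j ^+ m = x i.
  rewrite (bigD1 i) //= big1 => [|j ji]; first by rewrite ti expr1n mulr1 addr0.
  by rewrite tj ?mulr0.
rewrite hA0E hB0E (proj2 (hAP _)) (proj2 (hBP _)) !sumE ti !expr1n !mulr1 !mulr0 !addr0.
rewrite !coef_euler dm1 !mul1r coefD coefZ coefW => /eqP.
by rewrite -subr_eq0 addrAC subrr add0r invr_eq0 pnatr_eq0.
Qed.

End EqualDegrees.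

Lemma count_equal_degrees (K : numClosedFieldType) (R : realType) (nu : proper_absval K R)
    (s b : nat) : (0 < s)%N ->
  holds_for_general_pair b.+2 b.+2
    [set fg : mpoly s K * mpoly s K | (alg_critical fg.1 fg.2 #= `I_(s.+1 * b.+1 ^ s)%N)%card].
Proof.
move=> s0; pose q : {poly K} := integral ('X * falling K b).
have [i|c' c'P] := @constant_avoiding K s (fun=> q) (fun=> q^`()).
  by rewrite deriv_integral mulf_neq0 ?polyX_eq0 ?falling_neq0.
exact: (equal_degrees_example nu s0 c'P).
Qed.

Section LinearPencil.
Variables (K : numClosedFieldType) (R : realType) (nu : proper_absval K R) (s : nat).

(** A quotient [(l + 1) / l], with [l] a linear form, has no critical point. *)
Lemma count_linear : (0 < s)%N -> holds_for_general_pair 1 1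
  [set fg : mpoly s K * mpoly s K | (alg_critical fg.1 fg.2 #= `I_0)%card].
Proof.
move=> s0; pose P (i : 'I_s) : {poly K} := 'X.
have sP i : (size (P i) <= 2)%N by rewrite size_polyX.
have sf c : (msize (separated P c) <= 2)%N by exact: msize_separated.
have dP c (t : 'rV[K]_s) j : meval (t 0) (mderiv j (separated P c)) = 1.
  by rewrite mderiv_separated meval_in_variable derivX hornerC.
have [|||||//] := @general_count_of_example _ _ nu s 1 1 (separated P 1) (separated P 0) [::] s0
  (conj (sf 1) (sf 0)).
- by [].
- move=> t l; split=> // -[]; rewrite !meval_separated addr0 => h0 /(_ (Ordinal s0)).
  rewrite !dP mulr1 => l1; move: h0; rewrite -l1 mul1r => /eqP.
  by rewrite -subr_eq0 addrAC subrr add0r oner_eq0.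
- by [].
- by move=> t [_ /(_ (Ordinal s0))/eqP]; rewrite dP oner_eq0.
move=> f1 g1 [/= sf1 sg1].
have top c j : exists h, homogenization 0 (mderiv j (separated P c)) h /\
    forall t : 'rV[K]_s, h (t, 0) = 1.
  have [|h hh hE] := @homogenization_partial _ _ P c j 1 _ sP => //.
  by exists h; split=> // t; rewrite hE derivX coefC mulr1.
have /choice[hA hAP] := top 1; have /choice[hB hBP] := top 0.
have sE (i : 'I_s) : (size (1 *: P i - 'X * (P i)^`())%R <= 1)%N.
  by rewrite scale1r derivX mulr1 subrr size_poly0.
have [hA0 + hA0E] := @homogenization_separated _ _ _ (1 * 1) 0 sE.
have [hB0 + hB0E] := @homogenization_separated _ _ _ (1 * 0) 0 sE.
rewrite -!(euler_defect_separated 1) => hB0P hA0P.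
apply: (@singular_members_bounded _ _ nu s (separated P 1) (separated P 0) f1 g1
  (euler_defect 1 (separated P 1)) (euler_defect 1 (separated P 0))
  (euler_defect 1 f1) (euler_defect 1 g1) 1 1 0 0 hA hB hA0 hB0) => //.
- exact: msize_euler_defect.
- exact: msize_euler_defect.
- by move=> j; case: (hAP j).
- by move=> j; case: (hBP j).
- by move=> t x y eps /(singular_member_euler 1); rewrite !euler_defect_linear.
move=> t i _ _; rewrite hA0E hB0E (proj2 (hAP _)) (proj2 (hBP _)) !mulr1 mulr0 mul1r addr0.
by move/eqP; rewrite -subr_eq0 addrAC subrr add0r oner_eq0.
Qed.

End LinearPencil.

(** * The number of critical points of a general quotient *)

(** The complex numbers enter only here, as an algebraically closed field with compact discs. *)
Lemma critical_general (R : realType) (s d e N : nat) :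
  (forall (K : numClosedFieldType) (nu : proper_absval K R),
    holds_for_general_pair d e
      [set fg : mpoly s K * mpoly s K | (alg_critical fg.1 fg.2 #= `I_N)%card]) ->
  holds_for_general_pair d e
    [set fg : mpoly s R[i] * mpoly s R[i] | (critical_points fg.1 fg.2 #= `I_N)%card].
Proof.
move=> H.
have E : critical_points (R := R) (s := s) = @alg_critical _ _.
  by apply/funext => p; apply/funext => q; exact: critical_pointsE.
rewrite E.
exact: (H (complex R) (normc_absval R)).
Qed.

Lemma holds_for_general_pairS (F : comNzRingType) (s d e : nat)
    (A B : set (mpoly s F * mpoly s F)) :
  A `<=` B -> holds_for_general_pair d e A -> holds_for_general_pair d e B.
Proof. by move=> AB [Z [Zc Zp ZA]]; exists Z; split=> //; exact: subset_trans ZA AB. Qed.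

Lemma count_in_rat (s b gamma N : nat) (d := (gamma + b).+1) (e := b.+1) : (0 < gamma)%N ->
  (gamma * N + e * b ^ s = d * (gamma + b) ^ s)%N ->
  N%:Q = (d%:Q * (d%:Q - 1) ^+ s - e%:Q * (e%:Q - 1) ^+ s) / (d%:Q - e%:Q).
Proof.
move=> g0 h.
have pred1 n : n.+1%:Q - 1 = n%:Q by rewrite -addn1 PoszD intrD addrK.
have de : d%:Q - e%:Q = gamma%:Q by rewrite /d /e -addnS PoszD intrD addrK.
rewrite de /d /e !pred1; apply: (mulIf (x := gamma%:Q)); first by rewrite intr_eq0 -lt0n.
rewrite divfK ?intr_eq0 -?lt0n //; apply/eqP; rewrite -subr_eq0 opprB addrA subr_eq0; apply/eqP.
by rewrite -!pmulrn -!natrX -!natrM -natrD mulnC h.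
Qed.

Lemma count_exists (s b gamma : nat) :
  exists N, (gamma * N + b.+1 * b ^ s = (gamma + b).+1 * (gamma + b) ^ s)%N.
Proof.
have le : (b.+1 * b ^ s <= (gamma + b).+1 * (gamma + b) ^ s)%N.
  by apply: leq_mul; [rewrite ltnS leq_addl|case: s => // k; rewrite leq_exp2r // leq_addl].
have /dvdnP[N NE] : (gamma %| (gamma + b).+1 * (gamma + b) ^ s - b.+1 * b ^ s)%N.
  by rewrite -eqn_mod_dvd // -addnS -modnMm -modnXm !modnDl modnXm modnMm.
by exists N; rewrite mulnC -NE subnK.
Qed.

Theorem theorem3p6 (R : realType) (s d e : nat)
    (hs : (1 <= s)%N) (hd : (1 <= d)%N) (he : (1 <= e)%N) :
  holds_for_general_pair d e
    [set fg : mpoly s R[i] * mpoly s R[i] |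
      (d <> e ->
         exists n : nat,
           (critical_points fg.1 fg.2 #= `I_n)%card /\
           n%:Q = (d%:Q * (d%:Q - 1) ^+ s - e%:Q * (e%:Q - 1) ^+ s)
                  / (d%:Q - e%:Q))
      /\
      (d = e ->
         (critical_points fg.1 fg.2 #= `I_((s + 1) * (d - 1) ^ s)%N)%card)].
Proof.
have [de|de] := eqVneq d e.
  apply: (holds_for_general_pairS (A := [set fg : mpoly s R[i] * mpoly s R[i] |
    (critical_points fg.1 fg.2 #= `I_((s + 1) * (d - 1) ^ s)%N)%card])) => [fg h|]; first by split.
  apply: critical_general => K nu; rewrite -{}de {he}; case: d hd => [//|[|b] _].
    by rewrite subnn exp0n // muln0; exact: (count_linear nu hs).
  by rewrite addn1 subSS subn0; exact: (count_equal_degrees nu b hs).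
suff [N [NE H]] : exists N : nat,
    N%:Q = (d%:Q * (d%:Q - 1) ^+ s - e%:Q * (e%:Q - 1) ^+ s) / (d%:Q - e%:Q) /\
    forall (K : numClosedFieldType) (nu : proper_absval K R), holds_for_general_pair d e
      [set fg : mpoly s K * mpoly s K | (alg_critical fg.1 fg.2 #= `I_N)%card].
  apply: holds_for_general_pairS (critical_general H) => fg h; split=> [_|/eqP].
    by exists N.
  by rewrite (negPf de).
case: d e hd he de => [//|a] [//|b] _ _; rewrite eqSS neq_ltn => /orP[ab|ba].
- have [N NE] := count_exists s a (b - a); exists N; split=> [|K nu].
    rewrite -[X in X / _]opprB -[X in _ / X]opprB invrN mulrNN.
    by have := count_in_rat _ NE; rewrite subnK ?(ltnW ab) // subn_gt0; apply.
  have := @count_distinct_degrees K R nu s a (b - a) N hs; rewrite subn_gt0 ab => /(_ isT NE)[_].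
  by rewrite subnK // ltnW.
have [N NE] := count_exists s b (a - b); exists N; split=> [|K nu].
  by have := count_in_rat _ NE; rewrite subnK ?(ltnW ba) // subn_gt0; apply.
have := @count_distinct_degrees K R nu s b (a - b) N hs; rewrite subn_gt0 ba => /(_ isT NE)[+ _].
by rewrite subnK // ltnW.
Qed.
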